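(* Let $M=\{M_\gamma\}_{\gamma\in\Gamma}$ and $N=\{N_\omega\}_{\omega\in\Omega}$ be defining families of functions on $\mathbb C^{k_1}$ and $\mathbb C^{k_2}$ respectively, and let $\Phi\colon\mathcal H(M)\times\mathcal H(N)\to\mathcal H(M\otimes N)$ be the bilinear map $\Phi(f,g)(z,w)=f(z)g(w)$. Suppose $N$ satisfies: (I) for every $\omega\in\Omega$ there exist $\omega'\in\Omega$ and a bounded integrable nonnegative function $L$ on $\mathbb C^{k_2}$ with $N_\omega\le LN_{\omega'}$ and $L(w)\to0$ as $|w|\to\infty$; (II) for every $\omega\in\Omega$ there exist $\omega'\in\Omega$, a neighborhood $B$ of the origin in $\mathbb C^{k_2}$ and $C>0$ with $N_\omega(w)\le CN_{\omega'}(w+w')$ for all $w\in\mathbb C^{k_2}$, $w'\in B$. Then $\Phi$ induces a topological isomorphism $\mathcal H(M)\widehat{\otimes}_\pi\mathcal H(N)\simeq\mathcal H(M\otimes N)$.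
   Context: A defining family of functions on $\mathbb R^n$ is a family $M=\{M_\gamma\}_{\gamma\in\Gamma}$ of nonnegative measurable functions on $\mathbb R^n$, each bounded on bounded subsets, such that: (a) for all $\gamma_1,\gamma_2\in\Gamma$ there are $\gamma\in\Gamma$ and $C>0$ with $M_\gamma\ge C(M_{\gamma_1}+M_{\gamma_2})$; (b) there is a countable $\Gamma'\subset\Gamma$ such that for every $\gamma\in\Gamma$ there are $\gamma'\in\Gamma'$ and $C>0$ with $CM_\gamma\le M_{\gamma'}$; (c) for every $x$ there are $\gamma\in\Gamma$, a neighborhood $O(x)$ of $x$ and $C>0$ with $M_\gamma\ge C$ on $O(x)$. A defining family on $\mathbb C^k$ is a defining family on the underlying real space $\mathbb R^{2k}$. $\mathcal H(M)$ is the space of entire analytic functions $f$ on $\mathbb C^k$ with finite seminorms $\|f\|_\gamma=\sup_{z\in\mathbb C^k}M_\gamma(z)|f(z)|$, $\gamma\in\Gamma$, topologized by them. $M\otimes N$ is the defining family on $\mathbb C^{k_1+k_2}$ given by $(M\otimes N)_{\gamma\omega}(z,w)=M_\gamma(z)N_\omega(w)$. $\widehat{\otimes}_\pi$ denotes the completed projective tensor product. *)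

(* Defs.v *)
From HB Require Import structures.
From mathcomp Require Import all_boot all_order all_algebra.
From mathcomp Require Import all_classical all_reals all_analysis.
From mathcomp Require Import complex.
From Stdlib Require List.

Set Implicit Arguments.
Unset Strict Implicit.
Unset Printing Implicit Defensive.

Import Order.TTheory GRing.Theory Num.Theory.
Local Open Scope classical_set_scope.
Local Open Scope ring_scope.

Section Defs.
Variable R : realType.
Local Notation C := R[i].

(* A point of C^n, stored through its underlying real coordinates
   (Re, Im) of each complex coordinate, i.e. a point of R^{2n}.  The type
   n.-tuple (R * R) carries the product (= Borel) sigma-algebra of R^{2n}. *)
Definition pt (n : nat) := (n.-tuple (R * R))%type.

Definition cplx (p : R * R) : C := Complex p.1 p.2.

Definition addpt n (z w : pt n) : pt n :=
  [tuple ((tnth z i).1 + (tnth w i).1, (tnth z i).2 + (tnth w i).2) | i < n].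
Definition subpt n (z w : pt n) : pt n :=
  [tuple ((tnth z i).1 - (tnth w i).1, (tnth z i).2 - (tnth w i).2) | i < n].

(* a norm on C^n (all norms are equivalent) *)
Definition ptnorm n (z : pt n) : R := \sum_(i < n) ComplexField.Normc.normc (cplx (tnth z i)).

Definition ptl k1 k2 (zw : pt (k1 + k2)) : pt k1 :=
  [tuple tnth zw (lshift k2 i) | i < k1].
Definition ptr k1 k2 (zw : pt (k1 + k2)) : pt k2 :=
  [tuple tnth zw (rshift k1 i) | i < k2].

Record defining_family (n : nat) (I : Type) (M : I -> pt n -> R) : Prop := {
  df_nonneg : forall g z, 0 <= M g z;
  df_meas : forall g, measurable_fun [set: pt n] (M g);
  df_bdd : forall g (r : R), exists K : R, forall z, ptnorm z <= r -> M g z <= K;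
  df_a : forall g1 g2, exists g (c : R), 0 < c /\
           forall z, c * (M g1 z + M g2 z) <= M g z;
  df_b : exists G' : set I, countable G' /\
           forall g, exists g', G' g' /\ exists c : R, 0 < c /\
             forall z, c * M g z <= M g' z;
  df_c : forall x : pt n, exists g (r c : R), 0 < r /\ 0 < c /\
           forall z, ptnorm (subpt z x) < r -> c <= M g z }.

Definition entire n (f : pt n -> C) : Prop :=
  forall z : pt n, exists a : n.-tuple C, forall e : R, 0 < e ->
    exists d : R, 0 < d /\ forall h : pt n, ptnorm h < d ->
      ComplexField.Normc.normc (f (addpt z h) - f z - \sum_(i < n) tnth a i * cplx (tnth h i))
        <= e * ptnorm h.

Definition snorm n (Mg : pt n -> R) (f : pt n -> C) : \bar R :=
  ereal_sup [set ((Mg z * ComplexField.Normc.normc (f z))%:E) | z in [set: pt n]].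

Definition inH n (I : Type) (M : I -> pt n -> R) (f : pt n -> C) : Prop :=
  entire f /\ forall g, (snorm (M g) f < +oo)%E.

Definition tensfam k1 k2 (I J : Type) (M : I -> pt k1 -> R) (N : J -> pt k2 -> R)
  : (I * J)%type -> pt (k1 + k2) -> R :=
  fun gw zw => M gw.1 (ptl zw) * N gw.2 (ptr zw).

Definition Phi k1 k2 (f : pt k1 -> C) (g : pt k2 -> C) : pt (k1 + k2) -> C :=
  fun zw => f (ptl zw) * g (ptr zw).

(* the algebraic tensor product H(M) (x) H(N), realized (via Phi) as the
   space of functions sum_j f_j(z) g_j(w); a representation of u is a
   finite list of pairs (f_j, g_j) with f_j in H(M), g_j in H(N) *)
Definition reps k1 k2 (I J : Type) (M : I -> pt k1 -> R) (N : J -> pt k2 -> R)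
  (u : pt (k1 + k2) -> C) : set (seq ((pt k1 -> C) * (pt k2 -> C))) :=
  [set s | (forall p, Stdlib.Lists.List.In p s -> inH M p.1 /\ inH N p.2) /\
           u = (fun zw => \sum_(p <- s) Phi p.1 p.2 zw)].

Definition in_tensor k1 k2 (I J : Type) (M : I -> pt k1 -> R) (N : J -> pt k2 -> R)
  (u : pt (k1 + k2) -> C) : Prop := reps M N u !=set0.

Definition projsn k1 k2 (I J : Type) (M : I -> pt k1 -> R) (N : J -> pt k2 -> R)
  (g : I) (w : J) (u : pt (k1 + k2) -> C) : \bar R :=
  ereal_inf [set (\sum_(p <- s) (snorm (M g) p.1 * snorm (N w) p.2))%E
            | s in reps M N u].

(* Lebesgue integral on R^{2n} of a nonnegative function, computed as the
   iterated integral over the real coordinates (Tonelli) *)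
Fixpoint iint (n : nat) : (pt n -> \bar R) -> \bar R :=
  match n return (pt n -> \bar R) -> \bar R with
  | 0 => fun f => f [tuple]
  | m.+1 => fun f =>
      (\int[@lebesgue_measure R]_(x in [set: R])
        \int[@lebesgue_measure R]_(y in [set: R])
          iint (fun t : pt m => f (cons_tuple (x, y) t)))%E
  end.

(* The conclusion "Phi induces a topological isomorphism
   H(M) (x)^_pi H(N) ~ H(M (x) N)", i.e. H(M (x) N) is (a model of) the
   completion of (H(M) (x) H(N), projective topology) via Phi. *)
Definition proj_tensor_iso k1 k2 (I J : Type)
  (M : I -> pt k1 -> R) (N : J -> pt k2 -> R) : Prop :=
  let MN := tensfam M N in
  (forall f g, inH M f -> inH N g -> inH MN (Phi f g)) /\
  (forall (g : I) (w : J), exists (g' : I) (w' : J) (c : R), 0 < c /\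
     forall u, in_tensor M N u ->
       (snorm (MN (g, w)) u <= c%:E * projsn M N g' w' u)%E) /\
  (forall (g : I) (w : J), exists (g' : I) (w' : J) (c : R), 0 < c /\
     forall u, in_tensor M N u ->
       (projsn M N g w u <= c%:E * snorm (MN (g', w')) u)%E) /\
  (forall u, inH MN u -> forall (g : I) (w : J) (e : R), 0 < e ->
     exists v, in_tensor M N v /\
       (snorm (MN (g, w)) (fun zw => (u zw - v zw)%R) < e%:E)%E) /\
  (* completeness of H(M (x) N) (a metrizable space, by (b)) *)
  (forall u : nat -> pt (k1 + k2) -> C, (forall m, inH MN (u m)) ->
     (forall gw e, 0 < e -> exists m0, forall m m', (m0 <= m)%N -> (m0 <= m')%N ->
        (snorm (MN gw) (fun zw => (u m zw - u m' zw)%R) < e%:E)%E) ->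
     exists v, inH MN v /\
       forall gw e, 0 < e -> exists m0, forall m, (m0 <= m)%N ->
         (snorm (MN gw) (fun zw => (u m zw - v zw)%R) < e%:E)%E).

End Defs.

(* Main.v *)
(* Conditions (I) and (II) make H(N) nuclear. Cauchy estimates and Taylor expansions at the
   points of a fine lattice, combined with the integrability of L, give for each N_w a norm
   N_w' and functionals d_n (multiples of partial derivatives at lattice points) with
   |d_n f| <= b_n ||f||_w', sum_n b_n < oo and ||f||_w <= sum_n |d_n f|. For u = sum_i f_i h_i,
   recovering elements of H(N) from their values under finitely many d_n by (regularised)
   least squares yields representations of u whose projective sums are bounded by a seminorm
   of u, the Cauchy-Schwarz inequality absorbing the number of terms. The same least squares,
   applied to the slices u(z, .) of an arbitrary u and a finite net of them, produce tensors
   close to u. Completeness of H(M (x) N) is Weierstrass' theorem. *)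
Require Import Defs.
From HB Require Import structures.
From mathcomp Require Import all_boot all_order all_algebra.
From mathcomp Require Import all_classical all_reals all_analysis.
From mathcomp Require Import measurable_realfun complex.
From mathcomp Require Import ring lra zify.

Set Implicit Arguments.
Unset Strict Implicit.
Unset Printing Implicit Defensive.

Import Order.TTheory GRing.Theory Num.Theory.
Import numFieldNormedType.Exports.
Local Open Scope classical_set_scope.
Local Open Scope ring_scope.

(** * Real derivatives *)

(** [entire] asks only for a complex differential at each point, so Cauchy's estimates have to start
    from Goursat's theorem. Integration is confined to primitives on the real line: circles become
    vertical periods after composition with the exponential. Treating real and imaginary parts
    separately costs factors 2, which are harmless since only the existence of constants matters.
    The obstacle in the tensor product is that the functionals [d n] come with no dual system inside
    H(N): a tensor is not expanded along fixed vectors, yet the bound may depend neither on the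
    number of terms of a representation nor on its vectors. Dividing by [sqrt (b n)] turns a
    summable family into a Euclidean norm, for which least squares is an orthogonal projection, of
    norm at most 1 in any dimension. This consumes one passage to a larger weight; estimating the
    vectors so obtained consumes a second one, hence the chain [w], [w1], [w2]. The first factor is
    only carried along: its index [g] never changes. *)

Definition rderiv (R : realType) (f : R -> R) (x d : R) : Prop :=
  forall e : R, 0 < e -> exists2 r : R, 0 < r &
    forall h : R, `|h| < r -> `|f (x + h) - f x - d * h| <= e * `|h|.

(** Bridge between increments, the form in which all estimates are made here, and the library
    derivative, to which the mean value theorem and the fundamental theorem of calculus apply. *)
Lemma rderivP (R : realType) (f : R -> R) (x d : R) :
  is_derive x 1 f d <-> rderiv f x d.
Proof.
split=> [fd e e0|fd].
- have /derivable_nbhs df : derivable f x 1 by [].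
  have E : 'D_1 f x = d by rewrite derive_val.
  move: df; rewrite E.
  move=> /eqaddoP /(_ _ e0)/nbhs_ballP[r /= r0 H].
  exists r => // h hr; have := H h; rewrite /ball/= sub0r normrN => /(_ hr).
  have -> : ((fun h : R => (f \o shift x) h%:A) - (cst (f x) + *:%R^~ d)) h = f (x + h) - f x - d * h.
    rewrite -[LHS]/(f (h *: 1 + x) - (f x + h *: d)).
    by rewrite [h *: 1]mulr1 [h + x]addrC opprD addrA [d * h]mulrC.
  by [].
- have h : (fun h => h^-1 *: (f (h *: 1 + x) - f x)) @ 0^' --> d.
    apply/cvgrPdist_le => e e0; have [r r0 H] := fd _ e0.
    rewrite near_withinE; apply/nbhs_ballP; exists r => //= t.
    rewrite /ball/= sub0r normrN => tr t0.
    have := H _ tr; rewrite -(@ler_pM2l _ `|t|^-1) ?invr_gt0 ?normr_gt0//.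
    rewrite -{1}normfV -normrM mulrBr [t^-1 * (d * t)]mulrCA mulVf// mulr1.
    rewrite [`|t|^-1 * _]mulrCA mulVf ?normr_eq0// mulr1.
    by rewrite distrC [t *: 1]mulr1 [t + x]addrC.
  apply: DeriveDef; last by apply/cvg_lim.
  by apply/cvg_ex; exists d.
Qed.

Lemma rderiv_continuous (R : realType) (f : R -> R) (x d : R) :
  rderiv f x d -> {for x, continuous f}.
Proof.
by move=> /rderivP fd; apply/differentiable_continuous/derivable1_diffP.
Qed.

(** Mean value theorem for [g - f]. Comparison with a variable majorant [g], and not only with a
    linear one, is what [taylor_bound] requires. *)
Lemma rderiv_homo (R : realType) (f g df dg : R -> R) (a b : R) : a <= b ->
  (forall x, a <= x <= b -> rderiv f x (df x) /\ rderiv g x (dg x) /\ df x <= dg x) ->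
  f b - f a <= g b - g a.
Proof.
move=> ab H.
have [||c cab E] := @MVT_segment R (g - f) (dg - df) a b ab.
- move=> x; rewrite in_itv/= => /andP[ax xb].
  have [|/rderivP fx [/rderivP gx _]] := H x; first by rewrite !ltW.
  exact: is_deriveB.
- apply: derivable_within_continuous => x; rewrite in_itv/= => axb.
  have [/rderivP fx [/rderivP gx _]] := H x axb.
  by have : is_derive x 1 (g - f) (dg x - df x) by exact: is_deriveB.
- rewrite -subr_ge0 [X in 0 <= X](_ : _ = (g - f) b - (g - f) a); last by rewrite !fctE; ring.
  rewrite E; apply: mulr_ge0; last by rewrite subr_ge0.
  rewrite -[X in _ <= X]/(dg c - df c) subr_ge0.
  by move: cab; rewrite in_itv/= => /H[_ []].
Qed.

Lemma rderiv_cst (R : realType) (c x : R) : rderiv (fun=> c) x 0.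
Proof. by apply/rderivP. Qed.

Lemma rderivZ (R : realType) (c x : R) : rderiv ( *%R c) x c.
Proof.
move=> e e0; exists 1 => // h _; rewrite [X in `|X|](_ : _ = 0); last by ring.
by rewrite normr0 mulr_ge0// ltW.
Qed.

Lemma rderiv_bound (R : realType) (f df : R -> R) (a b K : R) : a <= b ->
  (forall x, a <= x <= b -> rderiv f x (df x) /\ `|df x| <= K) ->
  `|f b - f a| <= K * (b - a).
Proof.
move=> ab H; rewrite ler_norml; apply/andP; split.
- have := @rderiv_homo R ( *%R (- K)) f (fun=> - K) df a b ab.
  rewrite -mulrBr mulNr; apply=> x /H[fx]; rewrite ler_norml => /andP[? _].
  by split; first exact: rderivZ.
- have := @rderiv_homo R f ( *%R K) df (fun=> K) a b ab.
  rewrite -mulrBr; apply=> x /H[fx]; rewrite ler_norml => /andP[_ ?].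
  by split=> //; split=> //; exact: rderivZ.
Qed.

(* This is 0, and not an oriented integral, when [x < b]; hence the hypotheses
   [b < _] up to Goursat's theorem. *)
Definition prim (R : realType) (b : R) (f : R -> R) (x : R) : R :=
  \int[@lebesgue_measure R]_(t in [set` `[b, x]]) f t.

Lemma prim_deriv (R : realType) (b : R) (f : R -> R) (x : R) :
  continuous f -> b < x -> rderiv (prim b f) x (f x).
Proof.
(* The interval is prolonged to [x + 1] so that [x] is an interior point of it. *)
move=> cf bx; apply/rderivP.
have [||||d e] := @continuous_FTC1_closed R f b x (x + 1).
- by rewrite ltrDl.
- apply: continuous_compact_integrable; first exact: segment_compact.
  exact: continuous_subspaceT.
- exact: bx.
- exact: cf.
by rewrite -e derive1E; exact/derivableP.
Qed.

(** * The modulus and derivatives on the complex line *)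

Local Notation normc := ComplexField.Normc.normc.
Local Notation Re := (@complex.Re _).
Local Notation Im := (@complex.Im _).
Local Open Scope complex_scope.

Section ComplexNorm.
Variable R : realType.
Implicit Types x y z : R[i].

Lemma normc_ge0 z : 0 <= normc z.
Proof. by case: z => a b; rewrite /= sqrtr_ge0. Qed.

Lemma normcD x y : normc (x + y) <= normc x + normc y.
Proof. exact: le_normcD. Qed.

Lemma normcN z : normc (- z) = normc z.
Proof. exact: complex.normcN. Qed.

Lemma normcBC x y : normc (x - y) = normc (y - x).
Proof. by rewrite -normcN opprB. Qed.

Lemma normcB x y : normc (x - y) <= normc x + normc y.
Proof. by rewrite -(normcN y) normcD. Qed.

Lemma normcM x y : normc (x * y) = normc x * normc y.
Proof. exact: ComplexField.Normc.normcM. Qed.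

Lemma normc_real (a : R) : normc a%:C = `|a|.
Proof. by rewrite /= expr0n addr0 sqrtr_sqr. Qed.

Lemma normc_i : normc ('i : R[i]) = 1.
Proof. by rewrite /= expr0n add0r expr1n sqrtr1. Qed.

Lemma normc0 : normc (0 : R[i]) = 0.
Proof. exact: ComplexField.Normc.normc0. Qed.

Lemma normc1 : normc (1 : R[i]) = 1.
Proof. exact: ComplexField.Normc.normc1. Qed.

Lemma normc_eq0 z : (normc z == 0) = (z == 0).
Proof.
by apply/eqP/eqP => [/ComplexField.Normc.eq0_normc//|->]; rewrite normc0.
Qed.

Lemma normc_gt0 z : (0 < normc z) = (z != 0).
Proof. by rewrite lt_neqAle normc_ge0 andbT eq_sym normc_eq0. Qed.

Lemma normcV z : normc z^-1 = (normc z)^-1.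
Proof. exact: ComplexField.Normc.normcV. Qed.

Lemma Re_le_normc z : `|Re z| <= normc z.
Proof.
case: z => a b /=; rewrite -[X in X <= _]sqrtr_sqr ler_wsqrtr//.
by rewrite lerDl sqr_ge0.
Qed.

Lemma Im_le_normc z : `|Im z| <= normc z.
Proof.
case: z => a b /=; rewrite -[X in X <= _]sqrtr_sqr ler_wsqrtr//.
by rewrite lerDr sqr_ge0.
Qed.

Lemma normc_le_ReIm z : normc z <= `|Re z| + `|Im z|.
Proof.
have -> : z = (Re z)%:C + 'i * (Im z)%:C by rewrite -complexE.
rewrite (le_trans (normcD _ _))// normcM normc_i mul1r !normc_real.
by case: z => a b; rewrite /= !(mul0r, mulr0, mul1r, addr0, subr0, add0r).
Qed.

Lemma normc_sum (I : Type) (s : seq I) (P : pred I) (F : I -> R[i]) :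
  normc (\sum_(i <- s | P i) F i) <= \sum_(i <- s | P i) normc (F i).
Proof.
elim/big_rec2: _ => [|i y x _ H]; first by rewrite normc0.
by rewrite (le_trans (normcD _ _))// lerD2l.
Qed.

Lemma ReD x y : Re (x + y) = Re x + Re y. Proof. by case: x; case: y. Qed.

Lemma ImD x y : Im (x + y) = Im x + Im y. Proof. by case: x; case: y. Qed.

Lemma ReB x y : Re (x - y) = Re x - Re y. Proof. by case: x; case: y. Qed.

Lemma ImB x y : Im (x - y) = Im x - Im y. Proof. by case: x; case: y. Qed.

Lemma ReMr x (a : R) : Re (x * a%:C) = Re x * a.
Proof. by case: x => u v /=; rewrite mulr0 subr0. Qed.

Lemma ImMr x (a : R) : Im (x * a%:C) = Im x * a.
Proof. by case: x => u v /=; rewrite mulr0 add0r. Qed.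

End ComplexNorm.

Definition cderiv (R : realType) (f : R[i] -> R[i]) (t d : R[i]) : Prop :=
  forall e : R, 0 < e -> exists2 r : R, 0 < r &
    forall h, normc h < r -> normc (f (t + h) - f t - d * h) <= e * normc h.

Definition crderiv (R : realType) (f : R -> R[i]) (t : R) (d : R[i]) : Prop :=
  forall e : R, 0 < e -> exists2 r : R, 0 < r &
    forall h : R, `|h| < r -> normc (f (t + h) - f t - d * h%:C) <= e * `|h|.

Section Deriv.
Variable R : realType.
Implicit Types (f g : R[i] -> R[i]) (F G : R -> R[i]).

Lemma crderivP F t d :
  crderiv F t d <-> rderiv (fun x => Re (F x)) t (Re d) /\ rderiv (fun x => Im (F x)) t (Im d).
Proof.
split=> [H|[HR HI] e e0].
- split=> e e0; have [r r0 K] := H e e0; exists r => // h /K; apply: le_trans.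
  + by rewrite -ReMr -!ReB Re_le_normc.
  + by rewrite -ImMr -!ImB Im_le_normc.
- have e20 : 0 < e / 2 by rewrite divr_gt0.
  have [r r0 K] := HR _ e20; have [s s0 L] := HI _ e20.
  exists (Num.min r s) => [|h]; first by rewrite lt_min r0.
  rewrite lt_min => /andP[/K hr /L hs].
  rewrite (le_trans (normc_le_ReIm _))// !ReB !ImB ReMr ImMr.
  by rewrite (le_trans (lerD hr hs))// -mulrDl -splitr.
Qed.

(** Complex values admit no mean value equality, so real and imaginary parts are bounded separately;
    this is the origin of the factor 2. *)
Lemma crderiv_bound F (f : R -> R[i]) a b K : a <= b ->
  (forall x, a <= x <= b -> crderiv F x (f x) /\ normc (f x) <= K) ->
  normc (F b - F a) <= 2 * K * (b - a).
Proof.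
move=> ab H; rewrite (le_trans (normc_le_ReIm _))// ReB ImB -mulrA mulr_natl mulr2n lerD//.
- apply: (@rderiv_bound _ (fun x => Re (F x)) (fun x => Re (f x))) => // x /H[/crderivP[? _] Hx].
  by split=> //; rewrite (le_trans (Re_le_normc _)).
- apply: (@rderiv_bound _ (fun x => Im (F x)) (fun x => Im (f x))) => // x /H[/crderivP[_ ?] Hx].
  by split=> //; rewrite (le_trans (Im_le_normc _)).
Qed.

Lemma crderivB F G t d d' : crderiv F t d -> crderiv G t d' ->
  crderiv (fun x => F x - G x) t (d - d').
Proof.
move=> HF HG e e0; have e20 : 0 < e / 2 by rewrite divr_gt0.
have [r r0 K] := HF _ e20; have [s s0 L] := HG _ e20.
exists (Num.min r s) => [|h]; first by rewrite lt_min r0.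
rewrite lt_min => /andP[/K hr /L hs].
rewrite [X in normc X](_ : _ = (F (t + h) - F t - d * h%:C) - (G (t + h) - G t - d' * h%:C)); last by ring.
rewrite (le_trans (normcB _ _))// (le_trans (lerD hr hs))// -mulrDl -splitr//.
Qed.

Lemma crderivM c F t d : crderiv F t d -> crderiv (fun x => c * F x) t (c * d).
Proof.
move=> HF e e0; have e20 : 0 < e / (normc c + 1).
  by rewrite divr_gt0// ltr_wpDl// normc_ge0.
have [r r0 K] := HF _ e20; exists r => // h /K H.
rewrite -mulrA -!mulrBr normcM.
have c1 : 0 < normc c + 1 by rewrite ltr_wpDl ?normc_ge0.
have : (normc c + 1) * normc (F (t + h) - F t - d * h%:C) <= e * `|h|.
  by rewrite -ler_pdivlMl// mulrA [_^-1 * _]mulrC.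
by apply: le_trans; rewrite ler_wpM2r ?normc_ge0// lerDl.
Qed.

Lemma crderiv_line f s u t d : cderiv f (s + u * t%:C) d ->
  crderiv (fun x => f (s + u * x%:C)) t (d * u).
Proof.
move=> Hf e e0.
have u1 : 0 < normc u + 1 by rewrite ltr_wpDl ?normc_ge0.
have [r r0 K] := Hf _ (divr_gt0 e0 u1).
exists (r / (normc u + 1)) => [|h]; first exact: divr_gt0.
rewrite ltr_pdivlMr// => hr.
have uh : normc (u * h%:C) <= (normc u + 1) * `|h|.
  by rewrite normcM normc_real ler_wpM2r// lerDl.
have := K (u * h%:C); rewrite (le_lt_trans uh) => [/(_ isT)|]; last by rewrite mulrC.
have -> : s + u * (t + h)%:C = s + u * t%:C + u * h%:C by rewrite raddfD/= mulrDr addrA.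
rewrite -[d * u * _]mulrA => /le_trans; apply.
by rewrite -mulrA ler_wpM2l ?(ltW e0)// ler_pdivrMl.
Qed.

Lemma cderiv_cst (c t : R[i]) : cderiv (fun=> c) t 0.
Proof.
move=> e e0; exists 1 => // h _.
by rewrite subrr mul0r subrr normc0 mulr_ge0 ?normc_ge0// ltW.
Qed.

Lemma cderiv_id (t : R[i]) : cderiv id t 1.
Proof.
move=> e e0; exists 1 => // h _.
by rewrite mul1r [t + h]addrC addrK subrr normc0 mulr_ge0 ?normc_ge0// ltW.
Qed.

Lemma cderivD f g t d d' : cderiv f t d -> cderiv g t d' ->
  cderiv (fun x => f x + g x) t (d + d').
Proof.
move=> HF HG e e0; have e20 : 0 < e / 2 by rewrite divr_gt0.
have [r r0 K] := HF _ e20; have [s s0 L] := HG _ e20.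
exists (Num.min r s) => [|h]; first by rewrite lt_min r0.
rewrite lt_min => /andP[/K hr /L hs].
rewrite [X in normc X](_ : _ = (f (t + h) - f t - d * h) + (g (t + h) - g t - d' * h)); last by ring.
by rewrite (le_trans (normcD _ _))// (le_trans (lerD hr hs))// -mulrDl -splitr.
Qed.

Lemma cderiv_lip f t d : cderiv f t d ->
  exists2 r : R, 0 < r & forall h, normc h < r -> normc (f (t + h) - f t) <= (normc d + 1) * normc h.
Proof.
move=> H; have [r r0 K] := H 1 ltr01; exists r => // h /K; rewrite mul1r => Kh.
rewrite -[X in normc X](subrK (d * h)) (le_trans (normcD _ _))//.
by rewrite mulrDl mul1r normcM addrC lerD2l.
Qed.

Lemma cderiv_comp f g t d d' : cderiv f (g t) d -> cderiv g t d' ->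
  cderiv (fun x => f (g x)) t (d * d').
Proof.
move=> Hf Hg e e0.
have [r1 r10 L] := cderiv_lip Hg.
pose A := normc d' + 1; have A0 : 0 < A by rewrite ltr_wpDl ?normc_ge0.
pose B := normc d + 1; have B0 : 0 < B by rewrite ltr_wpDl ?normc_ge0.
have eA : 0 < e / 2 / A by rewrite !divr_gt0.
have eB : 0 < e / 2 / B by rewrite !divr_gt0.
have [r2 r20 K] := Hf _ eA; have [r3 r30 M] := Hg _ eB.
exists (Num.min r1 (Num.min (r2 / A) r3)) => [|h]; first by rewrite !lt_min r10 r30 divr_gt0.
rewrite !lt_min => /and3P[/L h1]; rewrite ltr_pdivlMr// => h2 /M h3.
have := K (g (t + h) - g t).
rewrite (le_lt_trans h1) => [/(_ isT)|]; last by rewrite mulrC.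
rewrite [g t + _]addrC subrK => h4.
rewrite [X in normc X](_ : _ = (f (g (t + h)) - f (g t) - d * (g (t + h) - g t)) + d * (g (t + h) - g t - d' * h)); last by ring.
rewrite (le_trans (normcD _ _))// [e]splitr mulrDl lerD//.
- rewrite (le_trans h4)// -mulrA; apply: ler_wpM2l; first by rewrite divr_ge0// ltW.
  by rewrite mulrC ler_pdivrMr// [X in _ <= X]mulrC.
- rewrite normcM (@le_trans _ _ (B * (e / 2 / B * normc h)))//.
    by rewrite ler_pM ?normc_ge0// lerDl.
  by rewrite mulrA [B * _]mulrC divfK// gt_eqF.
Qed.

Lemma cderivM f g t d d' : cderiv f t d -> cderiv g t d' ->
  cderiv (fun x => f x * g x) t (d * g t + f t * d').
Proof.
move=> Hf Hg e e0.
pose A := normc (g t) + 1; have A0 : 0 < A by rewrite ltr_wpDl ?normc_ge0.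
pose B := normc (f t) + 1; have B0 : 0 < B by rewrite ltr_wpDl ?normc_ge0.
pose D := (normc d + 1) * (normc d' + 1).
have D0 : 0 < D by rewrite mulr_gt0// ltr_wpDl ?normc_ge0.
have e30 : 0 < e / 3 by rewrite divr_gt0.
have [r1 r10 K] := Hf _ (divr_gt0 e30 A0); have [r2 r20 M] := Hg _ (divr_gt0 e30 B0).
have [r3 r30 Lf] := cderiv_lip Hf; have [r4 r40 Lg] := cderiv_lip Hg.
exists (Num.min (Num.min r1 r2) (Num.min (Num.min r3 r4) (e / 3 / D))) => [|h].
  by rewrite !lt_min r10 r20 r30 r40 divr_gt0.
rewrite !lt_min -!andbA => /and5P[/K h1 /M h2 /Lf h3 /Lg h4]; rewrite ltr_pdivlMr// => h5.
rewrite [X in normc X](_ : _ = (f (t + h) - f t - d * h) * g t + f t * (g (t + h) - g t - d' * h)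
  + (f (t + h) - f t) * (g (t + h) - g t)); last by ring.
have -> : e * normc h = e / 3 * normc h + e / 3 * normc h + e / 3 * normc h by field.
rewrite (le_trans (normcD _ _))// lerD//; last first.
  rewrite normcM (le_trans (ler_pM (normc_ge0 _) (normc_ge0 _) h3 h4))//.
  rewrite mulrACA -/D mulrCA mulrA ler_wpM2r ?normc_ge0//.
  by rewrite ltW// mulrC.
rewrite (le_trans (normcD _ _))// lerD// normcM.
- rewrite (le_trans (ler_pM (normc_ge0 _) (normc_ge0 _) h1 (lexx _)))//.
  rewrite mulrAC ler_wpM2r ?normc_ge0// -mulrA ler_piMr ?(ltW e30)//.
  by rewrite mulrC ler_pdivrMr// mul1r lerDl.
- rewrite (le_trans (ler_pM (normc_ge0 _) (normc_ge0 _) (lexx _) h2))//.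
  rewrite mulrA ler_wpM2r ?normc_ge0// mulrCA ler_piMr ?(ltW e30)//.
  by rewrite ler_pdivrMr// mul1r lerDl.
Qed.

End Deriv.

(** * Goursat's theorem for rectangles *)

(** If [P] failed, it would fail on some quarter at every stage; the lower left corners of these
    nested quarters increase, and their suprema form a point common to all of them, where the local
    hypothesis gives a contradiction. *)
Lemma bisection (R : realType) (P : R -> R -> R -> R -> Prop) x y w h :
  0 <= w -> 0 <= h ->
  (forall x y w h, 0 <= w -> 0 <= h ->
     P x y (w / 2) (h / 2) -> P (x + w / 2) y (w / 2) (h / 2) ->
     P x (y + h / 2) (w / 2) (h / 2) -> P (x + w / 2) (y + h / 2) (w / 2) (h / 2) ->
     P x y w h) ->
  (forall px py, exists2 d : R, 0 < d & forall x y w h,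
     x <= px <= x + w -> y <= py <= y + h -> w + h < d -> P x y w h) ->
  P x y w h.
Proof.
move=> w0 h0 Hq Hl; apply: contrapT => nP.
pose c n : R := 2^-1 ^+ n.
have c0 n : 0 <= c n by rewrite exprn_ge0// invr_ge0.
have cS n : c n.+1 = c n / 2 by rewrite /c exprSr.
pose Q n (p : R * R) := ~ P p.1 p.2 (w * c n) (h * c n).
(* The failing quarter is made a total function of the stage and the corner, so that it can be
   iterated; the inequalities say that it stays inside its parent. *)
have step (np : nat * (R * R)) : exists q, Q np.1 np.2 ->
    [/\ Q np.1.+1 q, np.2.1 <= q.1, q.1 + w * c np.1.+1 <= np.2.1 + w * c np.1,
      np.2.2 <= q.2 & q.2 + h * c np.1.+1 <= np.2.2 + h * c np.1].
  case: np => n [a b] /=.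
  have W0 : 0 <= w * c n by rewrite mulr_ge0.
  have H0 : 0 <= h * c n by rewrite mulr_ge0.
  have [Qn|] := pselect (Q n (a, b)); last by exists (a, b).
  have HQ := Hq a b _ _ W0 H0.
  have eW : w * c n.+1 = w * c n / 2 by rewrite cS mulrA.
  have eH : h * c n.+1 = h * c n / 2 by rewrite cS mulrA.
  have W2 : w * c n = w * c n / 2 + w * c n / 2 by rewrite -splitr.
  have H2 : h * c n = h * c n / 2 + h * c n / 2 by rewrite -splitr.
  have W20 : 0 <= w * c n / 2 by rewrite divr_ge0.
  have H20 : 0 <= h * c n / 2 by rewrite divr_ge0.
  apply: contrapT => /forallNP nq; apply: Qn; rewrite /Q /=.
  apply: HQ; apply: contrapT => nP'.
  - apply: (nq (a, b)) => _; split; rewrite /Q /= ?eW ?eH//; lra.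
  - apply: (nq (a + w * c n / 2, b)) => _; split; rewrite /Q /= ?eW ?eH//; lra.
  - apply: (nq (a, b + h * c n / 2)) => _; split; rewrite /Q /= ?eW ?eH//; lra.
  - apply: (nq (a + w * c n / 2, b + h * c n / 2)) => _; split; rewrite /Q /= ?eW ?eH//; lra.
have [f Hf] := choice step.
pose s := fix s n := if n is m.+1 then f (m, s m) else (x, y).
have Qs n : Q n (s n).
  elim: n => [|n IH]; first by rewrite /Q /c expr0 !mulr1.
  by have [] := Hf (n, s n) IH.
have Hs n := Hf (n, s n) (Qs n).
have mono n m : [/\ (s n).1 <= (s (n + m)%N).1, (s (n + m)%N).1 + w * c (n + m)%N <= (s n).1 + w * c n,
   (s n).2 <= (s (n + m)%N).2 & (s (n + m)%N).2 + h * c (n + m)%N <= (s n).2 + h * c n].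
  elim: m => [|m [IH1 IH2 IH3 IH4]]; first by rewrite addn0.
  rewrite addnS; have [_ /= h1 h2 h3 h4] := Hs (n + m)%N; split.
  - exact: le_trans h1.
  - exact: le_trans IH2.
  - exact: le_trans h3.
  - exact: le_trans IH4.
(* Every left end is below every right end, whatever the stages; hence the supremum of the left ends
   lies in all the intervals. *)
have cross1 n m : (s n).1 <= (s m).1 + w * c m.
  have [le|/ltnW le] := leqP n m.
  - have [h1 _ _ _] := mono n (m - n)%N; rewrite subnKC// in h1.
    by rewrite (le_trans h1)// lerDl mulr_ge0.
  - have [_ h2 _ _] := mono m (n - m)%N; rewrite subnKC// in h2.
    by rewrite (le_trans _ h2)// lerDl mulr_ge0.
have cross2 n m : (s n).2 <= (s m).2 + h * c m.
  have [le|/ltnW le] := leqP n m.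
  - have [_ _ h1 _] := mono n (m - n)%N; rewrite subnKC// in h1.
    by rewrite (le_trans h1)// lerDl mulr_ge0.
  - have [_ _ _ h2] := mono m (n - m)%N; rewrite subnKC// in h2.
    by rewrite (le_trans _ h2)// lerDl mulr_ge0.
pose px := sup (range (fun n => (s n).1)); pose py := sup (range (fun n => (s n).2)).
have Hpx n : (s n).1 <= px <= (s n).1 + w * c n.
  apply/andP; split.
  - apply: ub_le_sup; last by exists n.
    by exists ((s 0%N).1 + w * c 0%N) => _ [m _ <-].
  - apply: ge_sup; first by exists (s 0%N).1, 0%N.
    by move=> _ [m _ <-].
have Hpy n : (s n).2 <= py <= (s n).2 + h * c n.
  apply/andP; split.
  - apply: ub_le_sup; last by exists n.
    by exists ((s 0%N).2 + h * c 0%N) => _ [m _ <-].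
  - apply: ge_sup; first by exists (s 0%N).2, 0%N.
    by move=> _ [m _ <-].
have [d d0 Hd] := Hl px py.
have [n hn] : exists n, (w + h) * c n < d.
  have cv : (fun n => (w + h) * c n) @ \oo --> (w + h) * 0.
    apply: cvgM; first exact: cvg_cst.
    by apply: cvg_expr; rewrite ger0_norm ?invr_ge0// invf_lt1// ltr1n.
  rewrite mulr0 in cv.
  have /cvgrPdist_lt /(_ _ d0) [n _ Hn] := cv.
  exists n; have := Hn n (leqnn n); rewrite /= sub0r normrN.
  by apply: le_lt_trans; rewrite ler_norm.
by apply: (Qs n); apply: Hd => //; rewrite -mulrDl.
Qed.

Section Goursat.
Variables (R : realType) (f : R[i] -> R[i]) (b : R).
Hypothesis df : forall s, exists d, cderiv f s d.

(** Path integrals are encoded as differences of values of this primitive along the line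
    [s + u * t]. The direction [u] is not a factor of the integrand, so [rect_int] supplies the ['i]
    of the vertical sides. *)
Definition line_prim (s u : R[i]) (t : R) : R[i] :=
  prim b (fun x => Re (f (s + u * x%:C))) t +i* prim b (fun x => Im (f (s + u * x%:C))) t.

Lemma line_prim_deriv s u t : b < t -> crderiv (line_prim s u) t (f (s + u * t%:C)).
Proof.
move=> bt; have H (x : R) : {for x, continuous (fun x : R => Re (f (s + u * x%:C)))} /\
    {for x, continuous (fun x : R => Im (f (s + u * x%:C)))}.
  have [d /crderiv_line/crderivP[h1 h2]] := df (s + u * x%:C).
  by split; [apply: rderiv_continuous h1|apply: rderiv_continuous h2].
apply/crderivP; split; rewrite /line_prim /=.
- by apply: (@prim_deriv _ b (fun x => Re (f (s + u * x%:C)))) => // x; have [] := H x.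
- by apply: (@prim_deriv _ b (fun x => Im (f (s + u * x%:C)))) => // x; have [] := H x.
Qed.

Let hor y := line_prim ('i * y%:C) 1.
Let ver x := line_prim x%:C 'i.

(* The integral of [f] along the boundary of [x, x + w] x [y, y + h]. *)
Definition rect_int (x y w h : R) : R[i] :=
  (hor y (x + w) - hor y x) - (hor (y + h) (x + w) - hor (y + h) x) +
  'i * ((ver (x + w) (y + h) - ver (x + w) y) - (ver x (y + h) - ver x y)).

(** The inner sides cancel; once the values of the primitives are abstracted, this is a ring
    identity. *)
Lemma rect_int_quarter x y w h :
  rect_int x y w h = rect_int x y (w / 2) (h / 2) + rect_int (x + w / 2) y (w / 2) (h / 2) +
   rect_int x (y + h / 2) (w / 2) (h / 2) + rect_int (x + w / 2) (y + h / 2) (w / 2) (h / 2).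
Proof.
rewrite {1}[w]splitr {1}[h]splitr /rect_int !addrA; clearbody hor ver.
set x1 := x + w / 2; set x2 := x1 + w / 2; set y1 := y + h / 2; set y2 := y1 + h / 2.
move: (hor y x) (hor y x1) (hor y x2) (hor y1 x) (hor y1 x1) (hor y1 x2) (hor y2 x)
  (hor y2 x1) (hor y2 x2) (ver x y) (ver x1 y) (ver x2 y) (ver x y1) (ver x1 y1)
  (ver x2 y1) (ver x y2) (ver x1 y2) (ver x2 y2) => *; ring.
Qed.

(** The affine approximation [l] of [f] has the primitive [P], whose increments cancel around the
    rectangle. What remains is [f - l], at most [e * (w + h)], integrated over the perimeter
    [2 * (w + h)], with the factor 2 of [crderiv_bound]. *)
Lemma rect_int_local x y w h px py d e : 0 <= e -> b < x -> b < y ->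
  x <= px <= x + w -> y <= py <= y + h ->
  (forall q, normc q <= w + h -> normc (f (px +i* py + q) - f (px +i* py) - d * q) <= e * normc q) ->
  normc (rect_int x y w h) <= 4 * e * (w + h) ^+ 2.
Proof.
move=> e0 bx by0 /andP[x1 x2] /andP[y1 y2] H.
have w0 : 0 <= w by lra.
have h0 : 0 <= h by lra.
pose p := px +i* py.
pose l q := f p + d * (q - p).
pose P q := f p * q + d * (2^-1 * ((q - p) * (q - p))).
have dP q : cderiv P q (l q).
  have : cderiv P q (0 * q + f p * 1 + (0 * (2^-1 * ((q - p) * (q - p))) +
     d * (0 * ((q - p) * (q - p)) + 2^-1 * ((1 + 0) * (q - p) + (q - p) * (1 + 0))))).
    have hq : cderiv (fun q => q - p) q (1 + 0) by apply: cderivD; [exact: cderiv_id|exact: cderiv_cst].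
    apply: cderivD; first by apply: cderivM; [exact: cderiv_cst|exact: cderiv_id].
    by apply: cderivM; [exact: cderiv_cst|apply: cderivM; [exact: cderiv_cst|apply: cderivM]].
  congr (cderiv _ _ _); rewrite /l !mul0r add0r mulr1 add0r addr0 mul1r mulr1 add0r.
  by congr (_ + _ * _); rewrite -mulr2n -[X in _ * X]mulr_natl mulrA mulVf ?mul1r//.
have near s t : x <= s <= x + w -> y <= t <= y + h -> normc (f (s +i* t) - l (s +i* t)) <= e * (w + h).
  move=> /andP[s1 s2] /andP[t1 t2].
  have hn : normc (s +i* t - p) <= w + h.
    rewrite (le_trans (normc_le_ReIm _))// lerD// /= ler_norml; apply/andP; split; lra.
  have := H _ hn; rewrite -/p [p + _]addrC subrK /l opprD addrA => /le_trans; apply.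
  by rewrite ler_wpM2l.
have eq1 s t : 'i * t%:C + 1 * s%:C = s +i* t :> R[i].
  by rewrite mul1r addrC [RHS]complexE.
have eq2 s t : s%:C + 'i * t%:C = s +i* t :> R[i] by rewrite [RHS]complexE.
have bH t : y <= t <= y + h ->
    normc ((hor t (x + w) - P ((x + w) +i* t)) - (hor t x - P (x +i* t))) <= 2 * (e * (w + h)) * w.
  move=> yt.
  have -> : 2 * (e * (w + h)) * w = 2 * (e * (w + h)) * (x + w - x) by ring.
  apply: (@crderiv_bound _ (fun s => hor t s - P (s +i* t)) (fun s => f (s +i* t) - l (s +i* t))).
    by rewrite lerDl.
  move=> s xs; split; last exact: near.
  rewrite -!eq1; apply: crderivB.
    by apply: line_prim_deriv; rewrite (lt_le_trans bx)//; case/andP: xs.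
  rewrite [X in crderiv X](_ : _ = (fun s => P ('i * t%:C + 1 * s%:C))); last by apply/funext => s'; rewrite -eq1.
  by rewrite -[l _]mulr1; apply: crderiv_line.
have bV s : x <= s <= x + w ->
    normc (('i * ver s (y + h) - P (s +i* (y + h))) - ('i * ver s y - P (s +i* y))) <= 2 * (e * (w + h)) * h.
  move=> yt.
  have -> : 2 * (e * (w + h)) * h = 2 * (e * (w + h)) * (y + h - y) by ring.
  apply: (@crderiv_bound _ (fun t => 'i * ver s t - P (s +i* t)) (fun t => 'i * f (s +i* t) - l (s +i* t) * 'i)).
    by rewrite lerDl.
  move=> t xs; split; last first.
    by rewrite mulrC -mulrBl normcM normc_i mulr1 near.
  rewrite -!eq2; apply: crderivB.
    apply: crderivM; apply: line_prim_deriv; rewrite (lt_le_trans by0)//; by case/andP: xs.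
  rewrite [X in crderiv X](_ : _ = (fun t => P (s%:C + 'i * t%:C))); last by apply/funext => s'; rewrite -eq2.
  by apply: crderiv_line.
have -> : rect_int x y w h =
  ((hor y (x + w) - P ((x + w) +i* y)) - (hor y x - P (x +i* y)))
  - ((hor (y + h) (x + w) - P ((x + w) +i* (y + h))) - (hor (y + h) x - P (x +i* (y + h))))
  + (('i * ver (x + w) (y + h) - P ((x + w) +i* (y + h))) - ('i * ver (x + w) y - P ((x + w) +i* y)))
  - (('i * ver x (y + h) - P (x +i* (y + h))) - ('i * ver x y - P (x +i* y))).
  by rewrite /rect_int; clearbody hor ver; ring.
have -> : 4 * e * (w + h) ^+ 2 = 2 * (e * (w + h)) * w + 2 * (e * (w + h)) * w +
   2 * (e * (w + h)) * h + 2 * (e * (w + h)) * h by ring.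
rewrite (le_trans (normcB _ _))// lerD//; last by apply: bV; rewrite lerDl ?w0 ?h0 lexx.
rewrite (le_trans (normcD _ _))// lerD//; last by apply: bV; rewrite lerDl ?w0 ?h0 lexx.
rewrite (le_trans (normcB _ _))// lerD//; first by apply: bH; rewrite lerDl ?w0 ?h0 lexx.
by apply: bH; rewrite lerDl ?w0 ?h0 lexx.
Qed.

(** The bound [normc (rect_int x y w h) <= e * (w + h) ^+ 2] passes from quarters to the whole,
    since each quarter accounts for one fourth of the right side; it holds locally by
    differentiability, and [bisection] makes it global. *)
Lemma goursat x y w h : b < x -> b < y -> 0 <= w -> 0 <= h -> rect_int x y w h = 0.
Proof.
move=> bx by0 w0 h0; apply/eqP; rewrite -normc_eq0 -[_ == _]negbK; apply/negP => n0.
have {}n0 : 0 < normc (rect_int x y w h) by rewrite lt_neqAle eq_sym n0 normc_ge0.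
have wh : 0 < (w + h) ^+ 2 + 1 by rewrite ltr_wpDl ?sqr_ge0.
(* The denominator exceeds [(w + h) ^+ 2], so for this [e] the bound would put the integral strictly
   below itself. *)
pose e := normc (rect_int x y w h) / ((w + h) ^+ 2 + 1).
have e0 : 0 < e by rewrite divr_gt0.
suff : b < x -> b < y -> normc (rect_int x y w h) <= e * (w + h) ^+ 2.
  move=> /(_ bx by0); apply/negP; rewrite -ltNge /e mulrAC ltr_pdivrMr// ltr_pM2l//.
  by rewrite ltrDl.
apply: (@bisection R (fun x y w h => b < x -> b < y -> normc (rect_int x y w h) <= e * (w + h) ^+ 2)) => //.
- clearbody e; move=> {bx by0 w0 h0 n0 wh e0} {}x {}y {}w {}h w0 h0 H1 H2 H3 H4 bx by0.
  rewrite rect_int_quarter.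
  have bx' : b < x + w / 2 by rewrite (lt_le_trans bx)// lerDl divr_ge0.
  have by' : b < y + h / 2 by rewrite (lt_le_trans by0)// lerDl divr_ge0.
  have {}H1 := H1 bx by0; have {}H2 := H2 bx' by0.
  have {}H3 := H3 bx by'; have {}H4 := H4 bx' by'.
  have -> : e * (w + h) ^+ 2 = e * (w / 2 + h / 2) ^+ 2 + e * (w / 2 + h / 2) ^+ 2 +
     e * (w / 2 + h / 2) ^+ 2 + e * (w / 2 + h / 2) ^+ 2 by field.
  do 3 (apply: le_trans (normcD _ _) _; apply: lerD; last by []).
  exact: H1.
- move=> px py; have [d Hd] := df (px +i* py).
  have e40 : 0 < e / 4 by rewrite divr_gt0.
  have [r r0 Hr] := Hd _ e40; exists r => // {bx by0 w0 h0 n0 wh} x' y' w' h' hx hy hr bx by0.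
  have -> : e * (w' + h') ^+ 2 = 4 * (e / 4) * (w' + h') ^+ 2 by field.
  apply: (@rect_int_local _ _ _ _ px py d) => //; first exact: ltW.
  by move=> q hq; apply: Hr; exact: le_lt_trans hr.
Qed.

(** On a rectangle of height one period the horizontal sides cancel, so Goursat's theorem equates
    the integrals over the vertical ones. *)
Lemma periodic_mean_const (T x0 x1 : R) : 0 <= T -> x0 <= x1 -> b < 0 -> b < x0 ->
  (forall s, f (s + 'i * T%:C) = f s) ->
  ver x1 T - ver x1 0 = ver x0 T - ver x0 0.
Proof.
move=> T0 x01 b0 bx0 per.
have := @goursat x0 0 (x1 - x0) T bx0 b0; rewrite subr_ge0 => /(_ x01 T0).
rewrite /rect_int [x0 + (x1 - x0)]addrC subrK !add0r.
have -> : hor T = hor 0.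
  rewrite /hor /line_prim; apply/funext => t.
  have E x : 'i * T%:C + 1 * x%:C = 'i * 0%:C + 1 * x%:C + 'i * T%:C :> R[i].
    by rewrite raddf0 mulr0 add0r addrC.
  by congr (prim _ _ _ +i* prim _ _ _); apply/funext => x; rewrite E per.
rewrite subrr add0r => /eqP; rewrite mulf_eq0 => /orP[/eqP /(congr1 (@complex.Im R))/= /eqP|].
  by rewrite oner_eq0.
by rewrite subr_eq0 => /eqP.
Qed.

(* The mean of [f] over a vertical period does not depend on the abscissa: it is
   close to [l] at [x0] and bounded by [K1] at [x1]. *)
Lemma periodic_mean_bound (T x0 x1 K0 K1 : R) (l : R[i]) : 0 < T -> x0 <= x1 ->
  b < 0 -> b < x0 -> (forall s, f (s + 'i * T%:C) = f s) ->
  (forall t, normc (f (x0%:C + 'i * t%:C) - l) <= K0) ->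
  (forall t, normc (f (x1%:C + 'i * t%:C)) <= K1) ->
  normc l <= 2 * (K0 + K1).
Proof.
move=> T0 x01 b0 bx0 per H0 H1.
have lin x : crderiv (fun t => l * t%:C) x l.
  by move=> e e0; exists 1 => // h _; rewrite raddfD/= mulrDr [l * x%:C + _]addrC addrK subrr normc0 mulr_ge0// ltW.
have h0 : normc ((ver x0 T - l * T%:C) - (ver x0 0 - l * 0%:C)) <= 2 * K0 * (T - 0).
  apply: (@crderiv_bound _ (fun t => ver x0 t - l * t%:C) (fun t => f (x0%:C + 'i * t%:C) - l)); first exact: ltW.
  move=> t /andP[t0 _]; split => //.
  apply: crderivB => //; apply: line_prim_deriv; exact: lt_le_trans t0.
have h1 : normc (ver x1 T - ver x1 0) <= 2 * K1 * (T - 0).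
  apply: (@crderiv_bound _ (ver x1) (fun t => f (x1%:C + 'i * t%:C))); first exact: ltW.
  move=> t /andP[t0 _]; split => //; apply: line_prim_deriv; exact: lt_le_trans t0.
have h2 := periodic_mean_const (ltW T0) x01 b0 bx0 per.
have : normc (l * T%:C) <= 2 * (K0 + K1) * T.
  have -> : l * T%:C = (ver x1 T - ver x1 0) - ((ver x0 T - l * T%:C) - (ver x0 0 - l * 0%:C)).
    by rewrite h2 raddf0 mulr0; ring.
  rewrite (le_trans (normcB _ _))// mulrDr mulrDl addrC lerD//.
    by rewrite (le_trans h0)// subr0.
  by rewrite (le_trans h1)// subr0.
by rewrite normcM normc_real (gtr0_norm T0) ler_pM2r.
Qed.

End Goursat.

(** * Cauchy estimates in one variable *)

Section CauchyEstimate.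
Variable R : realType.

Definition cexp (s : R[i]) : R[i] := (expR (Re s))%:C * (cos (Im s) +i* sin (Im s)).

Lemma cexpD s t : cexp (s + t) = cexp s * cexp t.
Proof.
rewrite /cexp ReD ImD expRD cosD sinD; apply/eqP; rewrite eq_complex /=.
by apply/andP; split; apply/eqP; ring.
Qed.

Lemma cexp0 : cexp 0 = 1.
Proof. by rewrite /cexp /= expR0 cos0 sin0 mul1r. Qed.

Lemma cexpNK s : cexp s * cexp (- s) = 1.
Proof. by rewrite -cexpD subrr cexp0. Qed.

Lemma normc_cexp s : normc (cexp s) = expR (Re s).
Proof.
by rewrite /cexp normcM normc_real ger0_norm ?expR_ge0//= cos2Dsin2 sqrtr1 mulr1.
Qed.

Lemma cexp_period s : cexp (s + 'i * (pi *+ 2)%:C) = cexp s.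
Proof.
rewrite cexpD -[RHS]mulr1; congr (_ * _); rewrite /cexp.
rewrite !ReMr !ImMr /= mul0r mul1r expR0 mul1r.
by rewrite -[pi *+ 2]add0r cosD2pi sinD2pi cos0 sin0.
Qed.

Lemma cexp_deriv s : cderiv cexp s (cexp s).
Proof.
suff H : cderiv cexp 0 1.
  move=> e e0; have N0 : 0 < normc (cexp s) by rewrite normc_cexp expR_gt0.
  have [r r0 K] := H _ (divr_gt0 e0 N0); exists r => // h /K.
  rewrite add0r cexp0 mul1r cexpD => Kh.
  rewrite [X in normc X](_ : _ = cexp s * (cexp h - 1 - h)); last by ring.
  rewrite normcM (le_trans (ler_wpM2l (normc_ge0 _) Kh))//.
  by rewrite mulrA mulrCA divff ?mulr1// gt_eqF.
(* The four terms estimated at the end contribute 2, 1, 2 and 2 times [d * n], hence the 7. The cap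
   1 keeps [expR u] below 2. *)
move=> e e0; pose d := Num.min (e / 7) 1.
have d0 : 0 < d by rewrite lt_min ltr01 andbT divr_gt0.
have d1 : d <= 1 by rewrite ge_min lexx orbT.
have de : 7 * d <= e by rewrite -ler_pdivlMl// mulrC ge_min lexx.
have /rderivP E : is_derive (0 : R) 1 expR (expR 0) by exact: is_derive_expR.
have /rderivP S : is_derive (0 : R) 1 sin (cos 0) by exact: is_derive_sin.
have /rderivP C : is_derive (0 : R) 1 cos (- sin 0) by exact: is_derive_cos.
have [r1 r10 {}E] := E _ d0; have [r2 r20 {}S] := S _ d0; have [r3 r30 {}C] := C _ d0.
exists (Num.min (Num.min r1 r2) (Num.min r3 (d / 2))) => [|h].
  by rewrite !lt_min r10 r20 r30 divr_gt0.
rewrite !lt_min -!andbA => /and4P[h1 h2 h3 h4].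
have u1 := Re_le_normc h; have v1 := Im_le_normc h.
have {}E := E _ (le_lt_trans u1 h1); have {}S := S _ (le_lt_trans v1 h2).
have {}C := C _ (le_lt_trans v1 h3).
move: E S C; rewrite !add0r expR0 sin0 cos0 oppr0 mul0r !subr0 !mul1r ?addr0 => E S C.
apply: le_trans (normc_le_ReIm _) _.
have n0 := normc_ge0 h; set n := normc h in h1 h2 h3 h4 u1 v1 n0 *.
rewrite cexp0 /cexp; clearbody n; case: h => u v /= in u1 v1 E S C *.
have Eu : `|expR u - 1| <= 2 * `|u|.
  rewrite -[expR u - 1](subrK u) (le_trans (ler_normD _ _))// mulr_natl mulr2n lerD2r.
  by rewrite (le_trans E)// ler_piMl.
have eu2 : `|expR u| <= 2.
  rewrite -[expR u](subrK 1) (le_trans (ler_normD _ _))// normr1 [2]mulr2n lerD2r.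
  rewrite (le_trans Eu)// -ler_pdivlMl// (le_trans u1)// (le_trans (ltW h4))//.
  by rewrite mulr1 mulrC ler_piMr// invr_ge0.
rewrite [X in X <= _](_ : _ = `|expR u * (cos v - 1) + (expR u - 1 - u)|
    + `|expR u * (sin v - v) + (expR u - 1) * v|); last first.
  by congr (_ + _); congr Num.norm; ring.
have -> : e * n = (e - 7 * d) * n + ((2 * (d * n) + d * n) + (2 * (d * n) + 2 * (d * n))) by ring.
rewrite -[X in X <= _]add0r lerD// ?mulr_ge0 ?subr_ge0//.
have dv : d * `|v| <= d * n by rewrite ler_wpM2l// ltW.
apply: lerD; apply: le_trans (ler_normD _ _) _; apply: lerD.
- by rewrite normrM ler_pM// (le_trans C).
- by rewrite (le_trans E)// ler_wpM2l// ltW.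
- by rewrite normrM ler_pM// (le_trans S).
- rewrite normrM (le_trans (ler_wpM2r _ Eu))// -mulrA ler_wpM2l//.
  rewrite ler_pM// (le_trans u1)// (le_trans (ltW h4))//.
  by rewrite ler_piMr ?(ltW d0)// invf_le1// ler1n.
Qed.

(* Apply the previous bound to the [2 i pi]-periodic function
   [(f (a + cexp s) - f a) * cexp (- s)], which tends to [d] as [Re s] tends to -oo. *)
Lemma cauchy_estimate (f : R[i] -> R[i]) (a d : R[i]) (r K : R) :
  (forall s, exists d, cderiv f s d) -> cderiv f a d -> 0 < r ->
  (forall s, normc (s - a) <= r -> normc (f s) <= K) ->
  normc d <= 4 * K / r.
Proof.
move=> df da r0 H.
pose psi s := (f (a + cexp s) - f a) * cexp (- s).
have dpsi s : exists d, cderiv psi s d.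
  have [d1 H1] := df (a + cexp s).
  have aux : cderiv (fun s => a + cexp s) s (0 + cexp s).
    by apply: cderivD; [exact: cderiv_cst|exact: cexp_deriv].
  have [d2 H2] : exists d, cderiv (fun s => cexp (- s)) s d.
    exists (cexp (- s) * (-1 * 1)); apply: (@cderiv_comp _ cexp (fun s => - s)).
      exact: cexp_deriv.
    move=> e e0; exists 1 => // h _; rewrite mulr1 mulN1r opprD opprK opprK.
    by rewrite (_ : _ + _ = 0) ?normc0 ?mulr_ge0 ?normc_ge0 ?(ltW e0)//; ring.
  exists ((d1 * (0 + cexp s) + 0) * cexp (- s) + (f (a + cexp s) - f a) * d2).
  apply: cderivM H2; apply: cderivD; last exact: cderiv_cst.
  by apply: (@cderiv_comp _ f (fun s => a + cexp s)).
have per s : psi (s + 'i * (pi *+ 2)%:C) = psi s.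
  rewrite /psi cexp_period; congr (_ * _).
  by rewrite -[LHS]cexp_period opprD -addrA addNr addr0.
apply/ler_addgt0Pr => e e0; have e20 : 0 < e / 2 by rewrite divr_gt0.
have [q q0 Hq] := da _ e20.
(* On the abscissa [ln r] the point [a + cexp s] lies on the circle of radius [r], where [psi] is at
   most [2 * K / r]; on the abscissa [x0] it is so close to [a] that the difference quotient is
   within [e / 2] of [d]. *)
pose x1 := ln r; pose x0 := Num.min x1 (ln (q / 2)).
have q20 : 0 < q / 2 by rewrite divr_gt0.
have eK : 4 * K / r + e = 2 * (e / 2 + 2 * K / r).
  by field; rewrite gt_eqF.
rewrite eK; apply: (@periodic_mean_bound R psi (Num.min x0 0 - 1) dpsi (pi *+ 2) x0 x1).
- by rewrite mulrn_wgt0// pi_gt0.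
- by rewrite ge_min lexx.
- by rewrite ltrBlDr add0r gt_min ltr01 orbT.
- by rewrite ltrBlDr gt_min ltrDl ltr01.
- exact: per.
- move=> t; set s := x0%:C + _.
  have N : normc (cexp s) < q.
    rewrite normc_cexp /s ReD ReMr /= mul0r addr0.
    rewrite (@le_lt_trans _ _ (expR (ln (q / 2))))//; first by rewrite ler_expR ge_min lexx orbT.
    by rewrite lnK ?posrE// ltr_pdivrMr// ltr_pMr// ltr1n.
  have := Hq _ N.
  have -> : psi s - d = (f (a + cexp s) - f a - d * cexp s) * cexp (- s).
    by rewrite /psi [RHS]mulrBl -[d * cexp s * _]mulrA cexpNK mulr1.
  rewrite normcM => /(ler_wpM2r (normc_ge0 (cexp (- s)))) /le_trans; apply.
  by rewrite -mulrA -normcM cexpNK normc1 mulr1.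
- move=> t; set s := x1%:C + _.
  have N : normc (cexp s) = r.
    by rewrite normc_cexp /s ReD ReMr /= mul0r addr0 lnK.
  have -> : psi s = (f (a + cexp s) - f a) / cexp s.
    rewrite /psi; congr (_ * _); apply: (@mulfI _ (cexp s)); last rewrite cexpNK divff//;
    by rewrite -normc_gt0 N.
  rewrite normcM normcV N ler_wpM2r ?invr_ge0 ?(ltW r0)//.
  rewrite (le_trans (normcB _ _))// mulr_natl mulr2n lerD// H//.
    by rewrite addrAC subrr add0r N.
  by rewrite subrr normc0 ltW.
Qed.

Lemma segment_bound (f : R[i] -> R[i]) (t : R[i]) (K : R) :
  (forall s, normc s <= normc t -> exists2 d, cderiv f s d & normc d <= K) ->
  normc (f t - f 0) <= 2 * K * normc t.
Proof.
move=> H.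
have /choice[d Hd] : forall s, exists d, normc s <= normc t -> cderiv f s d /\ normc d <= K.
  move=> s; have [/H[d d1 d2]|_] := leP (normc s) (normc t); by [exists d|exists 0].
have := @crderiv_bound R (fun x => f (0 + t * x%:C)) (fun x => d (0 + t * x%:C) * t) 0 1 (K * normc t) ler01.
rewrite subr0 !mulr1 mulr0 !add0r mulrA; apply.
move=> x /andP[x0 x1].
have nx : normc (0 + t * x%:C) <= normc t.
  by rewrite add0r normcM normc_real ger0_norm// ler_piMr ?normc_ge0.
have [h1 h2] := Hd _ nx; split; first exact: crderiv_line.
by rewrite normcM ler_wpM2r ?normc_ge0.
Qed.

(** About a point of the disc of radius [r / 2] there is room for a disc of radius [r / 2], so the
    derivative is at most [8 * K / r] there; [segment_bound] doubles this. *)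
Lemma lipschitz_estimate (f : R[i] -> R[i]) (r K : R) (t : R[i]) :
  (forall s, exists d, cderiv f s d) -> 0 < r ->
  (forall s, normc s <= r -> normc (f s) <= K) -> normc t <= r / 2 ->
  normc (f t - f 0) <= 16 * K / r * normc t.
Proof.
move=> df r0 H tr.
have -> : 16 * K / r = 2 * (4 * K / (r / 2)) by rewrite invfM invrK; ring.
apply: segment_bound => s st; have [d Hd] := df s; exists d => //.
apply: (cauchy_estimate df Hd); first exact: divr_gt0.
move=> u us; apply: H; rewrite -[u](subrK s) (le_trans (normcD _ _))// [r]splitr lerD//.
exact: le_trans tr.
Qed.

(** The variation [D s - d] of the derivative is the derivative at 0 of [f (u + s) - f u]. That
    function is small by the Lipschitz estimate, so Cauchy's estimate with radius [r / 4] makes [D]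
    Lipschitz at 0 with constant [512 * K / r ^+ 2]; then [segment_bound] applies to
    [f s - d * s]. *)
Lemma quadratic_estimate (f : R[i] -> R[i]) (d : R[i]) (r K : R) (t : R[i]) :
  (forall s, exists d, cderiv f s d) -> cderiv f 0 d -> 0 < r ->
  (forall s, normc s <= r -> normc (f s) <= K) -> normc t <= r / 4 ->
  normc (f t - f 0 - d * t) <= 1024 * K / r ^+ 2 * normc t ^+ 2.
Proof.
move=> df d0 r0 H tr.
have K0 : 0 <= K by apply: le_trans (normc_ge0 (f 0)) _; apply: H; rewrite normc0 ltW.
have r4 : 0 < r / 4 by rewrite divr_gt0.
have /choice[D HD] := df.
have lip s : normc s <= normc t -> normc (D s - d) <= 512 * K / r ^+ 2 * normc t.
  move=> st.
  have dg u : cderiv (fun u => f (u + s) + -1 * f u) u (D (u + s) * (1 + 0) + (0 * f u + -1 * D u)).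
    apply: cderivD; last by apply: cderivM => //; exact: cderiv_cst.
    apply: (@cderiv_comp _ f (fun u => u + s)) => //.
    by apply: cderivD; [exact: cderiv_id|exact: cderiv_cst].
  have dg0 : cderiv (fun u => f (u + s) + -1 * f u) 0 (D s - d).
    move: (dg 0).
    have D0 : cderiv (fun u => f (u + s) + -1 * f u) 0 (D s * (1 + 0) + (0 * f 0 + -1 * d)).
      apply: cderivD; last by apply: cderivM => //; exact: cderiv_cst.
      apply: (@cderiv_comp _ f (fun u => u + s)); first by rewrite add0r.
      by apply: cderivD; [exact: cderiv_id|exact: cderiv_cst].
    by move=> _; move: D0; rewrite addr0 mulr1 mul0r add0r mulN1r.
  have -> : 512 * K / r ^+ 2 * normc t = 4 * (32 * K / r * normc t) / (r / 4).
    by field; rewrite gt_eqF.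
  apply: (cauchy_estimate (fun u => ex_intro _ _ (dg u)) dg0 r4) => u; rewrite subr0 => ur.
  rewrite mulN1r.
  have -> : f (u + s) - f u = (fun v => f (u + v)) s - (fun v => f (u + v)) 0 by rewrite addr0.
  have -> : 32 * K / r = 16 * K / (r / 2) by field; rewrite gt_eqF.
  have := @lipschitz_estimate (fun v => f (u + v)) (r / 2) K s.
  move=> LE; apply: (@le_trans _ _ (16 * K / (r / 2) * normc s)).
    apply: LE.
    - move=> v; eexists; apply: (@cderiv_comp _ f (fun v => u + v)); first exact: HD.
      by apply: cderivD; [exact: cderiv_cst|exact: cderiv_id].
    - by rewrite divr_gt0.
    - move=> v vr; apply: H; rewrite (le_trans (normcD _ _))//.
      rewrite [r]splitr lerD// (le_trans ur)// ler_pM2l// lef_pV2 ?posrE// ler_nat//.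
    - rewrite (le_trans st)// (le_trans tr)// -mulrA ler_pM2l//.
      by rewrite -invfM -natrM.
  by rewrite ler_wpM2l// divr_ge0 ?mulr_ge0 ?divr_ge0 ?(ltW r0).
have := @segment_bound (fun s => f s + (- d) * s) t (512 * K / r ^+ 2 * normc t).
rewrite mulr0 addr0.
have -> : f t + - d * t - f 0 = f t - f 0 - d * t by ring.
move=> SB; rewrite (le_trans (SB _))//; last first.
  by rewrite expr2 !mulrA -natrM.
move=> s st; exists (D s + (0 * s + (- d) * 1)); last first.
  by rewrite mul0r add0r mulr1; exact: lip.
apply: cderivD; first exact: HD.
by apply: cderivM; [exact: cderiv_cst|exact: cderiv_id].
Qed.

End CauchyEstimate.

(** * Entire functions of several variables *)

Lemma complex_complete (R : realType) (u : nat -> R[i]) :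
  (forall e : R, 0 < e -> exists m0, forall m m', (m0 <= m)%N -> (m0 <= m')%N ->
     normc (u m - u m') <= e) ->
  exists l, forall e : R, 0 < e -> exists m0, forall m, (m0 <= m)%N -> normc (u m - l) <= e.
Proof.
move=> H.
have real (v : nat -> R) : (forall m m', `|v m - v m'| <= normc (u m - u m')) ->
    exists l, forall e : R, 0 < e -> exists m0, forall m, (m0 <= m)%N -> `|v m - l| <= e.
  move=> vu; have : cvg (v @ \oo).
    apply/cauchy_cvgP/cauchy_exP => e e0.
    have e20 : 0 < e / 2 by rewrite divr_gt0.
    have [m0 Hm] := H _ e20; exists (v m0); exists m0 => // m /= mm.
    rewrite /ball/= (le_lt_trans (vu _ _))// (le_lt_trans (Hm _ _ _ _))//.
    by rewrite ltr_pdivrMr// ltr_pMr// ltr1n.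
  move=> /cvg_ex[l /cvgrPdist_le Hl]; exists l => e /Hl[m0 _ Hm]; exists m0 => m mm.
  by rewrite distrC; exact: Hm.
have [|a Ha] := real (fun m => Re (u m)); first by move=> m m'; rewrite -ReB Re_le_normc.
have [|b Hb] := real (fun m => Im (u m)); first by move=> m m'; rewrite -ImB Im_le_normc.
exists (a +i* b) => e e0; have e20 : 0 < e / 2 by rewrite divr_gt0.
have [m1 {}Ha] := Ha _ e20.
have [m2 {}Hb] := Hb _ e20.
exists (maxn m1 m2) => m; rewrite geq_max => /andP[h1 h2].
rewrite (le_trans (normc_le_ReIm _))// ReB ImB [e]splitr lerD ?Ha ?Hb//.
Qed.

Section Points.
Variable R : realType.
Local Notation C := R[i].

Definition co n (z : pt R n) (i : 'I_n) : C := cplx (tnth z i).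
Definition mkpt n (c : 'I_n -> C) : pt R n := [tuple (Re (c i), Im (c i)) | i < n].
Definition scalept n (t : C) (z : pt R n) : pt R n := mkpt (fun i => t * co z i).
Definition zeropt n : pt R n := mkpt (fun=> 0).
Definition unitpt n (i : 'I_n) : pt R n := mkpt (fun j => (j == i)%:R).

Section Coordinates.
Variable n : nat.
Implicit Types z w h : pt R n.

Lemma co_mkpt (c : 'I_n -> C) i : co (mkpt c) i = c i.
Proof. by rewrite /co /cplx tnth_mktuple /=; case: (c i). Qed.

Lemma co_add z w i : co (addpt z w) i = co z i + co w i.
Proof. by rewrite /co /cplx tnth_mktuple. Qed.

Lemma co_sub z w i : co (subpt z w) i = co z i - co w i.
Proof. by rewrite /co /cplx tnth_mktuple. Qed.

Lemma co_scale t z i : co (scalept t z) i = t * co z i.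
Proof. exact: co_mkpt. Qed.

Lemma co_zero i : co (zeropt n) i = 0.
Proof. exact: co_mkpt. Qed.

Lemma co_unit i j : co (unitpt i : pt R n) j = (j == i)%:R.
Proof. exact: co_mkpt. Qed.

Lemma pt_ext z w : (forall i, co z i = co w i) -> z = w.
Proof.
move=> H; apply: eq_from_tnth => i; have := H i; rewrite /co /cplx.
by case: (tnth z i) => a b; case: (tnth w i) => c d /= [-> ->].
Qed.

Definition coE := (co_mkpt, co_add, co_sub, co_scale, co_zero, co_unit).

Lemma ptnormE z : ptnorm z = \sum_(i < n) normc (co z i).
Proof. by []. Qed.

Lemma ptnorm_ge0 z : 0 <= ptnorm z.
Proof. by apply: sumr_ge0 => i _; exact: normc_ge0. Qed.

Lemma ptnormD z w : ptnorm (addpt z w) <= ptnorm z + ptnorm w.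
Proof.
rewrite !ptnormE -big_split; apply: ler_sum => i _; rewrite co_add; exact: normcD.
Qed.

Lemma ptnorm_scale t z : ptnorm (scalept t z) = normc t * ptnorm z.
Proof.
by rewrite !ptnormE mulr_sumr; apply: eq_bigr => i _; rewrite co_scale normcM.
Qed.

Lemma ptnorm_zero : ptnorm (zeropt n) = 0.
Proof. by rewrite ptnormE big1// => i _; rewrite co_zero normc0. Qed.

Lemma ptnorm_unit (i : 'I_n) : ptnorm (unitpt i) = 1.
Proof.
rewrite ptnormE (bigD1 i)// co_unit eqxx normc1 big1; first exact: addr0.
move=> j ji; rewrite co_unit (negbTE (ji : j != i)); exact: normc0.
Qed.

Lemma co_le_ptnorm z i : normc (co z i) <= ptnorm z.
Proof.
by rewrite ptnormE (bigD1 i)//= lerDl sumr_ge0// => j _; exact: normc_ge0.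
Qed.

Lemma ptnorm_subC z w : ptnorm (subpt z w) = ptnorm (subpt w z).
Proof. by rewrite !ptnormE; apply: eq_bigr => i _; rewrite !co_sub normcBC. Qed.

Lemma ptnorm_sub_trans z w x : ptnorm (subpt z x) <= ptnorm (subpt z w) + ptnorm (subpt w x).
Proof.
rewrite (_ : subpt z x = addpt (subpt z w) (subpt w x)) ?ptnormD//.
by apply: pt_ext => i; rewrite !coE addrA subrK.
Qed.

Lemma addptK z h : subpt (addpt z h) z = h.
Proof. by apply: pt_ext => i; rewrite !coE addrAC subrr add0r. Qed.

Lemma subptK z w : addpt z (subpt w z) = w.
Proof. by apply: pt_ext => i; rewrite !coE addrC subrK. Qed.

Lemma subptt z : subpt z z = zeropt n.
Proof. by apply: pt_ext => i; rewrite !coE subrr. Qed.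

Lemma addpt0 z : addpt z (zeropt n) = z.
Proof. by apply: pt_ext => i; rewrite !coE addr0. Qed.

Lemma addptA x y z : addpt x (addpt y z) = addpt (addpt x y) z.
Proof. by apply: pt_ext => i; rewrite !coE addrA. Qed.

Lemma scale0pt z : scalept 0 z = zeropt n.
Proof. by apply: pt_ext => i; rewrite !coE mul0r. Qed.

Lemma scale1pt z : scalept 1 z = z.
Proof. by apply: pt_ext => i; rewrite !coE mul1r. Qed.

Lemma scaleDpt s t z : scalept (s + t) z = addpt (scalept s z) (scalept t z).
Proof. by apply: pt_ext => i; rewrite !coE mulrDl. Qed.

(** The condition inside [entire], with the gradient as a function on ['I_n] instead of a tuple, so
    that gradients are written by formulas in the index. *)
Definition has_diff (f : pt R n -> C) z (a : 'I_n -> C) : Prop :=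
  forall e : R, 0 < e -> exists2 d : R, 0 < d & forall h, ptnorm h < d ->
    normc (f (addpt z h) - f z - \sum_(i < n) a i * co h i) <= e * ptnorm h.

Lemma entireP (f : pt R n -> C) : entire f <-> forall z, exists a, has_diff f z a.
Proof.
split=> H z.
- have [a Ha] := H z; exists (tnth a) => e /Ha[d [d0 Hd]]; by exists d.
- have [a Ha] := H z; exists [tuple a i | i < n] => e /Ha[d d0 Hd]; exists d.
  split=> // h /Hd; under eq_bigr do rewrite -(tnth_mktuple a).
  by [].
Qed.

Lemma sum_unit (a : 'I_n -> C) (t : C) i : \sum_(j < n) a j * co (scalept t (unitpt i)) j = a i * t.
Proof.
rewrite (bigD1 i)//= !coE eqxx mulr1 big1 ?addr0// => j ji.
by rewrite !coE (negbTE ji) !mulr0.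
Qed.

Lemma has_diff_line f p u t a : has_diff f (addpt p (scalept t u)) a ->
  cderiv (fun t => f (addpt p (scalept t u))) t (\sum_(i < n) a i * co u i).
Proof.
move=> H e e0; have u1 : 0 < ptnorm u + 1 by rewrite ltr_wpDl ?ptnorm_ge0.
have [d d0 Hd] := H _ (divr_gt0 e0 u1).
exists (d / (ptnorm u + 1)) => [|h]; first exact: divr_gt0.
rewrite ltr_pdivlMr// => hd.
have hu : normc h * ptnorm u <= normc h * (ptnorm u + 1).
  by rewrite ler_wpM2l ?normc_ge0// lerDl.
have := Hd (scalept h u); rewrite ptnorm_scale (le_lt_trans hu)// => /(_ isT).
rewrite -addptA -scaleDpt.
have -> : \sum_(i < n) a i * co (scalept h u) i = (\sum_(i < n) a i * co u i) * h.
  by rewrite mulr_suml; apply: eq_bigr => i _; rewrite co_scale mulrCA mulrC.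
move=> /le_trans; apply; rewrite -mulrA ler_wpM2l ?(ltW e0)// ler_pdivrMl//.
by rewrite [X in _ <= X]mulrC.
Qed.

Lemma entire_line (f : pt R n -> C) p u : entire f ->
  forall t, exists d, cderiv (fun t => f (addpt p (scalept t u))) t d.
Proof.
move=> /entireP H t; have [a Ha] := H (addpt p (scalept t u)).
by eexists; exact: has_diff_line Ha.
Qed.

Lemma has_diffD f g z a b : has_diff f z a -> has_diff g z b ->
  has_diff (fun w => f w + g w) z (fun i => a i + b i).
Proof.
move=> HF HG e e0; have e20 : 0 < e / 2 by rewrite divr_gt0.
have [r r0 K] := HF _ e20; have [s s0 L] := HG _ e20.
exists (Num.min r s) => [|h]; first by rewrite lt_min r0.
rewrite lt_min => /andP[/K hr /L hs].
under eq_bigr do rewrite mulrDl.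
rewrite big_split /=.
set A := \sum_(i < n) a i * _ in hr *; set B := \sum_(i < n) b i * _ in hs *.
rewrite [X in normc X](_ : _ = (f (addpt z h) - f z - A) + (g (addpt z h) - g z - B)); last by ring.
by rewrite (le_trans (normcD _ _))// (le_trans (lerD hr hs))// -mulrDl -splitr.
Qed.

Lemma has_diff_cst (c : C) z : has_diff (fun=> c) z (fun=> 0).
Proof.
move=> e e0; exists 1 => // h _; rewrite big1 => [|i _]; last by rewrite mul0r.
by rewrite !subrr normc0 mulr_ge0 ?ptnorm_ge0// ltW.
Qed.

Lemma has_diff_lip f z a : has_diff f z a ->
  exists2 d : R, 0 < d & exists2 A : R, 0 < A &
    forall h, ptnorm h < d -> normc (f (addpt z h) - f z) <= A * ptnorm h.
Proof.
move=> H; have [d d0 K] := H 1 ltr01; exists d => //.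
exists (\sum_(i < n) normc (a i) + 1) => [|h /K].
  by rewrite ltr_wpDl ?sumr_ge0// => i _; exact: normc_ge0.
rewrite mul1r => Kh.
rewrite -[X in normc X](subrK (\sum_(i < n) a i * co h i)) (le_trans (normcD _ _))//.
rewrite mulrDl mul1r addrC lerD// (le_trans (normc_sum _ _ _))//.
rewrite mulr_suml; apply: ler_sum => i _.
by rewrite normcM ler_wpM2l ?normc_ge0// co_le_ptnorm.
Qed.

Lemma has_diffM f g z a b : has_diff f z a -> has_diff g z b ->
  has_diff (fun w => f w * g w) z (fun i => a i * g z + f z * b i).
Proof.
move=> Hf Hg e e0.
pose A := normc (g z) + 1; have A0 : 0 < A by rewrite ltr_wpDl ?normc_ge0.
pose B := normc (f z) + 1; have B0 : 0 < B by rewrite ltr_wpDl ?normc_ge0.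
have [r3 r30 [p p0 Lf]] := has_diff_lip Hf; have [r4 r40 [q q0 Lg]] := has_diff_lip Hg.
pose D := p * q; have D0 : 0 < D by rewrite mulr_gt0.
have e30 : 0 < e / 3 by rewrite divr_gt0.
have [r1 r10 K] := Hf _ (divr_gt0 e30 A0); have [r2 r20 M] := Hg _ (divr_gt0 e30 B0).
exists (Num.min (Num.min r1 r2) (Num.min (Num.min r3 r4) (e / 3 / D))) => [|h].
  by rewrite !lt_min r10 r20 r30 r40 divr_gt0.
rewrite !lt_min -!andbA => /and5P[/K h1 /M h2 /Lf h3 /Lg h4]; rewrite ltr_pdivlMr// => h5.
have -> : \sum_(i < n) (a i * g z + f z * b i) * co h i =
   (\sum_(i < n) a i * co h i) * g z + f z * \sum_(i < n) b i * co h i.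
  rewrite mulr_suml mulr_sumr -big_split; apply: eq_bigr => i _ /=; ring.
set SA := \sum_(i < n) _ in h1 *; set SB := \sum_(i < n) _ in h2 *.
rewrite [X in normc X](_ : _ = (f (addpt z h) - f z - SA) * g z + f z * (g (addpt z h) - g z - SB)
  + (f (addpt z h) - f z) * (g (addpt z h) - g z)); last by ring.
have -> : e * ptnorm h = e / 3 * ptnorm h + e / 3 * ptnorm h + e / 3 * ptnorm h by field.
have N0 := ptnorm_ge0 h.
rewrite (le_trans (normcD _ _))// lerD//; last first.
  rewrite normcM (le_trans (ler_pM (normc_ge0 _) (normc_ge0 _) h3 h4))//.
  rewrite mulrACA -/D mulrCA mulrA ler_wpM2r//.
  by rewrite ltW// mulrC.
rewrite (le_trans (normcD _ _))// lerD// normcM.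
- rewrite (le_trans (ler_pM (normc_ge0 _) (normc_ge0 _) h1 (lexx _)))//.
  rewrite mulrAC ler_wpM2r// -mulrA ler_piMr ?(ltW e30)//.
  by rewrite mulrC ler_pdivrMr// mul1r lerDl.
- rewrite (le_trans (ler_pM (normc_ge0 _) (normc_ge0 _) (lexx _) h2))//.
  rewrite mulrA ler_wpM2r// mulrCA ler_piMr ?(ltW e30)//.
  by rewrite ler_pdivrMr// mul1r lerDl.
Qed.

Lemma entireD f g : entire f -> entire g -> entire (fun z => f z + g z).
Proof.
move=> /entireP Hf /entireP Hg; apply/entireP => z.
by have [a Ha] := Hf z; have [b Hb] := Hg z; eexists; exact: has_diffD Ha Hb.
Qed.

Lemma entireM f g : entire f -> entire g -> entire (fun z => f z * g z).
Proof.
move=> /entireP Hf /entireP Hg; apply/entireP => z.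
by have [a Ha] := Hf z; have [b Hb] := Hg z; eexists; exact: has_diffM Ha Hb.
Qed.

Lemma entire_cst (c : C) : entire (fun _ : pt R n => c).
Proof. by apply/entireP => z; eexists; exact: has_diff_cst. Qed.

Lemma entireZ c f : entire f -> entire (fun z => c * f z).
Proof. by apply: entireM; exact: entire_cst. Qed.

Lemma entireB f g : entire f -> entire g -> entire (fun z => f z - g z).
Proof.
move=> Hf Hg; rewrite (_ : (fun z => _) = (fun z => f z + -1 * g z)).
  by apply: entireD => //; exact: entireZ.
by apply/funext => z; rewrite mulN1r.
Qed.

Lemma entire_sum (I : Type) (s : seq I) (P : pred I) (F : I -> pt R n -> C) :
  (forall i, entire (F i)) -> entire (fun z => \sum_(i <- s | P i) F i z).
Proof.
move=> H; elim: s => [|i s IH].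
  by under eq_fun do rewrite big_nil; exact: entire_cst.
under eq_fun do rewrite big_cons.
case: (P i) => //; exact: entireD.
Qed.

(** Increments along [unitpt i] isolate the coordinate [i]. Uniqueness lets [pdE] compute partial
    derivatives, which are defined by choice. *)
Lemma has_diff_unique f z a b : has_diff f z a -> has_diff f z b -> a =1 b.
Proof.
move=> Ha Hb i; apply/eqP; rewrite -subr_eq0 -normc_eq0 -[_ == _]negbK; apply/negP => n0.
have {}n0 : 0 < normc (a i - b i) by rewrite lt_neqAle eq_sym n0 normc_ge0.
pose e := normc (a i - b i) / 4; have e0 : 0 < e by rewrite divr_gt0.
have [r r0 K] := Ha _ e0; have [s s0 L] := Hb _ e0.
pose t : R := Num.min r s / 2.
have m0 : 0 < Num.min r s by rewrite lt_min r0.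
have t0 : 0 < t by rewrite divr_gt0.
have tm : t < Num.min r s by rewrite ltr_pdivrMr// ltr_pMr// ltr1n.
pose h := scalept t%:C (unitpt i).
have ht : ptnorm h = t by rewrite ptnorm_scale normc_real ptnorm_unit mulr1 gtr0_norm.
have := K h; have := L h; move: tm; rewrite lt_min ht => /andP[-> ->] /(_ isT) l1 /(_ isT) l2.
have : normc (a i - b i) * t <= e * t + e * t.
  rewrite -[X in _ * X](gtr0_norm t0) -normc_real -normcM.
  move: l1 l2; rewrite !sum_unit => l1 l2.
  have -> : (a i - b i) * t%:C = (f (addpt z h) - f z - b i * t%:C) - (f (addpt z h) - f z - a i * t%:C) by ring.
  by rewrite (le_trans (normcB _ _))// lerD.
rewrite -mulrDl ler_pM2r// /e; apply/negP; rewrite -ltNge; lra.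
Qed.

(** This is the one-variable estimate on the complex line through [z] in direction [h], at parameter
    1 and with radius [r / ptnorm h]; so the dimension does not enter the constant, and
    [ptnorm h = 0] is treated apart. *)
Lemma quadratic_estimate_pt f z a (r K : R) h :
  entire f -> has_diff f z a -> 0 < r ->
  (forall w, ptnorm (subpt w z) <= r -> normc (f w) <= K) -> ptnorm h <= r / 4 ->
  normc (f (addpt z h) - f z - \sum_(i < n) a i * co h i) <= 1024 * K / r ^+ 2 * ptnorm h ^+ 2.
Proof.
move=> ef fa r0 H hr; have [h0|hn] := eqVneq (ptnorm h) 0.
  have hz i : co h i = 0.
    apply/eqP; rewrite -normc_eq0 eq_le normc_ge0 andbT -h0; exact: co_le_ptnorm.
  rewrite (_ : addpt z h = z); last by apply: pt_ext => i; rewrite co_add hz addr0.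
  rewrite big1 => [|i _]; last by rewrite hz mulr0.
  by rewrite h0 !subrr normc0 expr0n mulr0.
have h0 : 0 < ptnorm h by rewrite lt_neqAle eq_sym hn ptnorm_ge0.
have := @quadratic_estimate _ (fun t => f (addpt z (scalept t h))) (\sum_(i < n) a i * co h i) (r / ptnorm h) K 1.
rewrite scale1pt scale0pt addpt0 mulr1 normc1 expr1n mulr1 => /(_ (entire_line _ _ ef)).
have -> : 1024 * K / (r / ptnorm h) ^+ 2 = 1024 * K / r ^+ 2 * ptnorm h ^+ 2.
  by field; rewrite hn gt_eqF.
apply.
- by apply: has_diff_line; rewrite scale0pt addpt0.
- by rewrite divr_gt0.
- move=> s sr; apply: H; rewrite addptK ptnorm_scale; by rewrite -ler_pdivlMr.
- by rewrite mulrAC ler_pdivlMr// mul1r.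
Qed.

Lemma partial_estimate f z a (r K : R) i :
  entire f -> has_diff f z a -> 0 < r ->
  (forall w, ptnorm (subpt w z) <= r -> normc (f w) <= K) ->
  normc (a i) <= 4 * K / r.
Proof.
move=> ef fa r0 H; apply: (@cauchy_estimate _ (fun t => f (addpt z (scalept t (unitpt i)))) 0) => //.
- exact: entire_line.
- have -> : a i = \sum_(j < n) a j * co (unitpt i) j.
    by rewrite -[LHS]mulr1 -(sum_unit a) scale1pt.
  by apply: has_diff_line; rewrite scale0pt addpt0.
- by move=> s; rewrite subr0 => sr; apply: H; rewrite addptK ptnorm_scale ptnorm_unit mulr1.
Qed.

Lemma entire_locally_bounded f z : entire f ->
  exists2 r : R, 0 < r & exists K : R, forall w, ptnorm (subpt w z) <= r -> normc (f w) <= K.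
Proof.
move=> /entireP/(_ z)[a /has_diff_lip[d d0 [A A0 H]]].
exists (d / 2); first by rewrite divr_gt0.
exists (A * d + normc (f z)) => w wd.
have wd' : ptnorm (subpt w z) < d.
  by rewrite (le_lt_trans wd)// ltr_pdivrMr// ltr_pMr// ltr1n.
have := H _ wd'; rewrite subptK => Hw.
rewrite -[f w](subrK (f z)) (le_trans (normcD _ _))// lerD2r (le_trans Hw)//.
by rewrite ler_wpM2l ?ltW.
Qed.

(** Weierstrass' theorem. Cauchy's estimates make the gradients at [z] converge. The expansion of a
    single [F m0] then passes to the limit, because the Taylor remainders of [F m - F m0] are
    quadratically small uniformly in [m]. *)
Lemma entire_limit (F : nat -> pt R n -> C) f : (forall m, entire (F m)) ->
  (forall z, exists2 r : R, 0 < r & forall e : R, 0 < e -> exists m0, forall m, (m0 <= m)%N ->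
     forall w, ptnorm (subpt w z) <= r -> normc (F m w - f w) <= e) ->
  entire f.
Proof.
move=> eF H; apply/entireP => z; have [r r0 Hr] := H z.
have /choice[A HA] : forall m, exists a, has_diff (F m) z a by move=> m; have /entireP := eF m.
have diffB m m' : has_diff (fun w => F m w + -1 * F m' w) z (fun i => A m i + (0 * F m' z + -1 * A m' i)).
  by apply: has_diffD => //; apply: has_diffM => //; exact: has_diff_cst.
have eB m m' : entire (fun w => F m w + -1 * F m' w).
  by apply: entireD => //; exact: entireZ.
have close (e : R) : 0 < e -> exists m0, forall m m', (m0 <= m)%N -> (m0 <= m')%N ->
    forall w, ptnorm (subpt w z) <= r -> normc (F m w + -1 * F m' w) <= e.
  move=> e0; have [m0 Hm] := Hr _ (divr_gt0 e0 (ltr0n _ 2)).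
  exists m0 => m m' mm mm' w wr; rewrite mulN1r.
  have -> : F m w - F m' w = (F m w - f w) - (F m' w - f w) by ring.
  by rewrite (le_trans (normcB _ _))// [e]splitr lerD// Hm.
have /choice[a Ha] : forall i, exists l, forall e : R, 0 < e ->
    exists m0, forall m, (m0 <= m)%N -> normc (A m i - l) <= e.
  move=> i; apply: complex_complete => e e0.
  have e4 : 0 < e * r / 4 by rewrite divr_gt0// mulr_gt0.
  have [m0 Hm] := close _ e4; exists m0 => m m' mm mm'.
  have := partial_estimate i (eB m m') (diffB m m') r0 (Hm m m' mm mm').
  rewrite mul0r add0r mulN1r => /le_trans; apply.
  by rewrite mulrCA divff// mulr1 mulfK// gt_eqF.
exists a => e e0.
(* The crude bound 1 on [F m - F m0] is enough: it gives the remainder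
   [1024 / r ^+ 2 * ptnorm h ^+ 2], and [q] below is the radius where this is at most
   [e / 2 * ptnorm h]. *)
have [m0 Hm0] := close 1 ltr01.
have e20 : 0 < e / 2 by rewrite divr_gt0.
have [d d0 Hd] := HA m0 _ e20.
pose q := e / 2 / (1024 / r ^+ 2).
have c0 : 0 < 1024 / r ^+ 2 :> R by apply: mulr_gt0; [rewrite ltr0n|rewrite invr_gt0 exprn_gt0].
have q0 : 0 < q by exact: divr_gt0.
exists (Num.min d (Num.min (r / 4) q)) => [|h]; first by rewrite !lt_min d0 q0 andbT divr_gt0.
rewrite !lt_min => /and3P[hd /ltW hr /ltW hq].
have N0 := ptnorm_ge0 h.
have lim : normc ((f (addpt z h) - f z - \sum_(i < n) a i * co h i) -
    (F m0 (addpt z h) - F m0 z - \sum_(i < n) A m0 i * co h i)) <= e / 2 * ptnorm h.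
  (* Here [h] is fixed and [m] is taken large in terms of the slack [t]. *)
  apply/ler_addgt0Pr => t t0.
  pose t4 := t / (2 + ptnorm h).
  have t40 : 0 < t4 by rewrite divr_gt0// ltr_wpDr.
  have /choice[ms Hms] : forall i, exists m1, forall m, (m1 <= m)%N -> normc (A m i - a i) <= t4.
    by move=> i; exact: Ha.
  have [m1 Hm1] := Hr _ t40.
  pose m := maxn m0 (maxn m1 (\max_(i < n) ms i)).
  have mm0 : (m0 <= m)%N by rewrite leq_maxl.
  have mm1 : (m1 <= m)%N by rewrite (leq_trans _ (leq_maxr _ _))// leq_maxl.
  have mms i : (ms i <= m)%N.
    by rewrite (leq_trans _ (leq_maxr _ _))// (leq_trans _ (leq_maxr _ _))// leq_bigmax.
  have := quadratic_estimate_pt (eB m m0) (diffB m m0) r0 (Hm0 m m0 mm0 (leqnn _)) hr.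
  rewrite mulr1 => Q.
  have zr : ptnorm (subpt z z) <= r by rewrite subptt ptnorm_zero ltW.
  have zhr : ptnorm (subpt (addpt z h) z) <= r.
    by rewrite addptK (le_trans hr)// ler_pdivrMr// ler_peMr ?(ltW r0)// ler1n.
  have S1 := Hm1 m mm1 _ zr; have S2 := Hm1 m mm1 _ zhr.
  have S3 : normc (\sum_(i < n) (A m i - a i) * co h i) <= t4 * ptnorm h.
    rewrite (le_trans (normc_sum _ _ _))// ptnormE mulr_sumr; apply: ler_sum => i _.
    by rewrite normcM ler_wpM2r ?normc_ge0// Hms.
  have e1 : \sum_(i < n) (A m i - a i) * co h i = \sum_(i < n) A m i * co h i - \sum_(i < n) a i * co h i.
    by rewrite -sumrB; apply: eq_bigr => i _; rewrite mulrBl.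
  have e2 : \sum_(i < n) (A m i + (0 * F m0 z + -1 * A m0 i)) * co h i =
     \sum_(i < n) A m i * co h i - \sum_(i < n) A m0 i * co h i.
    by rewrite -sumrB; apply: eq_bigr => i _; ring.
  rewrite e2 in Q; rewrite e1 in S3.
  move: Q S3; set SA := \sum_(i < n) A m i * _; set Sa := \sum_(i < n) a i * _.
  set S0 := \sum_(i < n) A m0 i * _ => Q S3.
  rewrite [X in normc X](_ : _ = (F m (addpt z h) + -1 * F m0 (addpt z h) - (F m z + -1 * F m0 z) - (SA - S0))
    - ((F m (addpt z h) - f (addpt z h)) - (F m z - f z) - (SA - Sa))); last by ring.
  rewrite (le_trans (normcB _ _))// lerD//.
    rewrite (le_trans Q)// expr2 mulrA ler_wpM2r//.
    by rewrite mulrC -ler_pdivlMr.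
  have -> : t = t4 + t4 + t4 * ptnorm h.
    by rewrite /t4; field; rewrite gt_eqF// ltr_wpDr.
  rewrite (le_trans (normcB _ _))// lerD//.
  by rewrite (le_trans (normcB _ _))// lerD.
rewrite -[X in normc X](subrK (F m0 (addpt z h) - F m0 z - \sum_(i < n) A m0 i * co h i)).
by rewrite (le_trans (normcD _ _))// [e]splitr mulrDl lerD// Hd.
Qed.

End Coordinates.
End Points.

(** * Iterated partial derivatives and Taylor estimates *)

(** A crude Stirling bound: [n ^ n] is at most the falling factorial [(n + n) ^_ n], which is a
    central binomial coefficient times the factorial of [n], and that coefficient is at most
    [2 ^ (n + n)]. *)
Lemma expnn_le_fact n : (n ^ n <= 4 ^ n * n`!)%N.
Proof.
have le_ffact m k : (k ^ m <= (k + m) ^_ m)%N.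
  elim: m => [|m IH]; first by rewrite expn0 ffactn0.
  by rewrite addnS ffactSS expnS leq_mul// -addnS leq_addr.
apply: leq_trans (le_ffact n n) _; rewrite -bin_ffact leq_mul2r; apply/orP; right.
have -> : (4 ^ n = (1 + 1) ^ (n + n))%N by rewrite -[(1 + 1)%N]/2%N addnn -mul2n expnM.
rewrite expnDn; under eq_bigr do rewrite !exp1n !muln1.
have hn : (n < (n + n).+1)%N by rewrite ltnS leq_addr.
by rewrite (bigD1 (Ordinal hn))//= leq_addr.
Qed.

Section Partial.
Variable R : realType.
Local Notation C := R[i].

Section Dim.
Variable n : nat.
Implicit Types (z w h : pt R n) (f g : pt R n -> C) (i : 'I_n).

(** Total by choice, with default 0 where no differential exists, so that partial derivatives are
    plain functions and can be iterated. *)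
Definition grad f z : 'I_n -> C :=
  if pselect (exists a, has_diff f z a) is left H then projT1 (cid H) else fun=> 0.

Lemma gradP f z : entire f -> has_diff f z (grad f z).
Proof.
move=> /entireP/(_ z) H; rewrite /grad; case: pselect => // H'.
exact: projT2 (cid H').
Qed.

Definition pd i f : pt R n -> C := fun z => grad f z i.

Lemma pdE f z a i : has_diff f z a -> pd i f z = a i.
Proof.
move=> H; rewrite /pd /grad; case: pselect => [H'|]; last by case; exists a.
exact: (has_diff_unique (projT2 (cid H')) H).
Qed.

Lemma pd_line f z h (t : C) : entire f ->
  cderiv (fun t => f (addpt z (scalept t h))) t (\sum_(i < n) pd i f (addpt z (scalept t h)) * co h i).
Proof. by move=> ef; apply: has_diff_line; exact: gradP. Qed.

Lemma pd_estimate f z (r K : R) i : entire f -> 0 < r ->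
  (forall w, ptnorm (subpt w z) <= r -> normc (f w) <= K) -> normc (pd i f z) <= 4 * K / r.
Proof. by move=> ef; apply: partial_estimate => //; exact: gradP. Qed.

(** The difference quotients with steps [m.+1%:R^-1] are entire, and the quadratic estimate makes
    their convergence locally uniform, so [entire_limit] applies. *)
Lemma pd_entire i f : entire f -> entire (pd i f).
Proof.
move=> ef; pose t m : R := m.+1%:R^-1.
have t0 m : 0 < t m by rewrite invr_gt0.
have := @entire_limit R n (fun m (w : pt R n) => (t m)^-1%:C * (f (addpt w (scalept (t m)%:C (unitpt R i))) - f w)) (pd i f).
apply.
  move=> m; apply: entireZ; apply: entireB => //.
  apply/entireP => z; have /entireP/(_ (addpt z (scalept (t m)%:C (unitpt R i))))[a Ha] := ef.
  exists a => e /Ha[d d0 Hd]; exists d => // h /Hd.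
  rewrite (_ : addpt (addpt z _) h = addpt (addpt z h) (scalept (t m)%:C (unitpt R i)))//.
  by apply: pt_ext => j; rewrite !coE addrAC.
move=> z; have [r r0 [K HK]] := entire_locally_bounded z ef.
pose s := r / 2; have s0 : 0 < s by rewrite divr_gt0.
exists s => // e e0.
pose Q := 1024 * K / s ^+ 2.
have K0 : 0 <= K by apply: le_trans (normc_ge0 (f z)) _; apply: HK; rewrite subptt ptnorm_zero ltW.
have Q0 : 0 <= Q.
  apply: mulr_ge0; last by rewrite invr_ge0 exprn_ge0// ltW.
  by apply: mulr_ge0; [exact: ler0n|exact: K0].
have [m0 Hm] : exists m0, forall m, (m0 <= m)%N -> t m <= Num.min (s / 4) (e / (Q + 1)).
  have c0 : 0 < Num.min (s / 4) (e / (Q + 1)).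
    by rewrite lt_min !divr_gt0// ltr_wpDl.
  exists (Num.truncn (Num.min (s / 4) (e / (Q + 1)))^-1) => m mm.
  rewrite invf_ple ?posrE// (le_trans (ltW (truncnS_gt _)))// ler_nat//.
exists m0 => m /Hm; rewrite le_min => /andP[tm1 tm2] w wz.
have nt : ptnorm (scalept (t m)%:C (unitpt R i : pt R n)) = t m.
  by rewrite ptnorm_scale normc_real ptnorm_unit mulr1 gtr0_norm.
have := @quadratic_estimate_pt _ _ f w (grad f w) s K (scalept (t m)%:C (unitpt R i)) ef (gradP w ef) s0.
rewrite nt => /(_ _ tm1) H.
have {}H : normc (f (addpt w (scalept (t m)%:C (unitpt R i))) - f w - pd i f w * (t m)%:C) <= Q * t m ^+ 2.
  rewrite -sum_unit; apply: H => x xw; apply: HK.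
  by rewrite (le_trans (ptnorm_sub_trans _ w _))// [r]splitr lerD.
have tC : (t m)%:C * (t m)^-1%:C = 1 :> C.
  by rewrite -rmorphM/= divff// gt_eqF.
rewrite [X in normc X](_ : _ = (t m)^-1%:C * (f (addpt w (scalept (t m)%:C (unitpt R i))) - f w - pd i f w * (t m)%:C)); last first.
  by rewrite [RHS]mulrBr; congr (_ - _); rewrite [RHS]mulrCA [_ * (t m)%:C]mulrC tC mulr1.
rewrite normcM normc_real ger0_norm ?invr_ge0 ?(ltW (t0 m))//.
rewrite ler_pdivrMl// (le_trans H)// expr2 mulrA mulrC ler_wpM2l ?(ltW (t0 m))//.
rewrite (@le_trans _ _ ((Q + 1) * t m))//; first by rewrite ler_wpM2r ?lerDl// ltW.
by rewrite mulrC -ler_pdivlMr// ltr_wpDl.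
Qed.

Lemma pdD i f g : entire f -> entire g -> pd i (fun z => f z + g z) = (fun z => pd i f z + pd i g z).
Proof.
move=> ef eg; apply/funext => z; exact: (pdE _ (has_diffD (gradP z ef) (gradP z eg))).
Qed.

Lemma pdZ i c f : entire f -> pd i (fun z => c * f z) = (fun z => c * pd i f z).
Proof.
move=> ef; apply/funext => z.
by rewrite (pdE _ (has_diffM (has_diff_cst c z) (gradP z ef))) mul0r add0r.
Qed.

(** Iterated derivatives are indexed by words rather than multi-indices: every induction peels off
    one letter, and there are [n ^ m] words of length [m]. *)
Fixpoint pdw (s : seq 'I_n) f := if s is i :: s' then pdw s' (pd i f) else f.

Lemma pdw_entire s f : entire f -> entire (pdw s f).
Proof. by elim: s f => //= i s IH f ef; apply: IH; exact: pd_entire. Qed.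

Lemma pdwD s f g : entire f -> entire g -> pdw s (fun z => f z + g z) = (fun z => pdw s f z + pdw s g z).
Proof.
elim: s f g => //= i s IH f g ef eg.
by rewrite pdD// IH//; exact: pd_entire.
Qed.

Lemma pdwZ s c f : entire f -> pdw s (fun z => c * f z) = (fun z => c * pdw s f z).
Proof.
by elim: s f => //= i s IH f ef; rewrite pdZ// IH//; exact: pd_entire.
Qed.

(** One Cauchy estimate of radius [d] per letter; each derivative uses up a margin [d] of the ball
    on which [f] is bounded. *)
Lemma pdw_estimate s f z (r d K : R) : entire f -> 0 < d ->
  (forall x, ptnorm (subpt x z) <= r + d * (size s)%:R -> normc (f x) <= K) ->
  forall x, ptnorm (subpt x z) <= r -> normc (pdw s f x) <= (4 / d) ^+ size s * K.
Proof.
move=> + d0; elim: s f K => [|i s IH] f K ef H x xr /=.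
  by rewrite expr0 mul1r; apply: H; rewrite mulr0 addr0.
rewrite exprSr -mulrA; apply: IH => // [|y yr]; first exact: pd_entire.
rewrite mulrAC; apply: pd_estimate => // w wy; apply: H.
rewrite (le_trans (ptnorm_sub_trans _ y _))// addrC /= -natr1 mulrDr mulr1 addrA lerD//.
Qed.

Fixpoint words m : seq (seq 'I_n) :=
  if m is m'.+1 then [seq i :: s | i <- enum 'I_n, s <- words m'] else [:: [::]].

Lemma size_words m s : s \in words m -> size s = m.
Proof.
elim: m s => [|m IH] s /=; first by rewrite inE => /eqP ->.
by case/allpairsP => -[i s'] /= [_ /IH <- ->].
Qed.

Lemma words_uniq m : uniq (words m).
Proof.
elim: m => //= m IH; apply: allpairs_uniq => //; first exact: enum_uniq.
by move=> [i s] [j s'] _ _ /= [-> ->].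
Qed.

Lemma size_wordsE m : size (words m) = (n ^ m)%N.
Proof. by elim: m => //= m IH; rewrite size_allpairs IH size_enum_ord expnS. Qed.

Definition jet m f a : R := \sum_(s <- words m) normc (pdw s f a).

Lemma jetS m f a : jet m.+1 f a = \sum_(i < n) jet m (pd i f) a.
Proof. by rewrite /jet /= big_allpairs_dep big_enum. Qed.

Lemma rderiv_mono (b x : R) m :
  rderiv (fun x => (b * x) ^+ m.+1 / m.+1`!%:R) x (b * ((b * x) ^+ m / m`!%:R)).
Proof.
apply/rderivP; have /rderivP D1 := @rderivZ R b x.
have := is_deriveZ (m.+1`!%:R^-1) (is_deriveX m.+1 D1).
have -> : m.+1`!%:R^-1 \*: (( *%R b) ^+ m.+1) = (fun x => (b * x) ^+ m.+1 / m.+1`!%:R).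
  apply/funext => y; rewrite [LHS]mulrC; congr (_ / _).
  by elim: (m.+1) => // k IH; rewrite !exprS -IH.
move=> D; apply: is_derive_eq D _ => /=.
rewrite -[_ *: (_ *: b)]/(_ * (_ * b)) factS natrM.
have : m.+1%:R != 0 :> R by rewrite pnatr_eq0.
have : m`!%:R != 0 :> R by rewrite pnatr_eq0 -lt0n fact_gt0.
by move: (m`!%:R : R) (m.+1%:R : R) => A B A0 B0; field; rewrite A0 B0.
Qed.

Lemma rderivD (f g : R -> R) x df dg : rderiv f x df -> rderiv g x dg ->
  rderiv (fun x => f x + g x) x (df + dg).
Proof. by move=> /rderivP F /rderivP G; apply/rderivP; exact: is_deriveD. Qed.

Lemma rderivM_cst (c : R) (f : R -> R) x df : rderiv f x df ->
  rderiv (fun x => f x * c) x (df * c).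
Proof.
move=> /rderivP F; apply/rderivP; have := is_deriveZ c F.
rewrite -[c *: df]/(c * df) [c * df]mulrC (_ : c \*: f = (fun x => f x * c))//.
by apply/funext => y; rewrite -[LHS]/(c * f y) mulrC.
Qed.

Lemma rderiv_sum (I : Type) (r : seq I) (F dF : I -> R -> R) x :
  (forall j, rderiv (F j) x (dF j x)) ->
  rderiv (fun x => \sum_(j <- r) F j x) x (\sum_(j <- r) dF j x).
Proof.
move=> H; elim: r => [|j r IH].
  rewrite big_nil (_ : (fun x => _) = fun=> 0); first exact: rderiv_cst.
  by apply/funext => y; rewrite big_nil.
rewrite big_cons (_ : (fun x => _) = (fun x => F j x + \sum_(k <- r) F k x)); first exact: rderivD.
by apply/funext => y; rewrite big_cons.
Qed.

(** A majorant in place of Taylor's formula: the induction hypothesis bounds the first derivatives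
    along the segment, and integrating that bound raises each monomial by one degree. Integrating
    real and imaginary parts separately turns [rho] into [2 * rho]. *)
Lemma taylor_bound D f a h (rho K : R) (t : R) : entire f -> 0 <= rho ->
  (forall i, normc (co h i) <= rho) ->
  (forall s, size s = D -> forall t : R, 0 <= t <= 1 ->
     normc (pdw s f (addpt a (scalept t%:C h))) <= K) ->
  0 <= t <= 1 ->
  normc (f (addpt a (scalept t%:C h))) <=
    \sum_(m < D) (2 * rho * t) ^+ m / m`!%:R * jet m f a + (2 * rho * t) ^+ D / D`!%:R * n%:R ^+ D * K.
Proof.
move=> + rho0 hrho; elim: D f t => [|D IH] f t ef HK t01.
  rewrite big_ord0 add0r fact0 divr1 !expr0 !mul1r.
  exact: (HK [::] erefl).
have IHi i (x : R) : 0 <= x <= 1 -> normc (pd i f (addpt a (scalept x%:C h))) <=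
   \sum_(m < D) (2 * rho * x) ^+ m / m`!%:R * jet m (pd i f) a + (2 * rho * x) ^+ D / D`!%:R * n%:R ^+ D * K.
  move=> x01; apply: IH => //; first exact: pd_entire.
  by move=> s sD y y01; apply: (HK (i :: s)) => //=; rewrite sD.
pose G (x : R) := \sum_(m < D) (2 * rho * x) ^+ m.+1 / m.+1`!%:R * jet m.+1 f a +
   (2 * rho * x) ^+ D.+1 / D.+1`!%:R * (n%:R ^+ D.+1 * K).
pose dG (x : R) := \sum_(m < D) (2 * rho * ((2 * rho * x) ^+ m / m`!%:R)) * jet m.+1 f a +
   (2 * rho * ((2 * rho * x) ^+ D / D`!%:R)) * (n%:R ^+ D.+1 * K).
have DG x : rderiv G x (dG x).
  apply: rderivD; last by apply: rderivM_cst; exact: rderiv_mono.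
  apply: (@rderiv_sum _ _ (fun (m : 'I_D) x => (2 * rho * x) ^+ m.+1 / m.+1`!%:R * jet m.+1 f a)
     (fun (m : 'I_D) x => (2 * rho * ((2 * rho * x) ^+ m / m`!%:R)) * jet m.+1 f a)) => m.
  by apply: rderivM_cst; exact: rderiv_mono.
pose phi (x : R) := f (addpt a (scalept x%:C h)).
pose dphi (x : R) := \sum_(i < n) pd i f (addpt a (scalept x%:C h)) * co h i.
have Dphi x : crderiv phi x (dphi x).
  have := @crderiv_line R (fun t => f (addpt a (scalept t h))) 0 1 x _ (pd_line a h (0 + 1 * x%:C) ef).
  rewrite mulr1 add0r mul1r /dphi => H.
  rewrite (_ : phi = (fun y : R => f (addpt a (scalept (0 + 1 * y%:C) h))))//.
  by apply/funext => y; rewrite add0r mul1r.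
(* Half of [dG] suffices for the derivative; so the real and the imaginary part each grow by at most
   [G t / 2], and together by [G t]. *)
have bd x : 0 <= x <= 1 -> normc (dphi x) <= dG x / 2.
  move=> x01; apply: le_trans (normc_sum _ _ _) _.
  apply: (@le_trans _ _ (\sum_(i < n) rho * (\sum_(m < D) (2 * rho * x) ^+ m / m`!%:R * jet m (pd i f) a
     + (2 * rho * x) ^+ D / D`!%:R * n%:R ^+ D * K))).
    apply: ler_sum => i _; rewrite normcM mulrC ler_pM ?normc_ge0//; exact: IHi.
  rewrite -mulr_sumr big_split /= sumr_const card_ord exchange_big /= -[_ *+ n]mulr_natr.
  rewrite le_eqVlt; apply/orP; left; apply/eqP.
  rewrite /dG [RHS]mulrDl mulrDr [X in _ = X + _]mulr_suml mulr_sumr; congr (_ + _).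
    apply: eq_bigr => m _; rewrite jetS -mulr_sumr; field.
    by rewrite pnatr_eq0 -lt0n fact_gt0.
  rewrite exprSr; field.
  by rewrite pnatr_eq0 -lt0n fact_gt0.
have /andP[t0 t1] := t01.
have G0 : G 0 = 0.
  rewrite /G mulr0 expr0n /= !mul0r addr0 big1// => m _.
  by rewrite expr0n /= !mul0r.
have phi0 : phi 0 = f a by rewrite /phi scale0pt addpt0.
have inc : normc (phi t - phi 0) <= G t.
  have side (F dF : R -> R) : (forall x, rderiv F x (dF x)) -> (forall x, 0 <= x <= 1 -> `|dF x| <= dG x / 2) ->
      `|F t - F 0| <= G t / 2.
    move=> HF HdF.
    have inc1 (F' dF' : R -> R) : (forall x, rderiv F' x (dF' x)) -> (forall x, 0 <= x <= 1 -> dF' x <= dG x / 2) ->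
        F' t - F' 0 <= G t / 2.
      move=> HF' HdF'; have := @rderiv_homo R F' (fun x => G x / 2) dF' (fun x => dG x / 2) 0 t t0.
      rewrite G0 mul0r subr0; apply=> x /andP[x0 xt].
      split=> //; split; first exact: rderivM_cst.
      by apply: HdF'; rewrite x0 (le_trans xt).
    rewrite ler_norml lerNl; apply/andP; split.
      have := inc1 (fun x => F x * -1) (fun x => dF x * -1) (fun x => rderivM_cst _ (HF x)).
      rewrite !mulrN1 -opprD; apply=> x /HdF; rewrite mulrN1; apply: le_trans.
      by rewrite -normrN ler_norm.
    by apply: (inc1 F dF) => // x /HdF; apply: le_trans; rewrite ler_norm.
  rewrite (le_trans (normc_le_ReIm _))// ReB ImB [G t]splitr lerD//.
    apply: (side (fun x => Re (phi x)) (fun x => Re (dphi x))).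
      by move=> x; have /crderivP[] := Dphi x.
    by move=> x /bd; apply: le_trans; exact: Re_le_normc.
  apply: (side (fun x => Im (phi x)) (fun x => Im (dphi x))).
    by move=> x; have /crderivP[] := Dphi x.
  by move=> x /bd; apply: le_trans; exact: Im_le_normc.
rewrite -/(phi t) -[phi t](subrK (phi 0)) (le_trans (normcD _ _))//.
apply: le_trans (lerD inc (lexx _)) _.
rewrite big_ord_recl /= expr0 fact0 divr1 mul1r {1}/jet /= big_seq1 phi0 addrC -addrA lerD2l.
rewrite /G -[X in _ <= _ + X]mulrA; exact: lexx.
Qed.

(** Distributing the radius [r] over [m] Cauchy estimates of radius [r / m] gives [(4 * m / r) ^ m].
    Together with the Taylor factor this is [(8 * rho / r) ^ m] times [m ^ m] over the factorial of
    [m], and [expnn_le_fact] turns 8 into 32. *)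
Lemma jet_word_bound s f a (rho r K : R) : entire f -> 0 < r -> 0 <= rho ->
  (forall w, ptnorm (subpt w a) <= 2 * r -> normc (f w) <= K) ->
  forall x, ptnorm (subpt x a) <= r ->
  (2 * rho) ^+ size s / (size s)`!%:R * normc (pdw s f x) <= (32 * rho / r) ^+ size s * K.
Proof.
move=> ef r0 rho0 H x xr.
have K0 : 0 <= K.
  apply: le_trans (normc_ge0 (f a)) _; apply: H; rewrite subptt ptnorm_zero.
  by rewrite mulr_ge0// ltW.
case: s => [|i s']; first by rewrite !expr0 fact0 divr1 !mul1r; apply: H; rewrite (le_trans xr)// ler_peMl ?ltW// ltr1n.
set s := i :: s'; pose m := size s; have m0 : (0 < m)%N by [].
have mR : 0 < m%:R :> R by rewrite ltr0n.
have d0 : 0 < r / m%:R by rewrite divr_gt0.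
have := @pdw_estimate s f a r (r / m%:R) K ef d0.
rewrite divfK ?gt_eqF// -mulr2n -[r *+ 2]mulr_natl => /(_ H _ xr) B.
apply: (@le_trans _ _ ((2 * rho) ^+ m / m`!%:R * ((4 / (r / m%:R)) ^+ m * K))).
  by apply: ler_wpM2l => //; rewrite divr_ge0 ?exprn_ge0 ?mulr_ge0.
rewrite mulrA; apply: ler_wpM2r => //.
have f0 : 0 < m`!%:R :> R by rewrite ltr0n fact_gt0.
have -> : (2 * rho) ^+ m / m`!%:R * (4 / (r / m%:R)) ^+ m = (8 * rho / r) ^+ m * (m%:R ^+ m / m`!%:R).
  rewrite mulrAC -exprMn [RHS]mulrA -exprMn; congr (_ ^+ _ / _).
  by field; rewrite !gt_eqF.
have -> : 32 * rho / r = (8 * rho / r) * 4 by ring.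
rewrite -/m [X in _ <= X]exprMn; apply: ler_wpM2l.
  by rewrite exprn_ge0// divr_ge0 ?mulr_ge0// ltW.
rewrite ler_pdivrMr// -!natrX -natrM ler_nat; exact: expnn_le_fact.
Qed.

(** The remainder of [taylor_bound] counts [n ^ D] words, each contributing at most
    [(32 * rho / r) ^ D * K]; by the smallness of [rho / r] it is at most [2^-1 ^+ D * K]. So the
    jets at the single point [a] control [f] nearby, and [K] disappears from the bound. *)
Lemma taylor_sup f a h (rho r K : R) : entire f -> 0 < r -> 0 <= rho -> rho <= r ->
  n%:R * (32 * rho / r) <= 2^-1 -> ptnorm h <= rho ->
  (forall w, ptnorm (subpt w a) <= 2 * r -> normc (f w) <= K) ->
  forall e : R, 0 < e -> exists D,
    normc (f (addpt a h)) <= \sum_(m < D) (2 * rho) ^+ m / m`!%:R * jet m f a + e.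
Proof.
move=> ef r0 rho0 rr small hr H e e0.
have K0 : 0 <= K.
  apply: le_trans (normc_ge0 (f a)) _; apply: H; rewrite subptt ptnorm_zero.
  by rewrite mulr_ge0// ltW.
have [D HD] : exists D, 2^-1 ^+ D * K <= e.
  have cv : (fun m => 2^-1 ^+ m * K) @ \oo --> 0 * K.
    apply: cvgM; last exact: cvg_cst.
    by apply: cvg_expr; rewrite ger0_norm ?invr_ge0// invf_lt1// ltr1n.
  rewrite mul0r in cv; have /cvgrPdist_le /(_ _ e0)[D _ HD] := cv.
  exists D; have := HD D (leqnn D); rewrite /= sub0r normrN.
  by apply: le_trans; rewrite ler_norm.
exists D.
pose c := (2 * rho) ^+ D / D`!%:R.
have c0 : 0 <= c by rewrite divr_ge0 ?exprn_ge0 ?mulr_ge0.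
have e1 : 0 <= (1 : R) <= 1 by rewrite ler01 lexx.
have main (K' : R) : (forall s, size s = D -> forall t : R, 0 <= t <= 1 ->
     normc (pdw s f (addpt a (scalept t%:C h))) <= K') ->
   normc (f (addpt a h)) <= \sum_(m < D) (2 * rho) ^+ m / m`!%:R * jet m f a + c * n%:R ^+ D * K'.
  move=> HK'; have := @taylor_bound D f a h rho K' 1 ef rho0 _ HK' e1.
  rewrite (_ : scalept (1 : R)%:C h = h) ?mulr1; last exact: scale1pt.
  apply => i.
  exact: le_trans (co_le_ptnorm _ _) hr.
have wb s : size s = D -> forall t : R, 0 <= t <= 1 ->
     c * normc (pdw s f (addpt a (scalept t%:C h))) <= (32 * rho / r) ^+ D * K.
  move=> sD t /andP[t0 t1]; rewrite /c -sD; apply: (jet_word_bound _ ef r0 rho0 H).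
  rewrite addptK ptnorm_scale normc_real ger0_norm// (le_trans _ rr)// (le_trans _ hr)//.
  by rewrite ler_piMl ?ptnorm_ge0.
have rho_r : 0 <= 32 * rho / r by rewrite divr_ge0 ?mulr_ge0// ltW.
have fin : n%:R ^+ D * ((32 * rho / r) ^+ D * K) <= e.
  rewrite mulrA -exprMn (le_trans _ HD)// ler_wpM2r//.
  apply: lerXn2r; rewrite ?nnegrE; [exact: mulr_ge0|by rewrite invr_ge0|exact: small].
(* If [c = 0] the remainder has weight zero and any finite bound on the derivatives will do; [D.+1]
   keeps the radius of each Cauchy estimate well defined for every [D]. *)
have [c00|cn0] := eqVneq c 0.
  apply: le_trans (main ((4 / (r / D.+1%:R)) ^+ D * K) _) _.
    move=> s sD t /andP[t0 t1].
    have dd : 0 < r / D.+1%:R by rewrite divr_gt0.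
    rewrite -sD; rewrite -sD in dd; apply: (@pdw_estimate s f a r) => //.
      move=> x xr; apply: H; apply: le_trans xr _; rewrite [2 * r]mulr_natl mulr2n lerD2l.
      by rewrite mulrAC ler_pdivrMr// ler_wpM2l ?ler_nat// ltW.
    rewrite addptK ptnorm_scale normc_real ger0_norm// (le_trans _ rr)// (le_trans _ hr)//.
    by rewrite ler_piMl ?ptnorm_ge0.
  by rewrite c00 !mul0r addr0 lerDl ltW.
have cp : 0 < c by rewrite lt_neqAle eq_sym cn0.
apply: le_trans (main (c^-1 * ((32 * rho / r) ^+ D * K)) _) _.
  by move=> s sD t t01; rewrite ler_pdivlMl// wb.
by rewrite lerD2l mulrAC mulrA divff// mul1r mulrC.
Qed.

End Dim.
End Partial.

(** * Slices and tensor products of entire functions *)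

Section Composition.
Variable R : realType.
Local Notation C := R[i].

(** Chain rule for an affine [T], whose increments are exactly linear. It covers the projections of
    the product and the insertions of a slice. *)
Lemma has_diff_comp m n (T : pt R n -> pt R m) (c : 'I_m -> C) (A : 'I_m -> 'I_n -> C)
    (f : pt R m -> C) z a :
  (forall z j, co (T z) j = c j + \sum_(i < n) A j i * co z i) ->
  has_diff f (T z) a -> has_diff (fun z => f (T z)) z (fun i => \sum_(j < m) a j * A j i).
Proof.
move=> HT H e e0.
pose B := \sum_(j < m) \sum_(i < n) normc (A j i) + 1.
have B0 : 0 < B.
  by rewrite ltr_wpDl ?sumr_ge0// => j _; rewrite sumr_ge0// => i _; exact: normc_ge0.
have [d d0 Hd] := H _ (divr_gt0 e0 B0).
exists (d / B) => [|h]; first exact: divr_gt0.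
rewrite ltr_pdivlMr// => hd.
pose k := subpt (T (addpt z h)) (T z).
have kE j : co k j = \sum_(i < n) A j i * co h i.
  rewrite /k co_sub !HT opprD addrACA subrr add0r -sumrB; apply: eq_bigr => i _.
  by rewrite co_add mulrDr addrAC subrr add0r.
have kn : ptnorm k <= B * ptnorm h.
  rewrite /B mulrDl mul1r ptnormE -[X in X <= _]addr0 lerD ?ptnorm_ge0// mulr_suml.
  apply: ler_sum => j _; rewrite kE (le_trans (normc_sum _ _ _))// mulr_suml.
  by apply: ler_sum => i _; rewrite normcM ler_wpM2l ?normc_ge0// co_le_ptnorm.
have := Hd k; rewrite (le_lt_trans kn) => [/(_ isT)|]; last by rewrite mulrC.
rewrite [addpt (T z) k]subptK.
have -> : \sum_(j < m) a j * co k j = \sum_(i < n) (\sum_(j < m) a j * A j i) * co h i.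
  under eq_bigr do rewrite kE mulr_sumr.
  rewrite exchange_big /=; apply: eq_bigr => i _; rewrite mulr_suml.
  by apply: eq_bigr => j _; rewrite mulrA.
move/le_trans; apply; rewrite -mulrA; apply: ler_wpM2l; first exact: ltW.
by rewrite ler_pdivrMl.
Qed.

Lemma entire_comp m n (T : pt R n -> pt R m) (c : 'I_m -> C) (A : 'I_m -> 'I_n -> C)
    (f : pt R m -> C) :
  (forall z j, co (T z) j = c j + \sum_(i < n) A j i * co z i) ->
  entire f -> entire (fun z => f (T z)).
Proof.
move=> HT /entireP H; apply/entireP => z; have [a Ha] := H (T z).
by eexists; exact: has_diff_comp HT Ha.
Qed.

Variables k1 k2 : nat.
Implicit Types (z : pt R k1) (w : pt R k2) (u : pt R (k1 + k2) -> C).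

Definition catpt z w : pt R (k1 + k2) :=
  mkpt (fun i => match fintype.split i with inl j => co z j | inr j => co w j end).

Lemma co_ptl (x : pt R (k1 + k2)) j : co (ptl x) j = co x (lshift k2 j).
Proof. by rewrite /co tnth_mktuple. Qed.

Lemma co_ptr (x : pt R (k1 + k2)) j : co (ptr x) j = co x (rshift k1 j).
Proof. by rewrite /co tnth_mktuple. Qed.

Lemma co_cat_l z w j : co (catpt z w) (lshift k2 j) = co z j.
Proof. by rewrite co_mkpt (unsplitK (inl j)). Qed.

Lemma co_cat_r z w j : co (catpt z w) (rshift k1 j) = co w j.
Proof. by rewrite co_mkpt (unsplitK (inr j)). Qed.

Lemma ptl_cat z w : ptl (catpt z w) = z.
Proof. by apply: pt_ext => j; rewrite co_ptl co_cat_l. Qed.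

Lemma ptr_cat z w : ptr (catpt z w) = w.
Proof. by apply: pt_ext => j; rewrite co_ptr co_cat_r. Qed.

Lemma cat_ptlr (x : pt R (k1 + k2)) : catpt (ptl x) (ptr x) = x.
Proof.
by apply: pt_ext => j; rewrite -(splitK j); case: (fintype.split j) => i /=;
  rewrite ?co_cat_l ?co_cat_r ?co_ptl ?co_ptr.
Qed.

Lemma sum_pick n (i0 : 'I_n) (F : 'I_n -> C) : \sum_(i < n) (i == i0)%:R * F i = F i0.
Proof.
by rewrite (bigD1 i0)//= eqxx mul1r big1 ?addr0// => i /negbTE ->; rewrite mul0r.
Qed.

Lemma entire_ptl (f : pt R k1 -> C) : entire f -> entire (fun x : pt R (k1 + k2) => f (ptl x)).
Proof.
apply: (@entire_comp _ _ _ (fun=> 0) (fun j i => (i == lshift k2 j)%:R)) => x j.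
by rewrite sum_pick add0r co_ptl.
Qed.

Lemma entire_ptr (f : pt R k2 -> C) : entire f -> entire (fun x : pt R (k1 + k2) => f (ptr x)).
Proof.
apply: (@entire_comp _ _ _ (fun=> 0) (fun j i => (i == rshift k1 j)%:R)) => x j.
by rewrite sum_pick add0r co_ptr.
Qed.

Lemma entire_slice_l u w : entire u -> entire (fun z => u (catpt z w)).
Proof.
apply: (@entire_comp _ _ _ (fun i => match fintype.split i with inl j => 0 | inr j => co w j end)
  (fun i j => match fintype.split i with inl j' => (j == j')%:R | inr _ => 0 end)) => z i.
rewrite co_mkpt; case: (fintype.split i) => j; first by rewrite sum_pick add0r.
by rewrite big1 ?addr0// => ? _; rewrite mul0r.
Qed.

Lemma has_diff_slice_r u z w a : has_diff u (catpt z w) a ->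
  has_diff (fun w => u (catpt z w)) w (fun i => a (rshift k1 i)).
Proof.
move=> /(@has_diff_comp _ _ (fun w => catpt z w) (fun i => match fintype.split i with inl j => co z j | inr j => 0 end)
  (fun i j => match fintype.split i with inl _ => 0 | inr j' => (j == j')%:R end)) H.
have {}H := H _; rewrite (_ : (fun i => a (rshift k1 i)) = (fun i : 'I_k2 => \sum_(j < k1 + k2) a j *
   match fintype.split j with inl _ => 0 | inr j' => (i == j')%:R end)).
  apply: H => w' i; rewrite co_mkpt; case: (fintype.split i) => j; last by rewrite sum_pick add0r.
  by rewrite big1 ?addr0// => ? _; rewrite mul0r.
apply/funext => i; rewrite (bigD1 (rshift k1 i))//= (unsplitK (inr i)) eqxx mulr1 big1 ?addr0//.
move=> j; case: fintype.splitP => [j' _ _|j' jE jn]; first by rewrite mulr0.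
case: eqVneq => [ij|]; last by rewrite mulr0.
by move: jn; rewrite ij -val_eqE /= jE eqxx.
Qed.

Lemma entire_slice_r u z : entire u -> entire (fun w => u (catpt z w)).
Proof.
move=> /entireP H; apply/entireP => w; have [a Ha] := H (catpt z w).
by eexists; exact: has_diff_slice_r Ha.
Qed.

Lemma pdw_slice_r (s : seq 'I_k2) u z w : entire u ->
  pdw s (fun w => u (catpt z w)) w = pdw (map (@rshift k1 k2) s) u (catpt z w).
Proof.
elim: s u => //= i s IH u eu.
rewrite (_ : pd i _ = (fun w => pd (rshift k1 i) u (catpt z w))); first by rewrite IH//; exact: pd_entire.
apply/funext => w'; exact: (pdE _ (has_diff_slice_r (gradP _ eu))).
Qed.

Lemma Phi_entire (f : pt R k1 -> C) (g : pt R k2 -> C) : entire f -> entire g -> entire (Phi f g).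
Proof. by move=> ef eg; apply: entireM; [exact: entire_ptl|exact: entire_ptr]. Qed.

End Composition.

(** * Lattice sums and iterated integrals *)

Lemma sum_le_uniq_subset (R : realType) (T : eqType) (s t : seq T) (F : T -> R) :
  (forall x, 0 <= F x) -> uniq s -> {subset s <= t} ->
  \sum_(x <- s) F x <= \sum_(x <- t) F x.
Proof.
move=> F0; elim: s t => [|x s IH] t /=; first by rewrite big_nil sumr_ge0.
move=> /andP[xs us] st; have xt : x \in t by apply: st; rewrite mem_head.
rewrite big_cons (perm_big _ (perm_to_rem xt)) big_cons /= lerD2l; apply: IH => // y ys.
have yt : y \in t by apply: st; rewrite inE ys orbT.
move: yt; rewrite (perm_mem (perm_to_rem xt)) inE => /orP[/eqP yx|//].
by move: xs; rewrite -yx ys.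
Qed.

Section Lattice.
Variables (R : realType) (sg : R).
Hypothesis sg0 : 0 < sg.
Local Notation mu := (@lebesgue_measure R).

Import HBNNSimple.

(** In the application [f] is an inner iterated integral whose measurability is not established, so
    monotonicity is read off the integral as a supremum over simple functions. *)
Lemma nnsfun_le_integral (h : {nnsfun measurableTypeR R >-> R}) (f : R -> \bar R) :
  (forall x, (h x)%:E <= f x)%E -> (\int[mu]_x (h x)%:E <= \int[mu]_x f x)%E.
Proof.
move=> hf; have h0 x : (0 <= (h x)%:E)%E by rewrite lee_fin; exact: fun_ge0.
have f0 x : (0 <= f x)%E by exact: le_trans (hf x).
rewrite [leRHS]ge0_integralTE// integral_nnsfun// patch_setT.
by apply: ereal_sup_ubound; exists h.
Qed.

Definition seg (p : int) : set R := [set` `[sg * p%:~R, sg * (p + 1)%:~R[].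

Lemma seg_unique p q x : seg p x -> seg q x -> p = q.
Proof.
rewrite /seg /= !in_itv/= => /andP[p1 p2] /andP[q1 q2].
have := le_lt_trans p1 q2; have := le_lt_trans q1 p2.
rewrite !ltr_pM2l// !ltr_int => h1 h2; lia.
Qed.

Lemma integral_lower_sum (g : R -> \bar R) (s : seq int) (v : int -> R) : uniq s ->
  (forall x, 0 <= g x)%E -> (forall p, 0 <= v p) ->
  (forall p x, p \in s -> seg p x -> ((v p)%:E <= g x)%E) ->
  ((\sum_(p <- s) v p * sg)%:E <= \int[mu]_x g x)%E.
Proof.
move=> us g0 v0 H.
have mseg p : measurable (seg p : set (measurableTypeR R)) by exact: measurable_itv.
pose t p : {nnsfun measurableTypeR R >-> R} := scale_nnsfun (indic_nnsfun R (mseg p)) (v0 p).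
pose h : {nnsfun measurableTypeR R >-> R} := sum_nnsfun (fun i => t (nth 0 s i)) (size s).
have tE p x : t p x = v p * \1_(seg p) x by [].
have hE x : h x = \sum_(p <- s) v p * \1_(seg p) x.
  by rewrite /h sum_nnsfunE (big_nth 0) big_mkord; apply: eq_bigr => i _; rewrite tE.
have -> : (\sum_(p <- s) v p * sg)%:E = (\int[mu]_x (h x)%:E)%E.
  under eq_integral do rewrite hE -sumEFin.
  rewrite ge0_integral_sum//=; last first.
  - by move=> p x _; rewrite lee_fin mulr_ge0.
  - by move=> p; apply/measurable_EFinP; apply: measurable_funM.
  rewrite -sumEFin; apply: eq_bigr => p _.
  under eq_integral do rewrite EFinM.
  rewrite ge0_integralZl//; last 2 first.
  - by apply/measurable_EFinP; exact: measurable_indic.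
  - by rewrite lee_fin v0.
  rewrite integral_indic// setIT EFinM; congr (_ * _)%E.
  rewrite [LHS](_ : _ = lebesgue_measure (seg p))// /seg lebesgue_measure_itv /=.
  rewrite lte_fin ltr_pM2l// ltr_int ltzD1 lexx -EFinD -mulrBr.
  by rewrite rmorphD /= addrAC subrr add0r mulr1.
apply: nnsfun_le_integral => x; rewrite hE.
have [[p ps px]|np] := pselect (exists2 p, p \in s & seg p x).
  rewrite (bigD1_seq p)//= big1 ?addr0 => [|q qp].
    by rewrite indicE mem_set// mulr1 H.
  rewrite indicE memNset ?mulr0// => qx; move/eqP: qp; apply; exact: seg_unique qx px.
rewrite big_seq big1// => p ps; rewrite indicE memNset ?mulr0// => px; apply: np; by exists p.
Qed.

Lemma iint_ge0 k (f : pt R k -> \bar R) : (forall x, 0 <= f x)%E -> (0 <= iint f)%E.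
Proof.
elim: k f => [|k IH] f f0; first exact: f0.
by apply: integral_ge0 => x _; apply: integral_ge0 => y _; apply: IH.
Qed.

Definition cell k (p : k.-tuple (int * int)) (x : pt R k) : Prop :=
  forall i, seg (tnth p i).1 (tnth x i).1 /\ seg (tnth p i).2 (tnth x i).2.

(** The product shape lets the sum over cells factor along [iint], one complex coordinate at a
    time. *)
Fixpoint box k (s : seq int) : seq (k.-tuple (int * int)) :=
  match k with
  | 0 => [:: [tuple]]
  | k'.+1 => [seq cons_tuple ab p | ab <- [seq (a, b) | a <- s, b <- s], p <- box k' s]
  end.

Lemma iint_lower_box k (f : pt R k -> \bar R) (l : k.-tuple (int * int) -> R) (s : seq int) :
  uniq s -> (forall x, 0 <= f x)%E -> (forall p, 0 <= l p) ->
  (forall p x, cell p x -> ((l p)%:E <= f x)%E) ->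
  ((\sum_(p <- box k s) l p * sg ^+ (2 * k))%:E <= iint f)%E.
Proof.
move=> us; elim: k f l => [|k IH] f l f0 l0 H.
  rewrite /= big_seq1 mulr1; apply: H; by case.
rewrite /=.
pose v a b := \sum_(p <- box k s) l (cons_tuple (a, b) p) * sg ^+ (2 * k).
have v0 a b : 0 <= v a b.
  by apply: sumr_ge0 => p _; rewrite mulr_ge0// exprn_ge0// ltW.
have -> : \sum_(p <- [seq cons_tuple ab p | ab <- [seq (a, b) | a <- s, b <- s], p <- box k s])
    l p * sg ^+ (2 * k.+1) = \sum_(a <- s) (\sum_(b <- s) v a b * sg) * sg.
  rewrite big_allpairs_dep big_allpairs_dep; apply: eq_bigr => a _.
  rewrite mulr_suml; apply: eq_bigr => b _; rewrite /v !mulr_suml; apply: eq_bigr => p _.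
  by rewrite mulnS addnC exprD expr2 !mulrA.
apply: integral_lower_sum => //.
- by move=> x; apply: integral_ge0 => y _; apply: iint_ge0.
- by move=> a; apply: sumr_ge0 => b _; rewrite mulr_ge0// ltW.
move=> a x _ ax; apply: integral_lower_sum => //.
- by move=> y; apply: iint_ge0.
move=> b y _ yb; rewrite /v; apply: IH => // p t pt; apply: H => i.
case: (unliftP ord0 i) => [j|] ->; last by rewrite !tnth0.
by have [h1 h2] := pt j; split; [move: h1|move: h2]; rewrite !(tnthS).
Qed.

(** Any finite set of cells lies in the box over the integers that occur as coordinates, and the
    additional terms are nonnegative. The volume of a cell is [sg ^+ (2 * k)]. *)
Lemma iint_lower_sum k (f : pt R k -> \bar R) (l : k.-tuple (int * int) -> R)
    (P : seq (k.-tuple (int * int))) : uniq P ->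
  (forall x, 0 <= f x)%E -> (forall p, 0 <= l p) ->
  (forall p x, cell p x -> ((l p)%:E <= f x)%E) ->
  ((\sum_(p <- P) l p * sg ^+ (2 * k))%:E <= iint f)%E.
Proof.
move=> uP f0 l0 H.
pose s := undup (flatten [seq flatten [seq [:: q.1; q.2] | q <- val p] | p <- P]).
have us : uniq s by exact: undup_uniq.
apply: le_trans (iint_lower_box us f0 l0 H).
have mb m (p : m.-tuple (int * int)) : (forall i, (tnth p i).1 \in s /\ (tnth p i).2 \in s) -> p \in box m s.
  elim: m p => [|m IH] p Hp; first by rewrite tuple0 inE.
  rewrite [p]tuple_eta /=; apply/allpairsP; exists (thead p, behead_tuple p); split => //=.
    have [h1 h2] := Hp ord0; apply/allpairsP; exists (thead p); split => //=.
    by rewrite -surjective_pairing.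
  by apply: IH => i; have := Hp (lift ord0 i); rewrite [p in tnth p]tuple_eta tnthS.
rewrite lee_fin; apply: sum_le_uniq_subset => //.
  by move=> p; rewrite mulr_ge0// exprn_ge0// ltW.
move=> p pP; apply: mb => i; have pi := mem_tnth i p.
by split; rewrite mem_undup; apply/flattenP;
  exists (flatten [seq [:: q.1; q.2] | q <- val p]); rewrite ?(map_f (fun p : k.-tuple (int * int) => flatten [seq [:: q.1; q.2] | q <- val p]))//;
  apply/flattenP; exists [:: (tnth p i).1; (tnth p i).2]; rewrite ?(map_f (fun q : int * int => [:: q.1; q.2]))// !inE eqxx ?orbT.
Qed.

Definition latpt k (p : k.-tuple (int * int)) : pt R k :=
  [tuple (sg * (tnth p i).1%:~R, sg * (tnth p i).2%:~R) | i < k].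

Lemma cell_exists k (x : pt R k) : exists p, cell p x.
Proof.
exists [tuple (Num.floor ((tnth x i).1 / sg), Num.floor ((tnth x i).2 / sg)) | i < k] => i.
rewrite tnth_mktuple /= /seg /= !in_itv /= ![sg * _]mulrC.
by rewrite -!ler_pdivlMr// -!ltr_pdivrMr// !floor_le !floorD1_gt.
Qed.

Lemma cell_near k (p : k.-tuple (int * int)) (x : pt R k) : cell p x ->
  ptnorm (subpt x (latpt p)) <= sg * (2 * k)%:R.
Proof.
move=> H; rewrite ptnormE (@le_trans _ _ (\sum_(i < k) (2 * sg)))//; last first.
  by rewrite sumr_const card_ord -[_ *+ k]mulr_natr natrM mulrA [sg * 2]mulrC.
apply: ler_sum => i _; rewrite (le_trans (normc_le_ReIm _))// mulr_natl mulr2n.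
have [] := H i; rewrite /seg /= !in_itv /= !rmorphD /= !mulrDr !mulr1 => /andP[a1 a2] /andP[b1 b2].
by rewrite /subpt /latpt !tnth_mktuple /= lerD// ler_norml; apply/andP; split; lra.
Qed.

End Lattice.

(** * Nuclearity of the weighted spaces *)

(** The inequality [snorm W f <= K] free of extended reals; see [snorm_le_wbound]. *)
Definition wbound (R : realType) k (W : pt R k -> R) (f : pt R k -> R[i]) (K : R) : Prop :=
  forall x, W x * normc (f x) <= K.

Section TaylorFunctional.
Variable R : realType.
Local Notation C := R[i].

(** The data [d] consists of a real factor, a word of differentiations and a base point. With
    functionals kept as data, linearity and holomorphy in a parameter are proved once for all of
    them. *)
Definition taylor_fun k (d : R * seq 'I_k * pt R k) (f : pt R k -> C) : C :=
  d.1.1%:C * pdw d.1.2 f d.2.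

Lemma taylor_funD k d (f g : pt R k -> C) : entire f -> entire g ->
  taylor_fun d (fun x => f x + g x) = taylor_fun d f + taylor_fun d g.
Proof. by move=> ef eg; rewrite /taylor_fun pdwD// mulrDr. Qed.

Lemma taylor_funZ k d c (f : pt R k -> C) : entire f ->
  taylor_fun d (fun x => c * f x) = c * taylor_fun d f.
Proof. by move=> ef; rewrite /taylor_fun pdwZ// mulrCA. Qed.

Lemma taylor_fun_sum k d (I : Type) (s : seq I) (c : I -> C) (F : I -> pt R k -> C) :
  (forall i, entire (F i)) ->
  taylor_fun d (fun x => \sum_(i <- s) c i * F i x) = \sum_(i <- s) c i * taylor_fun d (F i).
Proof.
move=> eF; elim: s => [|i s IH].
  rewrite big_nil (_ : (fun x => _) = (fun x => 0 * 0)).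
    by rewrite taylor_funZ ?mul0r//; exact: entire_cst.
  by apply/funext => x; rewrite big_nil mul0r.
rewrite big_cons (_ : (fun x => _) = (fun x => c i * F i x + \sum_(j <- s) c j * F j x)).
  rewrite taylor_funD ?taylor_funZ ?IH//; first exact: entireZ.
  by apply: entire_sum => j; exact: entireZ.
by apply/funext => x; rewrite big_cons.
Qed.

(** By [pdw_slice_r] the derivatives of a slice are slices of derivatives taken in the product
    space, and these are entire in both variables. *)
Lemma taylor_fun_slice k1 k2 d (u : pt R (k1 + k2) -> C) : entire u ->
  entire (fun z => taylor_fun d (fun w => u (catpt z w))).
Proof.
move=> eu; apply: entireZ; under eq_fun do rewrite pdw_slice_r//.
by apply: entire_slice_l; exact: pdw_entire.
Qed.

End TaylorFunctional.

Section Nuclear.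
Variables (R : realType) (k : nat) (J : Type) (N : J -> pt R k -> R).
Hypothesis dfN : defining_family N.
Hypothesis HI : forall w : J, exists (w' : J) (L : pt R k -> R),
     (forall x, 0 <= L x) /\
     (exists K : R, forall x, L x <= K) /\
     measurable_fun [set: pt R k] L /\
     (iint (fun x => (L x)%:E) < +oo)%E /\
     (forall x, N w x <= L x * N w' x) /\
     (forall e : R, 0 < e -> exists r : R, forall x, r < ptnorm x -> L x < e).
Hypothesis HII : forall w : J, exists (w' : J) (B : set (pt R k)) (c : R),
     (exists r : R, 0 < r /\ forall x, ptnorm x < r -> B x) /\ 0 < c /\
     forall x x', B x' -> N w x <= c * N w' (addpt x x').

Lemma shift_bound w : exists w' (r c : R), [/\ 0 < r, 0 < c &
  forall x y, ptnorm (subpt y x) < r -> N w x <= c * N w' y].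
Proof.
have [w' [B [c [[r [r0 Hr]] [c0 H]]]]] := HII w; exists w', r, c; split=> // x y xy.
by rewrite -(subptK x y); apply/H/Hr.
Qed.

(* On a cell of a fine lattice, N w times f at nearby points is controlled by the
   infimum of L over the cell, and these infima are summable. *)
Lemma cell_weights w : exists w' (r sg A : R) (l s : k.-tuple (int * int) -> R),
  [/\ 0 < r, 0 < sg, sg * (2 * k)%:R <= r & k%:R * (32 * (sg * (2 * k)%:R) / r) <= 2^-1] /\
  [/\ forall p, 0 <= l p, forall p, 0 <= s p,
     forall P, uniq P -> \sum_(p <- P) l p <= A,
     forall p x, cell sg p x -> N w x <= s p &
     forall p f K x, wbound (N w') f K -> ptnorm (subpt x (latpt sg p)) <= 2 * r ->
        s p * normc (f x) <= l p * K].
Proof.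
have [w1 [r1 [c1 [r10 c10 H1]]]] := shift_bound w.
have [w2 [L [L0 [_ [_ [Lint [HL _]]]]]]] := HI w1.
have [w3 [r2 [c2 [r20 c20 H2]]]] := shift_bound w2.
(* A point within [2 * r] of the lattice point is within [3 * r < r2] of the whole cell. The first
   bound in [t] makes two points of a cell closer than [r1]; the 64 in the second yields
   [k%:R * (32 * rho / r) <= 2^-1], as [taylor_sup] demands. The 1 added in [sg] covers dimension
   0. *)
pose r := r2 / 4; have r0 : 0 < r by rewrite divr_gt0.
pose t := Num.min (r1 / 4) (r / (64 * k.+1%:R)).
have k0 : 0 < 64 * k.+1%:R :> R by rewrite mulr_gt0// ltr0n.
have t0 : 0 < t by rewrite lt_min !divr_gt0.
have kk : 0 < (2 * k)%:R + 1 :> R by rewrite ltr_wpDl.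
pose sg := t / ((2 * k)%:R + 1); have sg0 : 0 < sg by rewrite divr_gt0.
pose rho := sg * (2 * k)%:R.
have rho0 : 0 <= rho by rewrite mulr_ge0// ltW.
have rhot : rho <= t by rewrite /rho /sg mulrAC ler_pdivrMr// ler_wpM2l ?(ltW t0)// lerDl.
have rho1 : rho <= r1 / 4 by rewrite (le_trans rhot)// ge_min lexx.
have rho2 : rho * (64 * k.+1%:R) <= r by rewrite -ler_pdivlMr// (le_trans rhot)// ge_min lexx orbT.
have rhor : rho <= r.
  rewrite (le_trans _ rho2)// ler_peMr// -natrM ler1n muln_gt0//.
have cell_ne p : cell sg p (latpt sg p).
  move=> i; rewrite !tnth_mktuple /= /seg /= !in_itv/= !lexx /= !ltr_pM2l// !ltr_int !ltzD1 !lexx//.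
pose l p := c1 * c2 * inf [set L y | y in cell sg p].
have Lhas p : has_inf [set L y | y in cell sg p].
  by split; [exists (L (latpt sg p)), (latpt sg p)|exists 0 => _ [y _ <-]].
have inf0 p : 0 <= inf [set L y | y in cell sg p].
  by apply: lb_le_inf; [exact: (Lhas p).1|move=> _ [y _ <-]].
pose s p := sup [set N w x | x in cell sg p].
have Nhas p : has_sup [set N w x | x in cell sg p].
  split; first by exists (N w (latpt sg p)), (latpt sg p).
  have [K HK] := df_bdd dfN w (rho + ptnorm (latpt sg p)).
  exists K => _ [y py <-]; apply: HK.
  rewrite -[y](subptK (latpt sg p)) (le_trans (ptnormD _ _))// addrC lerD2r.
  exact: cell_near.
have s0 p : 0 <= s p.
  apply: le_trans (df_nonneg dfN w (latpt sg p)) _.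
  by apply: ub_le_sup; [exact: (Nhas p).2|exists (latpt sg p)].
have sg2 : 0 < sg ^+ (2 * k) by rewrite exprn_gt0.
exists w3, r, sg, (c1 * c2 * (fine (iint (fun x => (L x)%:E)) / sg ^+ (2 * k))), l, s.
split; split => //.
- rewrite -/rho mulrA ler_pdivrMr// ler_pdivlMl//.
  have -> : 2 * (k%:R * (32 * rho)) = rho * (64 * k%:R) by ring.
  apply: le_trans rho2; apply: ler_wpM2l => //.
  by apply: ler_wpM2l; [exact: ler0n|rewrite ler_nat leqnSn].
- by move=> p; rewrite !mulr_ge0 ?(ltW c10) ?(ltW c20).
- move=> P uP; rewrite -mulr_sumr; apply: ler_wpM2l; first by rewrite mulr_ge0// ltW.
  rewrite ler_pdivlMr// mulr_suml -lee_fin fineK; last first.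
    rewrite ge0_fin_numE//; apply: iint_ge0 => x; by rewrite lee_fin.
  apply: iint_lower_sum => // p x px.
  by rewrite lee_fin; apply: ge_inf; [exact: (Lhas p).2|exists x].
- by move=> p x px; apply: ub_le_sup; [exact: (Nhas p).2|exists x].
move=> p f K x fK xr.
have K0 : 0 <= K by apply: le_trans (fK x); rewrite mulr_ge0 ?normc_ge0 ?(df_nonneg dfN).
(* Condition (II) leads from [y] to [z], (I) is applied at [z], and (II) leads from [z] to [x]. As
   [y] and [z] are independent points of the cell, the supremum over [y] and the infimum over [z]
   may both be taken. *)
have main y z : cell sg p y -> cell sg p z -> N w y * normc (f x) <= c1 * c2 * L z * K.
  move=> py pz; have yz : ptnorm (subpt z y) < r1.
    rewrite (le_lt_trans (ptnorm_sub_trans _ (latpt sg p) _))// [X in _ + X]ptnorm_subC.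
    rewrite (@le_lt_trans _ _ (r1 / 4 + r1 / 4))//; last by lra.
    have near1 y' : cell sg p y' -> ptnorm (subpt y' (latpt sg p)) <= r1 / 4.
      by move=> /cell_near/le_trans; exact.
    by rewrite lerD ?near1.
  have xz : ptnorm (subpt x z) < r2.
    rewrite (le_lt_trans (ptnorm_sub_trans _ (latpt sg p) _))// [X in _ + X]ptnorm_subC.
    rewrite (@le_lt_trans _ _ (2 * r + r))//; last by rewrite /r; lra.
    by rewrite lerD// (le_trans (cell_near pz)).
  have h1 := H1 _ _ yz; have h2 := H2 _ _ xz; have h3 := HL z.
  apply: (@le_trans _ _ (c1 * (L z * (c2 * N w3 x)) * normc (f x))).
    apply: ler_wpM2r; first exact: normc_ge0.
    apply: le_trans h1 _; apply: ler_wpM2l; first exact: ltW.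
    by apply: le_trans h3 _; apply: ler_wpM2l.
  have -> : c1 * (L z * (c2 * N w3 x)) * normc (f x) = c1 * c2 * L z * (N w3 x * normc (f x)) by ring.
  by apply: ler_wpM2l => //; rewrite !mulr_ge0 ?(ltW c10) ?(ltW c20).
have [fx0|fx0] := eqVneq (normc (f x)) 0.
  by rewrite fx0 mulr0 !mulr_ge0 ?(ltW c10) ?(ltW c20).
have fxp : 0 < normc (f x) by rewrite lt_neqAle eq_sym fx0 normc_ge0.
rewrite -ler_pdivlMr//; apply: ge_sup; first exact: (Nhas p).1.
move=> _ [y py <-]; rewrite ler_pdivlMr// /l.
have [K00|Kn0] := eqVneq K 0.
  by have := main _ _ py py; rewrite K00 !mulr0.
have Kp : 0 < K by rewrite lt_neqAle eq_sym Kn0.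
rewrite -ler_pdivrMr// -ler_pdivrMl ?mulr_gt0//; apply: lb_le_inf; first exact: (Lhas p).1.
by move=> _ [z pz <-]; rewrite ler_pdivrMl ?mulr_gt0// ler_pdivrMr// main.
Qed.

Fixpoint short_words D : seq (seq 'I_k) :=
  if D is D'.+1 then short_words D' ++ words k D' else [::].

Lemma size_short_words D s : s \in short_words D -> (size s < D)%N.
Proof.
elim: D => // D IH; rewrite mem_cat => /orP[/IH /ltnW//|/size_words ->]; exact: leqnn.
Qed.

Lemma mem_short_words D s : (size s < D)%N -> s \in short_words D.
Proof.
elim: D s => // D IH s; rewrite ltnS leq_eqVlt mem_cat => /orP[/eqP <-|/IH ->//].
apply/orP; right; elim: s {IH} => [|i s IHs] /=; first by rewrite mem_head.
by apply/allpairsP; exists (i, s); split=> //=; rewrite mem_enum.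
Qed.

Lemma short_words_uniq D : uniq (short_words D).
Proof.
elim: D => //= D IH; rewrite cat_uniq IH words_uniq andbT; apply/hasPn => s /size_words sD.
by apply/negP => /size_short_words; rewrite sD ltnn.
Qed.

Lemma sum_short_words D (F : seq 'I_k -> R) :
  \sum_(s <- short_words D) F s = \sum_(m < D) \sum_(s <- words k m) F s.
Proof.
elim: D => [|D IH]; first by rewrite big_nil big_ord0.
by rewrite big_cat big_ord_recr /= IH.
Qed.

(** There are [k ^ m] words of length [m], so they contribute [(k * q) ^ m] in all. *)
Lemma sum_geometric (q : R) D : 0 <= q -> k%:R * q <= 2^-1 ->
  \sum_(s <- short_words D) q ^+ size s <= 2.
Proof.
move=> q0 kq; rewrite sum_short_words.
apply: (@le_trans _ _ (\sum_(m < D) 2^-1 ^+ m)).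
  apply: ler_sum => m _.
  rewrite big_seq (eq_bigr (fun=> q ^+ m)) => [|s /size_words -> //].
  rewrite -big_seq big_const_seq count_predT size_wordsE iter_addr_0 -[_ *+ _]mulr_natl natrX -exprMn.
  by apply: lerXn2r; rewrite ?nnegrE ?invr_ge0 ?mulr_ge0.
elim: D => [|D IH]; first by rewrite big_ord0.
have -> : \sum_(m < D.+1) (2^-1 : R) ^+ m = 1 + 2^-1 * \sum_(m < D) 2^-1 ^+ m.
  rewrite big_ord_recl expr0 mulr_sumr; congr (_ + _).
  by apply: eq_bigr => m _; rewrite -exprS.
lra.
Qed.

(** The functionals run over pairs of a cell and a word: the derivative at the lattice point, times
    its Taylor factor, times the supremum of [N w] over the cell. Their bounds are products of [l p]
    and a power of [q], so the double sum is at most twice the lattice sum [A]. *)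
Lemma nuclear_functionals w : exists w' (d : nat -> R * seq 'I_k * pt R k) (b : nat -> R) (B : R),
  [/\ forall n, 0 < b n, forall m, \sum_(n < m) b n <= B,
     forall n f K, entire f -> wbound (N w') f K -> normc (taylor_fun (d n) f) <= b n * K &
     forall f K, inH N f -> (forall m, \sum_(n < m) normc (taylor_fun (d n) f) <= K) -> wbound (N w) f K].
Proof.
have [w' [r [sg [A [l [s [[r0 sg0 rhor small] [l0 s0 lA Nw key]]]]]]]] := cell_weights w.
pose rho := sg * (2 * k)%:R; pose q := 32 * rho / r.
have rho0 : 0 <= rho by rewrite mulr_ge0// ltW.
have q0 : 0 <= q by rewrite divr_ge0 ?mulr_ge0// ltW.
pose T := (k.-tuple (int * int) * seq 'I_k)%type.
pose D (t : T) := (s t.1 * ((2 * rho) ^+ size t.2 / (size t.2)`!%:R), t.2, latpt sg t.1).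
(* Pairs are enumerated by their codes; an index that codes no pair receives the zero functional. *)
pose d n := if pickle_inv n is Some t then D t else (0, [::], zeropt R k).
pose F (t : T) := q ^+ size t.2 * l t.1.
have F0 t : 0 <= F t by rewrite mulr_ge0// exprn_ge0.
(* The geometric term makes every [b n] positive, as the later divisions by [Num.sqrt (b n)]
   require, and adds at most 1 to the sum. *)
pose b n := oapp F 0 (pickle_inv n) + 2^-1 ^+ n.+1.
have coef0 m : 0 <= (2 * rho) ^+ m / m`!%:R.
  by apply: divr_ge0; [apply: exprn_ge0; exact: mulr_ge0|exact: ler0n].
exists w', d, b, (A * 2 + 1); split.
- move=> n; rewrite /b ltr_wpDl ?exprn_gt0 ?invr_gt0//.
  by case: pickle_inv => [t|] /=.
- move=> m; rewrite big_split /=; apply: lerD; last first.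
    suff -> : \sum_(n < m) (2^-1 : R) ^+ n.+1 = 1 - 2^-1 ^+ m by rewrite lerBlDr lerDl exprn_ge0// invr_ge0.
    elim: m => [|m IH]; first by rewrite big_ord0 expr0 subrr.
    by rewrite big_ord_recr /= IH !exprSr; field.
  have -> : \sum_(n < m) oapp F 0 (pickle_inv n : option T) = \sum_(t <- pmap (pickle_inv : nat -> option T) (iota 0 m)) F t.
    rewrite -(big_mkord xpredT (fun n => oapp F 0 (pickle_inv n : option T))) /index_iota subn0.
    elim: (iota 0 m) => [|n S IH]; first by rewrite !big_nil.
    by rewrite big_cons IH /=; case: (pickle_inv n) => [t|] /=; rewrite ?big_cons ?add0r.
  set S := pmap _ _.
  have uS : uniq S by apply: (pmap_uniq (@pickle_invK _)); exact: iota_uniq.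
  (* Finitely many pairs lie in a product of a finite set of cells and the words of bounded length,
     over which the sum factors. *)
  pose P := undup [seq t.1 | t <- S]; pose M := \max_(t <- S) size t.2.
  apply: le_trans (@sum_le_uniq_subset R _ S [seq (p, v) | p <- P, v <- short_words M.+1] F F0 uS _) _.
    move=> [p v] tS; apply/allpairsP; exists (p, v); split; last by [].
      by rewrite mem_undup; apply/mapP; exists (p, v).
    apply: (@mem_short_words M.+1 v); rewrite ltnS /M.
    by rewrite (big_rem _ tS) /= leq_maxl.
  rewrite big_allpairs_dep /F /=.
  under eq_bigr do rewrite -mulr_suml mulrC.
  rewrite -mulr_suml; apply: ler_pM.
  + by apply: sumr_ge0.
  + by apply: sumr_ge0 => v _; rewrite exprn_ge0.
  + by apply: lA; exact: undup_uniq.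
  + exact: (@sum_geometric q M.+1 q0 small).
- move=> n f K ef fK.
  have K0 : 0 <= K by apply: le_trans (fK (zeropt R k)); rewrite mulr_ge0 ?normc_ge0 ?(df_nonneg dfN).
  apply: (@le_trans _ _ (oapp F 0 (pickle_inv n : option T) * K)); last first.
    by apply: ler_wpM2r => //; rewrite lerDl exprn_ge0// invr_ge0.
  rewrite /taylor_fun /d; case: pickle_inv => [[p v]|] /=; last by rewrite !mul0r normc0.
  rewrite normcM normc_real ger0_norm; last exact: mulr_ge0 (s0 p) (coef0 _).
  rewrite /F /=.
  have [sp0|spn0] := eqVneq (s p) 0; first by rewrite sp0 !mul0r !mulr_ge0// exprn_ge0.
  have sp : 0 < s p by rewrite lt_neqAle eq_sym spn0 s0.
  rewrite -[X in X <= _]mulrA -[X in _ <= X]mulrA -ler_pdivlMl//.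
  have bd x : ptnorm (subpt x (latpt sg p)) <= 2 * r -> normc (f x) <= (s p)^-1 * (l p * K).
    by move=> xr; rewrite ler_pdivlMl// key.
  have := jet_word_bound v ef r0 rho0 bd (x := latpt sg p).
  rewrite subptt ptnorm_zero (ltW r0) => /(_ isT) JB.
  apply: le_trans JB _.
  by rewrite mulrCA.
- move=> f K [ef fH] HK x.
  have K0 : 0 <= K by have := HK 0%N; rewrite big_ord0.
  have [p px] := cell_exists sg0 x.
  have [Nx0|Nxn0] := eqVneq (N w x) 0; first by rewrite Nx0 mul0r.
  have Nx : 0 < N w x by rewrite lt_neqAle eq_sym Nxn0 (df_nonneg dfN).
  have sp : 0 < s p by rewrite (lt_le_trans Nx)// Nw.
  apply: (@le_trans _ _ (s p * normc (f x))); first by rewrite ler_wpM2r ?normc_ge0// Nw.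
  (* The size of [K'] is irrelevant: it only makes the Taylor remainder tend to 0 and does not enter
     the final bound [K]. This is where membership in the space, and not mere holomorphy, is
     used. *)
  have [K' fK'] : exists K', wbound (N w') f K'.
    have := fH w'; rewrite /snorm => sup_lt.
    exists (fine (ereal_sup [set ((N w' z * normc (f z))%:E) | z in [set: pt R k]])) => z.
    have zle : ((N w' z * normc (f z))%:E <= ereal_sup [set ((N w' z * normc (f z))%:E) | z in [set: pt R k]])%E.
      by apply: ereal_sup_ubound; exists z.
    rewrite -lee_fin fineK// fin_numElt sup_lt andbT (lt_le_trans _ zle)// ltNyr//.
  have bd y : ptnorm (subpt y (latpt sg p)) <= 2 * r -> normc (f y) <= (s p)^-1 * (l p * K').
    by move=> yr; rewrite ler_pdivlMl// key.
  rewrite mulrC -ler_pdivlMr//; apply/ler_addgt0Pr => e e0.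
  have := taylor_sup ef r0 rho0 rhor small (h := subpt x (latpt sg p)) (cell_near px) bd e0.
  rewrite subptK => -[m /le_trans]; apply; rewrite lerD2r ler_pdivlMr//.
  have -> : (\sum_(j < m) (2 * rho) ^+ j / j`!%:R * jet j f (latpt sg p)) * s p =
     \sum_(n <- [seq pickle (p, v) | v <- short_words m]) normc (taylor_fun (d n) f).
    rewrite big_map sum_short_words mulr_suml; apply: eq_bigr => j _.
    rewrite /jet mulr_sumr mulr_suml big_seq [RHS]big_seq; apply: eq_bigr => v /size_words vj.
    rewrite /d pickleK_inv /taylor_fun /D /= normcM normc_real vj ger0_norm; last by rewrite mulr_ge0.
    by rewrite [LHS]mulrC [LHS]mulrA.
  pose M := \max_(n <- [seq pickle (p, v) | v <- short_words m]) n.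
  apply: le_trans (HK M.+1).
  rewrite -(big_mkord xpredT (fun n => normc (taylor_fun (d n) f))).
  apply: sum_le_uniq_subset => [n||n nS]; first exact: normc_ge0.
    rewrite map_inj_uniq ?short_words_uniq// => v v' /(pcan_inj (@pickleK _)) [].
    by [].
  by rewrite mem_index_iota /= ltnS /M (big_rem _ nS) /= leq_maxl.
Qed.

End Nuclear.

(** * Least squares and finite nets *)

Section PseudoInverse.
Variable C : numClosedFieldType.

Definition ctr m n (A : 'M[C]_(m, n)) : 'M[C]_(n, m) := (map_mx Num.conj A)^T.

Lemma ctrM m n p (A : 'M[C]_(m, n)) (B : 'M[C]_(n, p)) : ctr (A *m B) = ctr B *m ctr A.
Proof. by rewrite /ctr map_mxM trmx_mul. Qed.

Lemma ctrK m n (A : 'M[C]_(m, n)) : ctr (ctr A) = A.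
Proof. by apply/matrixP => i j; rewrite !mxE conjCK. Qed.

Lemma ctrD m n (A B : 'M[C]_(m, n)) : ctr (A + B) = ctr A + ctr B.
Proof. by apply/matrixP => i j; rewrite !mxE rmorphD. Qed.

Definition sqn n (v : 'cV[C]_n) : C := \sum_i `|v i 0| ^+ 2.

Lemma sqnE n (v : 'cV[C]_n) : (ctr v *m v) 0 0 = sqn v.
Proof.
by rewrite mxE; apply: eq_bigr => i _; rewrite !mxE normCK mulrC.
Qed.

Lemma sqn_ge0 n (v : 'cV[C]_n) : 0 <= sqn v.
Proof. by apply: sumr_ge0 => i _; rewrite exprn_ge0. Qed.

Lemma sqn_eq0 n (v : 'cV[C]_n) : sqn v = 0 -> v = 0.
Proof.
move=> /eqP; rewrite psumr_eq0 => [/allP H|i _]; last by rewrite exprn_ge0.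
apply/matrixP => i j; rewrite ord1 mxE; apply/eqP.
have := H i; rewrite mem_index_enum => /(_ isT).
by rewrite expf_eq0 /= normr_eq0.
Qed.

(* [G] is the Moore-Penrose inverse [(A^* A)^-1 A^*]: [A G] is an orthogonal
   projection, which yields both the least squares and the norm estimate. *)
Lemma pseudo_inverse_mx P m (A : 'M[C]_(P, m)) :
  (forall c : 'cV_m, A *m c = 0 -> c = 0) ->
  exists G : 'M[C]_(m, P), [/\ G *m A = 1%:M,
    forall (b : 'cV[C]_P) (e : 'cV[C]_m), sqn (b - A *m (G *m b)) <= sqn (b - A *m e) &
    forall (a : 'rV_m) (K : C), 0 <= K -> (forall c, `|(a *m c) 0 0| ^+ 2 <= K * sqn (A *m c)) ->
      sqn (ctr (a *m G)) <= K].
Proof.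
move=> inj; pose H := ctr A *m A.
have HH : ctr H = H by rewrite /H ctrM ctrK.
have uH : H \in unitmx.
  rewrite -row_free_unit; apply: inj_row_free => v vH.
  have {}vH : H *m ctr v = 0 by rewrite -HH -ctrM vH /ctr map_mx0 trmx0.
  have : A *m ctr v = 0.
    by apply: sqn_eq0; rewrite -sqnE ctrM -mulmxA [ctr A *m _]mulmxA -/H vH mulmx0 mxE.
  by move=> /inj v0; rewrite -[v]ctrK v0 /ctr map_mx0 trmx0.
pose Hi := invmx H.
have HiH : ctr Hi = Hi.
  have E : ctr Hi *m H = 1%:M by rewrite -[X in _ *m X]HH -ctrM mulmxV// /ctr map_mx1 trmx1.
  by rewrite -[LHS]mulmx1 -(mulmxV uH) mulmxA E mul1mx.
exists (Hi *m ctr A); split.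
- by rewrite -mulmxA mulVmx.
- move=> b e; set r := b - _; pose d := Hi *m ctr A *m b - e.
  have -> : b - A *m e = r + A *m d by rewrite /r /d mulmxBr addrA subrK.
  (* The residual is orthogonal to the range of [A]; Pythagoras gives the rest. *)
  have Ar : ctr A *m r = 0.
    by rewrite /r mulmxBr !mulmxA -/H mulmxV// mul1mx subrr.
  have rA : ctr r *m A = 0 by rewrite -[A]ctrK -ctrM Ar /ctr map_mx0 trmx0.
  have -> : sqn (r + A *m d) = sqn r + sqn (A *m d).
    rewrite -!sqnE ctrD.
    have z1 : ctr r *m (A *m d) = 0 by rewrite mulmxA rA mul0mx.
    have z2 : ctr (A *m d) *m r = 0 by rewrite ctrM -mulmxA Ar mulmx0.
    by clearbody r d; rewrite mulmxDl !mulmxDr z1 z2 addr0 add0r mxE.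
  by rewrite lerDl sqn_ge0.
- move=> a K K0 aK.
  (* At this [c] both [a *m c] and [sqn (A *m c)] equal [t], so the hypothesis reads
     [t ^+ 2 <= K * t]. *)
  pose c := Hi *m ctr a; set t := sqn _.
  have tE : t = (a *m c) 0 0.
    rewrite /t -sqnE ctrK !ctrM ctrK HiH /c !mulmxA.
    by rewrite -[a *m Hi *m ctr A *m A]mulmxA -/H -[a *m Hi *m H]mulmxA mulVmx// mulmx1.
  have tE2 : sqn (A *m c) = t.
    have Hc : H *m c = ctr a by rewrite /c mulmxA mulmxV// mul1mx.
    have cc : ctr c = a *m Hi by rewrite /c ctrM ctrK HiH.
    by rewrite tE -sqnE ctrM -mulmxA [ctr A *m _]mulmxA -/H Hc cc -mulmxA.
  have t0 : 0 <= t by exact: sqn_ge0.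
  have := aK c; rewrite -tE tE2 ger0_norm//.
  have [->|tn0] := eqVneq t 0; first by [].
  by rewrite expr2 ler_pM2r// lt_neqAle eq_sym tn0.
Qed.

Lemma pseudo_inverse_gen P m (A : 'I_P -> 'I_m -> C) :
  (forall c : 'I_m -> C, (forall p, \sum_(i < m) A p i * c i = 0) -> forall i, c i = 0) ->
  exists G : 'I_m -> 'I_P -> C,
  [/\ forall c i, \sum_(p < P) G i p * (\sum_(j < m) A p j * c j) = c i,
    forall b e, \sum_(p < P) `|b p - \sum_(i < m) A p i * (\sum_(q < P) G i q * b q)| ^+ 2 <=
       \sum_(p < P) `|b p - \sum_(i < m) A p i * e i| ^+ 2 &
    forall (a : 'I_m -> C) (K : C), 0 <= K ->
      (forall c, `|\sum_(i < m) a i * c i| ^+ 2 <= K * \sum_(p < P) `|\sum_(i < m) A p i * c i| ^+ 2) ->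
      \sum_(p < P) `|\sum_(i < m) a i * G i p| ^+ 2 <= K].
Proof.
move=> inj; pose AM : 'M[C]_(P, m) := \matrix_(p, i) A p i.
pose col n (c : 'I_n -> C) : 'cV[C]_n := \col_i c i.
have AE (c : 'cV[C]_m) p : (AM *m c) p 0 = \sum_(i < m) A p i * c i 0.
  by rewrite mxE; apply: eq_bigr => i _; rewrite mxE.
have [|G [GA Gls Gb]] := @pseudo_inverse_mx P m AM.
  move=> c /matrixP c0; apply/matrixP => i j; rewrite ord1 mxE.
  by apply: (inj (fun i => c i 0)) => p; rewrite -AE c0 mxE.
exists (fun i p => G i p); split.
- move=> c i; have /matrixP/(_ i 0) : G *m AM *m col _ c = col _ c by rewrite GA mul1mx.
  rewrite -mulmxA mxE [RHS]mxE => <-; apply: eq_bigr => p _; rewrite AE.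
  by congr (_ * _); apply: eq_bigr => j _; rewrite mxE.
- move=> b e.
  have sub (x : 'cV[C]_m) : sqn (col _ b - AM *m x) =
      \sum_(p < P) `|b p - \sum_(i < m) A p i * x i 0| ^+ 2.
    apply: eq_bigr => p _.
    congr (Num.norm _ ^+ 2); rewrite mxE; congr (_ + _); first by rewrite mxE.
    by rewrite mxE AE.
  have := Gls (col _ b) (col _ e); rewrite !sub.
  congr (_ <= _); apply: eq_bigr => p _; congr (Num.norm (_ - _) ^+ 2); apply: eq_bigr => i _.
    by congr (_ * _); rewrite mxE; apply: eq_bigr => q _; rewrite mxE.
  by rewrite mxE.
- move=> a K K0 aK; pose am : 'rV[C]_m := \row_i a i.
  have H := Gb am K K0.
  have -> : \sum_(p < P) `|\sum_(i < m) a i * G i p| ^+ 2 = sqn (ctr (am *m G)).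
    apply: eq_bigr => p _; rewrite !mxE norm_conjC; congr (Num.norm _ ^+ 2).
    by apply: eq_bigr => i _; rewrite mxE.
  apply: H => c.
  have -> : (am *m c) 0 0 = \sum_(i < m) a i * c i 0.
    by rewrite mxE; apply: eq_bigr => i _; rewrite mxE.
  have -> : sqn (AM *m c) = \sum_(p < P) `|\sum_(i < m) A p i * c i 0| ^+ 2.
    by apply: eq_bigr => p _; rewrite AE.
  exact: aK.
Qed.

End PseudoInverse.

Lemma normcC (R : realType) (x : R[i]) : `|x| = (normc x)%:C.
Proof. by rewrite normc_def; case: x. Qed.

Lemma sum_sqr_normC (R : realType) n (x : 'I_n -> R[i]) :
  \sum_(i < n) `|x i| ^+ 2 = (\sum_(i < n) normc (x i) ^+ 2)%:C.
Proof. by rewrite rmorph_sum /=; apply: eq_bigr => i _; rewrite normcC rmorphXn. Qed.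

(** Exact recovery and the dual bound on [a] composed with [G] serve [projsn_upper]; optimality
    among all [e] serves [tensor_dense]. No constant depends on [P] or [m]. *)
Lemma pseudo_inverse (R : realType) P m (A : 'I_P -> 'I_m -> R[i]) :
  (forall c : 'I_m -> R[i], (forall p, \sum_(i < m) A p i * c i = 0) -> forall i, c i = 0) ->
  exists G : 'I_m -> 'I_P -> R[i],
  [/\ forall c i, \sum_(p < P) G i p * (\sum_(j < m) A p j * c j) = c i,
    forall b e, \sum_(p < P) normc (b p - \sum_(i < m) A p i * (\sum_(q < P) G i q * b q)) ^+ 2 <=
       \sum_(p < P) normc (b p - \sum_(i < m) A p i * e i) ^+ 2 &
    forall (a : 'I_m -> R[i]) (K : R), 0 <= K ->
      (forall c, normc (\sum_(i < m) a i * c i) ^+ 2 <= K * \sum_(p < P) normc (\sum_(i < m) A p i * c i) ^+ 2) ->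
      \sum_(p < P) normc (\sum_(i < m) a i * G i p) ^+ 2 <= K].
Proof.
move=> /pseudo_inverse_gen[G [H1 H2 H3]]; exists G; split; first exact: H1.
- move=> b e; have := H2 b e.
  by rewrite (sum_sqr_normC (fun p => b p - _)) (sum_sqr_normC (fun p => b p - _)) lecR.
- move=> a K K0 aK; rewrite -lecR -sum_sqr_normC; apply: H3; first by rewrite ler0c.
  by move=> c; rewrite normcC -rmorphXn sum_sqr_normC -rmorphM lecR.
Qed.

(** Lagrange's identity: twice the difference of the two sides is a double sum of squares. *)
Lemma cauchy_schwarz (R : realType) n (a b : 'I_n -> R) :
  (\sum_(p < n) a p * b p) ^+ 2 <= (\sum_(p < n) a p ^+ 2) * (\sum_(p < n) b p ^+ 2).
Proof.
rewrite -subr_ge0 -(@pmulr_rge0 _ 2)//.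
suff -> : 2 * ((\sum_(p < n) a p ^+ 2) * (\sum_(p < n) b p ^+ 2) - (\sum_(p < n) a p * b p) ^+ 2) =
  \sum_(p < n) \sum_(q < n) (a p * b q - a q * b p) ^+ 2.
  by apply: sumr_ge0 => p _; apply: sumr_ge0 => q _; exact: sqr_ge0.
have E1 : (\sum_(p < n) a p ^+ 2) * (\sum_(p < n) b p ^+ 2) = \sum_(p < n) \sum_(q < n) a p ^+ 2 * b q ^+ 2.
  by rewrite mulr_suml; apply: eq_bigr => p _; rewrite mulr_sumr.
have E2 : (\sum_(p < n) a p ^+ 2) * (\sum_(p < n) b p ^+ 2) = \sum_(p < n) \sum_(q < n) a q ^+ 2 * b p ^+ 2.
  by rewrite E1 exchange_big.
have E3 : (\sum_(p < n) a p * b p) ^+ 2 = \sum_(p < n) \sum_(q < n) (a p * b p) * (a q * b q).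
  by rewrite expr2 mulr_suml; apply: eq_bigr => p _; rewrite mulr_sumr.
rewrite mulrBr mulr_natl mulr2n {1}E1 E2 E3 mulr_natl mulr2n opprD addrA.
rewrite -!big_split -sumrB -sumrB; apply: eq_bigr => p _ /=.
rewrite -!big_split -sumrB -sumrB; apply: eq_bigr => q _ /=; ring.
Qed.

Lemma sum_sqrt_le (R : realType) n (b x : 'I_n -> R) (B X : R) :
  (forall p, 0 <= b p) -> \sum_(p < n) b p <= B -> \sum_(p < n) x p ^+ 2 <= X ->
  \sum_(p < n) Num.sqrt (b p) * x p <= Num.sqrt B * Num.sqrt X.
Proof.
move=> b0 bB xX; have B0 : 0 <= B by apply: le_trans bB; exact: sumr_ge0.
have X0 : 0 <= X by apply: le_trans xX; apply: sumr_ge0 => p _; exact: sqr_ge0.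
apply: le_trans (ler_norm _) _; rewrite -sqrtr_sqr -sqrtrM//; apply: ler_wsqrtr.
apply: le_trans (cauchy_schwarz _ _) _; apply: ler_pM => //.
- by apply: sumr_ge0 => p _; exact: sqr_ge0.
- by apply: sumr_ge0 => p _; exact: sqr_ge0.
- by under eq_bigr do rewrite sqr_sqrtr//.
Qed.

Lemma bounded_sum_tail (R : realType) (b : nat -> R) (B : R) : (forall n, 0 <= b n) ->
  (forall m, \sum_(n < m) b n <= B) ->
  forall e : R, 0 < e -> exists m, forall M, \sum_(m <= n < M) b n <= e.
Proof.
move=> b0 bB e e0; pose S := [set \sum_(n < m) b n | m in [set: nat]].
have hS : has_sup S.
  by split; [exists (\sum_(n < 0) b n), 0%N|exists B => _ [m _ <-]].
have [_ [m _ <-] hm] := sup_adherent e0 hS.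
exists m => M; have [Mm|mM] := leqP M m; first by rewrite big_geq// ltW.
have : \sum_(n < M) b n <= sup S by apply: ub_le_sup; [exact: hS.2|exists M].
rewrite -!(big_mkord xpredT) (@big_cat_nat _ _ _ m)//=; last exact: ltnW.
rewrite -(big_mkord xpredT) in hm; lra.
Qed.

(** Real and imaginary parts are rounded to steps of length [e / 2], and one [z] is kept for each
    pattern of rounded values that occurs; so the net consists of values of [v]. The default [z0] is
    quantified because [Z] has no distinguished element. *)
Lemma finite_net (R : realType) (Z : Type) n (v : Z -> 'I_n -> R[i]) (K e : R) : 0 < e ->
  (forall z j, normc (v z j) <= K) ->
  exists s : seq Z, forall z, exists i : 'I_(size s), forall j,
     forall z0, normc (v z j - v (nth z0 s i) j) <= e.
Proof.
move=> e0 vK.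
pose N := (Num.truncn (2 * K * (2 / e))).+1.
pose code (x : R) : 'I_N := inord (Num.truncn ((x + K) * (2 / e))).
pose T : finType := {ffun 'I_n -> 'I_N * 'I_N}.
pose cl z : T := [ffun j => (code (Re (v z j)), code (Im (v z j)))].
have e20 : 0 < 2 / e by rewrite divr_gt0.
have codeP x y : `|x| <= K -> `|y| <= K -> code x = code y -> `|x - y| <= e / 2.
  have aux t : `|t| <= K -> [/\ (code t)%:R <= (t + K) * (2 / e) & (t + K) * (2 / e) < (code t)%:R + 1].
    rewrite ler_norml => /andP[t1 t2].
    have t0 : 0 <= (t + K) * (2 / e) by rewrite mulr_ge0 ?(ltW e20)//; lra.
    have tN : (Num.truncn ((t + K) * (2 / e)) < N)%N.
      by rewrite ltnS; apply: le_truncn; rewrite ler_wpM2r ?(ltW e20)//; lra.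
    by rewrite /code inordK// natr1; have /andP[] := truncn_itv t0.
  move=> /aux[x1 x2] /aux[y1 y2] E; rewrite E in x1 x2.
  have E2 : (x - y) * (2 / e) = (x + K) * (2 / e) - (y + K) * (2 / e) by ring.
  have : `|(x - y) * (2 / e)| <= 1 by rewrite E2 ler_norml; apply/andP; split; lra.
  by rewrite normrM (gtr0_norm e20) -ler_pdivlMr// div1r invf_div.
pose rep (t : T) : seq Z := if pselect (exists z, cl z = t) is left H then [:: projT1 (cid H)] else [::].
exists (flatten [seq rep t | t <- enum T]) => z.
have [z' zr cz] : exists2 z', (exists2 k, (k < size (flatten [seq rep t | t <- enum T]))%N &
    forall z0, nth z0 (flatten [seq rep t | t <- enum T]) k = z') & cl z' = cl z.
  have : cl z \in enum T by rewrite mem_enum.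
  elim: (enum T) => // t E IH; rewrite inE => /orP[/eqP ct|/IH [z' [k kl kn] cz]].
    rewrite /= /rep; case: pselect => [H|]; last by case; exists z.
    exists (projT1 (cid H)); first by exists 0%N.
    by rewrite (projT2 (cid H)).
  exists z' => //; exists (size (rep t) + k)%N; first by rewrite /= size_cat ltn_add2l.
  by move=> z0; rewrite /= nth_cat ltnNge leq_addr /= addKn.
case: zr => k kl kn; exists (Ordinal kl) => j z0; rewrite kn.
have := congr1 (fun t : T => t j) cz; rewrite !ffunE => -[c1 c2].
rewrite (le_trans (normc_le_ReIm _))// ReB ImB [e]splitr; apply: lerD; apply: codeP => //.
- exact: le_trans (Re_le_normc _) (vK _ _).
- exact: le_trans (Re_le_normc _) (vK _ _).
- exact: le_trans (Im_le_normc _) (vK _ _).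
- exact: le_trans (Im_le_normc _) (vK _ _).
Qed.

(** * Seminorms and representations *)

Section Seminorms.
Variable R : realType.
Local Notation C := R[i].

Section OneFactor.
Variables (k : nat) (W : pt R k -> R).
Hypothesis W0 : forall x, 0 <= W x.
Implicit Types f : pt R k -> C.

Lemma snorm_le_wbound f K : (snorm W f <= K%:E)%E <-> wbound W f K.
Proof.
split=> [H x|H].
  by rewrite -lee_fin; apply: le_trans H; apply: ereal_sup_ubound; exists x.
by apply: ge_ereal_sup => _ [x _ <-]; rewrite lee_fin.
Qed.

Lemma wbound_ge0 f K : wbound W f K -> 0 <= K.
Proof. by move/(_ (zeropt R k)); apply: le_trans; rewrite mulr_ge0 ?normc_ge0. Qed.

Lemma snorm_ge0 f : (0 <= snorm W f)%E.
Proof.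
apply: (@le_trans _ _ (W (zeropt R k) * normc (f (zeropt R k)))%:E).
  by rewrite lee_fin mulr_ge0 ?normc_ge0.
by apply: ereal_sup_ubound; exists (zeropt R k).
Qed.

Lemma snorm_fin f : (snorm W f < +oo)%E -> exists2 K, snorm W f = K%:E & wbound W f K.
Proof.
move=> H; have sf : snorm W f \is a fin_num by rewrite ge0_fin_numE// snorm_ge0.
exists (fine (snorm W f)); first by rewrite fineK.
by apply/snorm_le_wbound; rewrite fineK.
Qed.

Lemma wbound_le f K K' : wbound W f K -> K <= K' -> wbound W f K'.
Proof. by move=> H KK x; exact: le_trans (H x) KK. Qed.

Lemma wboundZ c f K : wbound W f K -> wbound W (fun x => c * f x) (normc c * K).
Proof. by move=> H x; rewrite normcM mulrCA ler_wpM2l ?normc_ge0. Qed.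

Lemma wbound_sum (I : Type) (s : seq I) (F : I -> pt R k -> C) (K : I -> R) :
  (forall i, wbound W (F i) (K i)) -> wbound W (fun x => \sum_(i <- s) F i x) (\sum_(i <- s) K i).
Proof.
move=> H x; apply: le_trans (ler_wpM2l (W0 x) (normc_sum _ _ _)) _.
by rewrite mulr_sumr; apply: ler_sum => i _; exact: H.
Qed.

Lemma wboundB f g K K' : wbound W f K -> wbound W g K' -> wbound W (fun x => f x - g x) (K + K').
Proof.
move=> Hf Hg x; apply: le_trans (ler_wpM2l (W0 x) (normcB _ _)) _.
by rewrite mulrDr lerD.
Qed.

End OneFactor.

Section Space.
Variables (k : nat) (I : Type) (M : I -> pt R k -> R).
Hypothesis M0 : forall g x, 0 <= M g x.
Implicit Types f : pt R k -> C.

Lemma inH_wbound f g : inH M f -> exists K, wbound (M g) f K.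
Proof. by move=> [_ /(_ g)/(snorm_fin (M0 g))[K _ HK]]; exists K. Qed.

Lemma inH_intro f : entire f -> (forall g, exists K, wbound (M g) f K) -> inH M f.
Proof.
move=> ef H; split=> // g; have [K /snorm_le_wbound HK] := H g.
by rewrite (le_lt_trans HK)// ltry.
Qed.

Lemma inH_comb (T : Type) (s : seq T) (c : T -> C) (F : T -> pt R k -> C) :
  (forall i, inH M (F i)) -> inH M (fun x => \sum_(i <- s) c i * F i x).
Proof.
move=> H; apply: inH_intro; first by apply: entire_sum => i; apply: entireZ; exact: (H i).1.
move=> g; have /choice[K HK] : forall i, exists K, wbound (M g) (F i) K by move=> i; exact: inH_wbound.
by exists (\sum_(i <- s) normc (c i) * K i); apply: wbound_sum => // i; exact: wboundZ.
Qed.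

Lemma inHB f h : inH M f -> inH M h -> inH M (fun x => f x - h x).
Proof.
move=> Hf Hh; apply: inH_intro; first by apply: entireB; [exact: Hf.1|exact: Hh.1].
move=> g; have [K HK] := inH_wbound g Hf; have [K' HK'] := inH_wbound g Hh.
by exists (K + K'); exact: wboundB.
Qed.

End Space.

Section TwoFactors.
Variables (k1 k2 : nat) (I J : Type) (M : I -> pt R k1 -> R) (N : J -> pt R k2 -> R).
Hypotheses (M0 : forall g x, 0 <= M g x) (N0 : forall w x, 0 <= N w x).
Local Notation MN := (tensfam M N).

Lemma tensfam_ge0 gw x : 0 <= MN gw x. Proof. by rewrite mulr_ge0. Qed.

Lemma wbound_Phi g w f h K K' : wbound (M g) f K -> wbound (N w) h K' ->
  wbound (MN (g, w)) (Phi f h) (K * K').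
Proof.
by move=> Hf Hh x; rewrite /tensfam /Phi normcM mulrACA ler_pM ?mulr_ge0 ?normc_ge0.
Qed.

Lemma inH_Phi f h : inH M f -> inH N h -> inH MN (Phi f h).
Proof.
move=> Hf Hh; apply: inH_intro; first by apply: Phi_entire; [exact: Hf.1|exact: Hh.1].
move=> [g w]; have [K HK] := inH_wbound M0 g Hf; have [K' HK'] := inH_wbound N0 w Hh.
by exists (K * K'); exact: wbound_Phi.
Qed.

Lemma rep_bound g w (s : seq ((pt R k1 -> C) * (pt R k2 -> C))) :
  (forall p, Stdlib.Lists.List.In p s -> inH M p.1 /\ inH N p.2) ->
  exists2 K, (\sum_(p <- s) snorm (M g) p.1 * snorm (N w) p.2)%E = K%:E &
    wbound (MN (g, w)) (fun x => \sum_(p <- s) Phi p.1 p.2 x) K.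
Proof.
elim: s => [|p s IH] H.
  exists 0; first by rewrite big_nil.
  by move=> x; rewrite big_nil normc0 mulr0.
have [|K EK HK] := IH; first by move=> q qs; apply: H; right.
have [H1 H2] := H p (or_introl erefl).
have [K1 E1 B1] := snorm_fin (M0 g) (H1.2 g).
have [K2 E2 B2] := snorm_fin (N0 w) (H2.2 w).
exists (K1 * K2 + K); first by rewrite big_cons EK E1 E2 EFinD EFinM.
move=> x; rewrite big_cons; apply: le_trans (ler_wpM2l (tensfam_ge0 _ _) (normcD _ _)) _.
by rewrite mulrDr lerD//; exact: wbound_Phi.
Qed.

Lemma snorm_le_projsn g w u : (snorm (MN (g, w)) u <= projsn M N g w u)%E.
Proof.
apply: le_ereal_inf_tmp => _ [s [Hs ->] <-].
by have [K -> /snorm_le_wbound] := rep_bound g w Hs.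
Qed.

Lemma reps_ord P (phi : 'I_P -> pt R k1 -> C) (ga : 'I_P -> pt R k2 -> C) u :
  (forall p, inH M (phi p)) -> (forall p, inH N (ga p)) ->
  (forall x, u x = \sum_(p < P) phi p (ptl x) * ga p (ptr x)) ->
  reps M N u [seq (phi p, ga p) | p <- enum 'I_P].
Proof.
move=> Hphi Hga uE; split.
  elim: (enum 'I_P) => //= p e IH q [<-|/IH//].
  by split; [exact: Hphi|exact: Hga].
by apply/funext => x; rewrite uE big_map big_enum.
Qed.

Lemma projsn_le_sum g w P (phi : 'I_P -> pt R k1 -> C) (ga : 'I_P -> pt R k2 -> C) (K K' : 'I_P -> R) u :
  (forall p, inH M (phi p)) -> (forall p, inH N (ga p)) ->
  (forall x, u x = \sum_(p < P) phi p (ptl x) * ga p (ptr x)) ->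
  (forall p, wbound (M g) (phi p) (K p)) -> (forall p, wbound (N w) (ga p) (K' p)) ->
  (projsn M N g w u <= (\sum_(p < P) K p * K' p)%:E)%E.
Proof.
move=> Hphi Hga uE HK HK'.
apply: (@le_trans _ _ (\sum_(p <- [seq (phi p, ga p) | p <- enum 'I_P]) snorm (M g) p.1 * snorm (N w) p.2)%E).
  by apply: ereal_inf_lbound; exists [seq (phi p, ga p) | p <- enum 'I_P] => //; exact: reps_ord.
rewrite big_map big_enum -sumEFin; apply: lee_sum => p _; rewrite EFinM.
apply: lee_pmul; [exact: snorm_ge0|exact: snorm_ge0| |].
  by apply/snorm_le_wbound; exact: HK.
by apply/snorm_le_wbound; exact: HK'.
Qed.

Lemma reps_nth u s : reps M N u s ->
  exists m (f : 'I_m -> pt R k1 -> C) (h : 'I_m -> pt R k2 -> C),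
  [/\ forall i, inH M (f i), forall i, inH N (h i) &
     forall x, u x = \sum_(i < m) f i (ptl x) * h i (ptr x)].
Proof.
move=> [Hs ->]; pose d : (pt R k1 -> C) * (pt R k2 -> C) := (fun=> 0, fun=> 0).
have Hin i : (i < size s)%N -> Stdlib.Lists.List.In (nth d s i) s.
  by elim: s i {Hs} => // p s IH [|i] /=; [left|right; exact: IH].
exists (size s), (fun i => (nth d s i).1), (fun i => (nth d s i).2); split.
- by move=> i; have [] := Hs _ (Hin i (ltn_ord i)).
- by move=> i; have [] := Hs _ (Hin i (ltn_ord i)).
- by move=> x; rewrite (big_nth d) big_mkord.
Qed.

(** The factor [M g z] makes the bound on the slices uniform in [z]. *)
Lemma wbound_slice g w u K z : wbound (MN (g, w)) u K ->
  wbound (N w) (fun y => (M g z)%:C * u (catpt z y)) K.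
Proof.
move=> H y; have := H (catpt z y); rewrite /tensfam /= ptl_cat ptr_cat normcM normc_real.
by rewrite ger0_norm// mulrCA mulrA.
Qed.

End TwoFactors.
End Seminorms.

(** * Reduction to finitely many functionals *)

Section Truncation.
Variables (R : realType) (k : nat) (J : Type) (N : J -> pt R k -> R).
Hypothesis dfN : defining_family N.
Hypothesis HI : forall w : J, exists (w' : J) (L : pt R k -> R),
     (forall x, 0 <= L x) /\
     (exists K : R, forall x, L x <= K) /\
     measurable_fun [set: pt R k] L /\
     (iint (fun x => (L x)%:E) < +oo)%E /\
     (forall x, N w x <= L x * N w' x) /\
     (forall e : R, 0 < e -> exists r : R, forall x, r < ptnorm x -> L x < e).
Hypothesis HII : forall w : J, exists (w' : J) (B : set (pt R k)) (c : R),
     (exists r : R, 0 < r /\ forall x, ptnorm x < r -> B x) /\ 0 < c /\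
     forall x x', B x' -> N w x <= c * N w' (addpt x x').

(** The tail of the series of functionals is at most the tail of [b] times [K]. The number [m] of
    functionals depends on [e] alone, so it can be fixed before the vectors and the linear algebra
    is finite-dimensional. *)
Lemma truncated_functionals w : exists w' (d : nat -> R * seq 'I_k * pt R k) (b : nat -> R) (B : R),
  [/\ forall n, 0 < b n, forall m, \sum_(n < m) b n <= B,
     forall n f K, entire f -> wbound (N w') f K -> normc (taylor_fun (d n) f) <= b n * K &
     forall e : R, 0 < e -> exists m, forall f K, inH N f -> wbound (N w') f K ->
       wbound (N w) f (\sum_(n < m) normc (taylor_fun (d n) f) + e * K)].
Proof.
have [w' [d [b [B [b0 bB bd sup]]]]] := nuclear_functionals dfN HI HII w.
exists w', d, b, B; split=> // e e0.
have [m Hm] := bounded_sum_tail (fun n => ltW (b0 n)) bB e0.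
exists m => f K Hf fK; have K0 := wbound_ge0 (df_nonneg dfN w') fK.
apply: sup => // m'; rewrite -!(big_mkord xpredT (fun n => normc (taylor_fun (d n) f))).
have [mm|mm] := leqP m' m.
  rewrite [X in _ <= X + _](@big_cat_nat _ _ _ m')//= -addrA lerDl addr_ge0//.
    by apply: sumr_ge0 => n _; exact: normc_ge0.
  by rewrite mulr_ge0// ltW.
rewrite (@big_cat_nat _ _ _ m)//=; last exact: ltnW.
rewrite lerD2l (@le_trans _ _ (\sum_(m <= n < m') b n * K))//.
  by apply: ler_sum => n _; apply: bd => //; exact: Hf.1.
by rewrite -mulr_suml ler_wpM2r.
Qed.

End Truncation.

(** * The tensor product of the two spaces *)

Section Main.
Variables (R : realType) (k1 k2 : nat) (I J : Type)
  (M : I -> pt R k1 -> R) (N : J -> pt R k2 -> R).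
Local Notation C := R[i].
Hypotheses (dfM : defining_family M) (dfN : defining_family N).
Hypothesis HI : forall w : J, exists (w' : J) (L : pt R k2 -> R),
     (forall x, 0 <= L x) /\
     (exists K : R, forall x, L x <= K) /\
     measurable_fun [set: pt R k2] L /\
     (iint (fun x => (L x)%:E) < +oo)%E /\
     (forall x, N w x <= L x * N w' x) /\
     (forall e : R, 0 < e -> exists r : R, forall x, r < ptnorm x -> L x < e).
Hypothesis HII : forall w : J, exists (w' : J) (B : set (pt R k2)) (c : R),
     (exists r : R, 0 < r /\ forall x, ptnorm x < r -> B x) /\ 0 < c /\
     forall x x', B x' -> N w x <= c * N w' (addpt x x').
Local Notation MN := (tensfam M N).
Let M0 := df_nonneg dfM.
Let N0 := df_nonneg dfN.

Lemma split_sum P m (T : nmodType) (F : 'I_P + 'I_m -> T) :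
  \sum_(p < P + m) F (fintype.split p) = \sum_(n < P) F (inl n) + \sum_(j < m) F (inr j).
Proof.
rewrite big_split_ord; congr (_ + _); apply: eq_bigr => i _.
  by rewrite -[lshift _ i]/(unsplit (inl i)) unsplitK.
by rewrite -[rshift _ i]/(unsplit (inr i)) unsplitK.
Qed.

(* Write [u = sum_i f_i h_i] and weigh the functionals [d' n] by [1 / sqrt (b' n)];
   small multiples of the coordinates make the resulting [A] injective. Its inverse [G]
   gives [u = sum_p phi_p ga_p], where [phi_p = sum_i A_pi f_i] is bounded through [u]
   itself and the Cauchy-Schwarz inequality controls the [ga_p], for each [d n] at once. *)
Lemma projsn_upper (g : I) (w : J) : exists (g' : I) (w' : J) (c : R), 0 < c /\
  forall u, in_tensor M N u -> (projsn M N g w u <= c%:E * snorm (MN (g', w')) u)%E.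
Proof.
have [w1 [d [b [B [b0 bB bd tr]]]]] := truncated_functionals dfN HI HII w.
have [w2 [d' [b' [B' [b'0 b'B bd' tr']]]]] := truncated_functionals dfN HI HII w1.
have B0 : 0 <= B by have := bB 0%N; rewrite big_ord0.
have B'0 : 0 <= B' by have := b'B 0%N; rewrite big_ord0.
(* The first summand comes from the functionals [d n] on the [ga p], the final 1 from the truncation
   error; [e <= 1] is used in both. *)
pose c := B * (B' + 1) + 1.
have c0 : 0 < c by rewrite ltr_wpDl// mulr_ge0// addr_ge0.
exists g, w2, c; split=> // u [s Hs].
have [S ES uS] : exists2 S, snorm (MN (g, w2)) u = S%:E & wbound (MN (g, w2)) u S.
  apply: snorm_fin; first exact: tensfam_ge0.
  have [K _ HK] := rep_bound M0 N0 g w2 Hs.1.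
  by rewrite Hs.2; apply: le_lt_trans (ltry K); apply/snorm_le_wbound.
have S0 : 0 <= S by apply: wbound_ge0 uS; exact: tensfam_ge0.
have [m [f [h [Hf Hh uE]]]] := reps_nth Hs.
rewrite ES -EFinM; apply/lee_addgt0Pr => e0 e00.
pose e := Num.min 1 (e0 / c).
have e_gt0 : 0 < e by rewrite lt_min ltr01 divr_gt0.
have e1 : e <= 1 by rewrite ge_min lexx.
have ec : e * c <= e0 by rewrite -ler_pdivlMr// ge_min lexx orbT.
have /choice[Fb HFb] : forall i, exists K, wbound (M g) (f i) K by move=> i; exact: inH_wbound.
have /choice[Hb HHb] : forall i, exists K, wbound (N w2) (h i) K by move=> i; exact: inH_wbound.
have Fb0 i : 0 <= Fb i by apply: wbound_ge0 (HFb i).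
have Hb0 i : 0 <= Hb i by apply: wbound_ge0 (HHb i).
pose F := \sum_(i < m) Fb i; pose H := \sum_(i < m) Hb i.
have FF i : Fb i <= F by rewrite /F (bigD1 i)//= lerDl sumr_ge0.
have HH i : Hb i <= H by rewrite /H (bigD1 i)//= lerDl sumr_ge0.
have F0 : 0 <= F by apply: sumr_ge0.
have H0 : 0 <= H by apply: sumr_ge0.
(* The [m] auxiliary rows have total weight at most [e], so the bound does not see the number of
   terms of the representation. *)
pose be := e / m.+1%:R.
have be0 : 0 < be by rewrite divr_gt0.
(* An auxiliary [phi p] is [f j] times [dl / Num.sqrt be]; this [dl] gives it the bound
   [Num.sqrt be * (S + e)], of the same form as for the other rows. Adding [e] keeps [dl] positive
   when [S = 0]. *)
pose dl := be * (S + e) / (F + 1).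
have Se : 0 < S + e by rewrite ltr_wpDl.
have dl0 : 0 < dl by rewrite divr_gt0 ?mulr_gt0// ltr_wpDl.
(* Chosen after [dl]: the truncation error of a combination of the [h i] is at most [dl] times the
   sum of the moduli of its coefficients, which the auxiliary rows measure. *)
have [mm Hmm] := tr' (dl / (H + 1)) (divr_gt0 dl0 (ltr_wpDl H0 ltr01)).
pose wt (p : 'I_mm + 'I_m) : R := match p with inl n => b' n | inr _ => be end.
have wt0 p : 0 < wt p by case: p => [n|j]; [exact: b'0|exact: be0].
pose Af (p : 'I_mm + 'I_m) (i : 'I_m) : C :=
  match p with inl n => (Num.sqrt (b' n))^-1%:C * taylor_fun (d' n) (h i)
  | inr j => (dl / Num.sqrt be)%:C * (i == j)%:R end.
pose A (p : 'I_(mm + m)) i := Af (fintype.split p) i.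
have sbe : 0 < Num.sqrt be by rewrite sqrtr_gt0.
have dq : 0 < dl / Num.sqrt be by exact: divr_gt0.
have Ainr (cf : 'I_m -> C) j : \sum_(i < m) Af (inr j) i * cf i = (dl / Num.sqrt be)%:C * cf j.
  by under eq_bigr do rewrite -mulrA; rewrite -mulr_sumr sum_pick.
have eh i : entire (h i) by exact: (Hh i).1.
have Ainl (cf : 'I_m -> C) n : \sum_(i < m) Af (inl n) i * cf i =
    (Num.sqrt (b' n))^-1%:C * taylor_fun (d' n) (fun y => \sum_(i < m) cf i * h i y).
  rewrite taylor_fun_sum// mulr_sumr; apply: eq_bigr => i _ /=.
  by rewrite -mulrA [taylor_fun _ _ * _]mulrC.
have [G [GA _ Gb]] : exists G : 'I_m -> 'I_(mm + m) -> C,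
  [/\ forall cf i, \sum_(p < mm + m) G i p * (\sum_(j < m) A p j * cf j) = cf i,
    forall b e, \sum_(p < mm + m) normc (b p - \sum_(i < m) A p i * (\sum_(q < mm + m) G i q * b q)) ^+ 2 <=
       \sum_(p < mm + m) normc (b p - \sum_(i < m) A p i * e i) ^+ 2 &
    forall (a : 'I_m -> C) (K : R), 0 <= K ->
      (forall cf, normc (\sum_(i < m) a i * cf i) ^+ 2 <= K * \sum_(p < mm + m) normc (\sum_(i < m) A p i * cf i) ^+ 2) ->
      \sum_(p < mm + m) normc (\sum_(i < m) a i * G i p) ^+ 2 <= K].
  apply: pseudo_inverse => cf Hcf j; have := Hcf (rshift mm j).
  rewrite /A -[rshift _ j]/(unsplit (inr j)) unsplitK Ainr => /eqP; rewrite mulf_eq0 => /orP[|/eqP//].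
  by rewrite -normc_eq0 normc_real (gtr0_norm dq) gt_eqF.
have wtB : \sum_(p < mm + m) wt (fintype.split p) <= B' + e.
  rewrite (split_sum wt) /=; apply: lerD; first exact: b'B.
  rewrite sumr_const card_ord -[_ *+ m]mulr_natr /be mulrAC ler_pdivrMr//.
  by rewrite ler_wpM2l ?(ltW e_gt0)// ler_nat.
have Be : 0 <= B' + e by rewrite addr_ge0// ltW.
pose hc (cf : 'I_m -> C) y := \sum_(i < m) cf i * h i y.
pose X cf := \sum_(p < mm + m) normc (\sum_(i < m) A p i * cf i) ^+ 2.
(* The key inequality: a combination of the [h i] is controlled by the Euclidean norm of its image
   under [A], with a constant independent of [m]. *)
have hcw1 cf : wbound (N w1) (hc cf) (Num.sqrt (B' + e) * Num.sqrt (X cf)).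
  have Hw2 : wbound (N w2) (hc cf) (\sum_(i < m) normc (cf i) * Hb i).
    by apply: wbound_sum => // i; exact: wboundZ.
  apply: wbound_le (Hmm _ _ (inH_comb N0 _ _ Hh) Hw2) _.
  apply: le_trans (sum_sqrt_le (b := fun p => wt (fintype.split p))
     (x := fun p => normc (\sum_(i < m) A p i * cf i)) (fun p => ltW (wt0 _)) wtB (lexx _)).
  rewrite (split_sum (fun p => Num.sqrt (wt p) * normc (\sum_(i < m) Af p i * cf i))) /=.
  apply: lerD.
    apply: ler_sum => n _; rewrite Ainl [X in _ <= _ * X]normcM normc_real ger0_norm ?invr_ge0 ?sqrtr_ge0//.
    by rewrite mulrA divff ?mul1r// gt_eqF// sqrtr_gt0.
  apply: (@le_trans _ _ (\sum_(j < m) dl * normc (cf j))); last first.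
    apply: ler_sum => j _; rewrite Ainr normcM normc_real (gtr0_norm dq).
    by rewrite mulrA mulrCA divff ?mulr1// gt_eqF.
  rewrite mulr_sumr; apply: ler_sum => j _; rewrite mulrCA [X in _ <= X]mulrC.
  apply: ler_wpM2l; first exact: normc_ge0.
  rewrite -mulrA ler_piMr ?(ltW dl0)// mulrC ler_pdivrMr ?mul1r; last by rewrite ltr_wpDl.
  by rewrite (le_trans (HH j))// lerDl.
pose ga (p : 'I_(mm + m)) := hc (fun i => G i p).
have Hga p : inH N (ga p) by apply: inH_comb.
have X0 cf : 0 <= X cf by apply: sumr_ge0 => p _; exact: sqr_ge0.
(* The dual bound of [pseudo_inverse], applied to the row of values of [d n] on the [h i]. *)
have level n : \sum_(p < mm + m) normc (taylor_fun (d n) (ga p)) ^+ 2 <= b n ^+ 2 * (B' + e).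
  have := Gb (fun i => taylor_fun (d n) (h i)) (b n ^+ 2 * (B' + e)).
  rewrite mulr_ge0 ?sqr_ge0// => /(_ isT) Gbn.
  under eq_bigr => p _.
    rewrite /ga /hc taylor_fun_sum//.
    under [X in normc X]eq_bigr do rewrite mulrC.
    over.
  apply: Gbn => cf.
  have -> : \sum_(i < m) taylor_fun (d n) (h i) * cf i = taylor_fun (d n) (hc cf).
    by rewrite taylor_fun_sum//; apply: eq_bigr => i _; rewrite mulrC.
  have ehc : entire (hc cf) by exact: (inH_comb N0 _ _ Hh).1.
  have := bd n _ _ ehc (hcw1 cf) => bdn.
  apply: (@le_trans _ _ ((b n * (Num.sqrt (B' + e) * Num.sqrt (X cf))) ^+ 2)).
    by apply: lerXn2r; rewrite ?nnegrE ?normc_ge0// !mulr_ge0 ?sqrtr_ge0// ltW.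
  by rewrite !exprMn !sqr_sqrtr// mulrA.
have /choice[K1 HK1] : forall p, exists K, wbound (N w1) (ga p) K by move=> p; exact: inH_wbound.
have K10 p : 0 <= K1 p by apply: wbound_ge0 (HK1 p).
pose Q := \sum_(p < mm + m) Num.sqrt (wt (fintype.split p)) * K1 p.
have Q0 : 0 <= Q by apply: sumr_ge0 => p _; rewrite mulr_ge0// sqrtr_ge0.
(* The crude bounds [K1] depend on the representation, but [m1] is chosen after them, so that their
   weighted sum [Q] contributes at most 1. *)
have [m1 Hm1] := tr (e / (Q + 1)) (divr_gt0 e_gt0 (ltr_wpDl Q0 ltr01)).
pose phi p (z : pt R k1) := \sum_(i < m) A p i * f i z.
have Hphi p : inH M (phi p) by apply: inH_comb.
have phib p : wbound (M g) (phi p) (Num.sqrt (wt (fintype.split p)) * (S + e)).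
  move=> z; rewrite /phi /A; case: (fintype.split p) => [n|j] /=.
  - rewrite (Ainl (fun i => f i z)) normcM normc_real ger0_norm ?invr_ge0 ?sqrtr_ge0//.
    have sb : 0 < Num.sqrt (b' n) by rewrite sqrtr_gt0.
    rewrite mulrCA ler_pdivrMl// mulrA -expr2 sqr_sqrtr ?(ltW (b'0 n))//.
    pose uz y := (M g z)%:C * (\sum_(i < m) f i z * h i y).
    have euz : entire (fun y => \sum_(i < m) f i z * h i y) by apply: entire_sum => i; exact: entireZ.
    have := bd' n uz S (entireZ _ euz); rewrite /uz taylor_funZ// normcM normc_real ger0_norm//.
    move=> H1; apply: le_trans (H1 _) _.
      have := wbound_slice M0 z uS; congr (wbound _ _ _); apply/funext => y.
      rewrite uE; congr (_ * _); apply: eq_bigr => i _; by rewrite ptl_cat ptr_cat.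
    by apply: ler_wpM2l; [exact: ltW|rewrite lerDl ltW].
  - rewrite (Ainr (fun i => f i z)) normcM normc_real (gtr0_norm dq) mulrCA.
    apply: le_trans (ler_wpM2l (ltW (divr_gt0 dl0 sbe)) (le_trans (HFb j z) (FF j))) _.
    rewrite mulrAC ler_pdivrMr// [X in _ <= X]mulrAC -[X in _ <= X * _]expr2 sqr_sqrtr ?(ltW be0)//.
    rewrite /dl mulrAC ler_pdivrMr; last by rewrite ltr_wpDl.
    have beSe : 0 <= be * (S + e) by apply: mulr_ge0; exact: ltW.
    by apply: (ler_wpM2l beSe); rewrite lerDl.
have uE' x : u x = \sum_(p < mm + m) phi p (ptl x) * ga p (ptr x).
  rewrite uE /ga /hc.
  under [RHS]eq_bigr do rewrite mulr_sumr.
  rewrite exchange_big /=; apply: eq_bigr => i _.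
  rewrite -[f i (ptl x)](GA (fun i => f i (ptl x))) mulr_suml; apply: eq_bigr => p _.
  by rewrite /phi mulrA [_ * G i p]mulrC.
apply: le_trans (projsn_le_sum M0 N0 Hphi Hga uE' phib (fun p => Hm1 _ _ (Hga p) (HK1 p))) _.
rewrite -EFinD lee_fin.
apply: (@le_trans _ _ ((S + e) * c)); last by rewrite mulrDl [S * c]mulrC lerD2l.
under eq_bigr do rewrite [Num.sqrt _ * _]mulrC -mulrA mulrDr.
rewrite -mulr_sumr; apply: ler_wpM2l; first exact: ltW.
rewrite big_split /=; apply: lerD; last first.
  under eq_bigr do rewrite mulrCA.
  rewrite -mulr_sumr -/Q mulrAC ler_pdivrMr ?ltr_wpDl// mul1r.
  by rewrite (le_trans (ler_wpM2r Q0 e1))// mul1r lerDl.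
(* Cauchy-Schwarz is applied over [p] for each fixed [n], and only then is the sum over [n] taken;
   it converges because [level n] contains [b n]. *)
under eq_bigr do rewrite mulr_sumr.
rewrite exchange_big /=.
apply: (@le_trans _ _ (\sum_(n < m1) b n * (B' + e))).
  apply: ler_sum => n _.
  apply: le_trans (sum_sqrt_le (b := fun p => wt (fintype.split p)) (fun p => ltW (wt0 _)) wtB (level n)) _.
  rewrite sqrtrM ?sqr_ge0// sqrtr_sqr (gtr0_norm (b0 n)) mulrCA -expr2 sqr_sqrtr//.
by rewrite -mulr_suml; apply: ler_pM; rewrite ?sumr_ge0// ?lerD2l// => n _; exact: ltW.
Qed.

(* The functions [x z = M z * u (z, .)] are totally bounded for [N w1]; approximating
   [x z] in the span of a finite net by least squares makes the coefficients linear in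
   [x z], hence [M z] times entire functions of [z]. *)
Lemma tensor_dense u (g : I) (w : J) (e : R) : inH MN u -> 0 < e ->
  exists v, in_tensor M N v /\ (snorm (MN (g, w)) (fun zw => (u zw - v zw)%R) < e%:E)%E.
Proof.
move=> Hu e0.
have [w1 [d [b [B [b0 bB bd tr]]]]] := truncated_functionals dfN HI HII w.
have [w2 [d' [b' [B' [b'0 b'B bd' tr']]]]] := truncated_functionals dfN HI HII w1.
have B0 : 0 <= B by have := bB 0%N; rewrite big_ord0.
have MN0 gw x : 0 <= MN gw x by exact: tensfam_ge0.
have [S uS] := inH_wbound MN0 (g, w2) Hu; have S0 := wbound_ge0 (MN0 (g, w2)) uS.
have [S1 uS1] := inH_wbound MN0 (g, w1) Hu; have S10 := wbound_ge0 (MN0 (g, w1)) uS1.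
have eu : entire u by exact: Hu.1.
pose x (z : pt R k1) : pt R k2 -> C := fun y => (M g z)%:C * u (catpt z y).
have xH z : inH N (x z).
  apply: inH_intro; first by apply: entireZ; exact: entire_slice_r.
  by move=> w'; have [K HK] := inH_wbound MN0 (g, w') Hu; exists K; exact: (wbound_slice M0 z HK).
have xw2 z : wbound (N w2) (x z) S by exact: (wbound_slice M0 z uS).
have xw1 z : wbound (N w1) (x z) S1 by exact: (wbound_slice M0 z uS1).
(* The least squares error will be at most [(B + 1) * e'], that is [e / 4]. *)
pose e' := e / (4 * (B + 1)).
have B1 : 0 < B + 1 by rewrite ltr_wpDl.
have e'0 : 0 < e' by rewrite divr_gt0// mulr_gt0.
(* A difference of two functions [x z] is bounded by [2 * S] for [N w2], so truncation costs at most
   [e' / 2]; the accuracy [ee] of the net leaves the other half to the [m'] functionals. *)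
pose et := e' / (4 * (S + 1)).
have S1' : 0 < S + 1 by rewrite ltr_wpDl.
have et0 : 0 < et by rewrite divr_gt0// mulr_gt0.
have [m' Hm'] := tr' et et0.
pose ee := e' / (2 * m'.+1%:R).
have ee0 : 0 < ee by rewrite divr_gt0// mulr_gt0// ltr0n.
have [sz Hsz] : exists s : seq (pt R k1), forall z, exists i : 'I_(size s), forall (j : 'I_m'),
     forall z0, normc (taylor_fun (d' j) (x z) - taylor_fun (d' j) (x (nth z0 s i))) <= ee.
  apply: (@finite_net R (pt R k1) m' (fun z j => taylor_fun (d' j) (x z)) (\sum_(j < m') b' j * S) ee ee0).
  move=> z j; apply: le_trans (bd' j _ S (xH z).1 (xw2 z)) _.
  by rewrite (bigD1 j)//= lerDl sumr_ge0// => i _; rewrite mulr_ge0// ltW.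
pose m := size sz.
pose h (i : 'I_m) : pt R k2 -> C := x (nth (zeropt R k1) sz i).
have Hh i : inH N (h i) by exact: xH.
have eh i : entire (h i) by exact: (Hh i).1.
have taylor_funB dd f1 f2 : entire f1 -> entire f2 ->
    taylor_fun dd (fun y => f1 y - f2 y) = taylor_fun dd f1 - taylor_fun dd f2 :> C.
  move=> ef1 ef2; rewrite (_ : (fun y => f1 y - f2 y) = (fun y => f1 y + -1 * f2 y)).
    by rewrite taylor_funD ?taylor_funZ ?mulN1r//; exact: entireZ.
  by apply/funext => y; rewrite mulN1r.
have near z : exists i, wbound (N w1) (fun y => x z y - h i y) e'.
  have [i Hi] := Hsz z; exists i.
  apply: wbound_le (Hm' _ _ (inHB N0 (xH z) (Hh i)) (wboundB (N0 w2) (xw2 z) (xw2 _))) _.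
  rewrite [e']splitr; apply: lerD.
    apply: (@le_trans _ _ (\sum_(n < m') ee)).
      apply: ler_sum => n _; rewrite taylor_funB//; [exact: Hi|exact: (xH z).1].
    rewrite sumr_const card_ord -[_ *+ m']mulr_natr /ee invfM mulrA mulrAC ler_pdivrMr ?ltr0n//.
    by rewrite ler_wpM2l ?ler_nat// divr_ge0// ltW.
  have -> : et * (S + S) = e' / 2 * (S / (S + 1)) by rewrite /et; field; rewrite gt_eqF.
  have e'2 : 0 <= e' / 2 by apply: ltW; exact: divr_gt0.
  by rewrite ler_piMr// ler_pdivrMr// mul1r lerDl.
pose sB := Num.sqrt (B + 1).
have sB0 : 0 <= sB by exact: sqrtr_ge0.
(* A bound on the residuals known in advance: the coefficients will be at most [sB] whatever [mm]
   is, so [mm] can be chosen after [Y]. *)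
pose Y := (1 + m%:R * sB) * S1.
have Y0 : 0 <= Y by rewrite mulr_ge0// addr_ge0// mulr_ge0.
have Y1 : 0 < Y + 1 by rewrite ltr_wpDl.
have e40 : 0 < e / 4 by rewrite divr_gt0.
have [mm Hmm] := tr (e / 4 / (Y + 1)) (divr_gt0 e40 Y1).
have sb n : 0 < Num.sqrt (b n) by rewrite sqrtr_gt0.
(* Tikhonov regularisation: the rows [inr j] penalise the coefficients with weight [e'], which both
   makes [A] injective and bounds the coefficients. *)
pose Af (p : 'I_mm + 'I_m) (i : 'I_m) : C :=
  match p with inl n => (Num.sqrt (b n))^-1%:C * taylor_fun (d n) (h i)
  | inr j => e'%:C * (i == j)%:R end.
pose A (p : 'I_(mm + m)) i := Af (fintype.split p) i.
have Ainr (cf : 'I_m -> C) j : \sum_(i < m) Af (inr j) i * cf i = e'%:C * cf j.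
  by under eq_bigr do rewrite -mulrA; rewrite -mulr_sumr sum_pick.
have Ainl (cf : 'I_m -> C) n : \sum_(i < m) Af (inl n) i * cf i =
    (Num.sqrt (b n))^-1%:C * taylor_fun (d n) (fun y => \sum_(i < m) cf i * h i y).
  rewrite taylor_fun_sum// mulr_sumr; apply: eq_bigr => i _ /=.
  by rewrite -mulrA [taylor_fun _ _ * _]mulrC.
have [G [_ Gls _]] : exists G : 'I_m -> 'I_(mm + m) -> C,
  [/\ forall cf i, \sum_(p < mm + m) G i p * (\sum_(j < m) A p j * cf j) = cf i,
    forall b e, \sum_(p < mm + m) normc (b p - \sum_(i < m) A p i * (\sum_(q < mm + m) G i q * b q)) ^+ 2 <=
       \sum_(p < mm + m) normc (b p - \sum_(i < m) A p i * e i) ^+ 2 &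
    forall (a : 'I_m -> C) (K : R), 0 <= K ->
      (forall cf, normc (\sum_(i < m) a i * cf i) ^+ 2 <= K * \sum_(p < mm + m) normc (\sum_(i < m) A p i * cf i) ^+ 2) ->
      \sum_(p < mm + m) normc (\sum_(i < m) a i * G i p) ^+ 2 <= K].
  apply: pseudo_inverse => cf Hcf j; have := Hcf (rshift mm j).
  rewrite /A -[rshift _ j]/(unsplit (inr j)) unsplitK Ainr => /eqP; rewrite mulf_eq0 => /orP[|/eqP//].
  by rewrite -normc_eq0 normc_real (gtr0_norm e'0) gt_eqF.
pose bvf z (p : 'I_mm + 'I_m) : C :=
  match p with inl n => (Num.sqrt (b n))^-1%:C * taylor_fun (d n) (x z) | inr _ => 0 end.
pose bv z (p : 'I_(mm + m)) := bvf z (fintype.split p).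
pose cz z i := \sum_(p < mm + m) G i p * bv z p.
pose y z : pt R k2 -> C := fun t => x z t - \sum_(i < m) cz z i * h i t.
(* The competitor is the indicator of a net point near [z]: the functionals cost at most
   [B * e' ^+ 2] and the penalty exactly [e' ^+ 2]. *)
have LS z : \sum_(p < mm + m) normc (bvf z (fintype.split p) - \sum_(i < m) Af (fintype.split p) i * cz z i) ^+ 2 <= (B + 1) * e' ^+ 2.
  have [i0 Hi0] := near z.
  apply: le_trans (Gls (bv z) (fun i => (i == i0)%:R)) _; rewrite /bv /A.
  rewrite (split_sum (fun p => normc (bvf z p - \sum_(i < m) Af p i * (i == i0)%:R) ^+ 2)) mulrDl mul1r.
  apply: lerD.
    rewrite (@le_trans _ _ (\sum_(n < mm) b n * e' ^+ 2))//; last first.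
      by rewrite -mulr_suml ler_wpM2r ?sqr_ge0.
    apply: ler_sum => n _; rewrite Ainl.
    have -> : (fun y => \sum_(i < m) (i == i0)%:R * h i y) = h i0 by apply/funext => t; rewrite sum_pick.
    rewrite /= -mulrBr -taylor_funB//; last exact: (xH z).1.
    have ed : entire (fun t => x z t - h i0 t) by apply: entireB => //; exact: (xH z).1.
    have := bd n _ _ ed Hi0 => bn.
    rewrite normcM normc_real ger0_norm ?invr_ge0 ?sqrtr_ge0// exprMn exprVn sqr_sqrtr ?(ltW (b0 n))//.
    rewrite ler_pdivrMl// (@le_trans _ _ ((b n * e') ^+ 2))//.
      by apply: lerXn2r; rewrite ?nnegrE ?normc_ge0// mulr_ge0// ltW.
    by rewrite exprMn [b n ^+ 2]expr2 -mulrA.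
  rewrite (bigD1 i0)//= Ainr eqxx mulr1 sub0r normcN normc_real (gtr0_norm e'0) big1 ?addr0//.
  by move=> j ji; rewrite Ainr (negbTE ji) mulr0 subrr normc0 expr0n.
have czb z j : normc (cz z j) <= sB.
  have : normc (e'%:C * cz z j) ^+ 2 <= (B + 1) * e' ^+ 2.
    apply: le_trans (LS z).
    rewrite (split_sum (fun p => normc (bvf z p - \sum_(i < m) Af p i * cz z i) ^+ 2)).
    rewrite (bigD1 j)//= Ainr sub0r normcN addrCA lerDl addr_ge0//; apply: sumr_ge0 => n _; exact: sqr_ge0.
  rewrite normcM normc_real (gtr0_norm e'0) exprMn mulrC ler_pM2r ?exprn_gt0// => H.
  by rewrite -[normc _]ger0_norm ?normc_ge0// -sqrtr_sqr; exact: ler_wsqrtr.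
have yH z : inH N (y z) by apply: inHB => //; exact: inH_comb.
have yw1 z : wbound (N w1) (y z) Y.
  have Hs : wbound (N w1) (fun t => \sum_(i < m) cz z i * h i t) (\sum_(i < m) normc (cz z i) * S1).
    by apply: (wbound_sum (N0 w1)) => i; exact: (wboundZ _ (xw1 _)).
  apply: wbound_le (wboundB (N0 w1) (xw1 z) Hs) _.
  rewrite /Y mulrDl mul1r lerD2l -mulr_suml; apply: ler_wpM2r => //.
  apply: (@le_trans _ _ (\sum_(i < m) sB)); first by apply: ler_sum.
  by rewrite sumr_const card_ord -[_ *+ m]mulr_natl.
have yw z : wbound (N w) (y z) (e / 2).
  apply: wbound_le (Hmm _ _ (yH z) (yw1 z)) _.
  have -> : e / 2 = e / 4 + e / 4 by field.
  apply: lerD; last first.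
    by rewrite mulrAC ler_pdivrMr// ler_wpM2l ?lerDl// ltW.
  apply: (@le_trans _ _ (Num.sqrt B * Num.sqrt ((B + 1) * e' ^+ 2))).
    apply: le_trans (sum_sqrt_le (b := fun n : 'I_mm => b n)
       (x := fun n => normc (bvf z (inl n) - \sum_(i < m) Af (inl n) i * cz z i)) (fun n => ltW (b0 n)) (bB mm) _); last first.
      apply: le_trans (LS z).
      rewrite (split_sum (fun p => normc (bvf z p - \sum_(i < m) Af p i * cz z i) ^+ 2)) lerDl.
      by apply: sumr_ge0 => n _; exact: sqr_ge0.
    apply: ler_sum => n _; rewrite Ainl /= -mulrBr [X in _ <= _ * X]normcM normc_real.
    rewrite ger0_norm ?invr_ge0 ?sqrtr_ge0// mulrA divff ?mul1r ?gt_eqF//.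
    rewrite -taylor_funB//; first exact: (xH z).1.
    by apply: entire_sum => i; exact: entireZ.
  rewrite (sqrtrM _ (ltW B1)) sqrtr_sqr (gtr0_norm e'0) mulrA.
  apply: (@le_trans _ _ ((B + 1) * e')).
    apply: ler_wpM2r; first exact: ltW.
    rewrite -[X in _ <= X](@sqr_sqrtr _ (B + 1)) ?(ltW B1)// expr2; apply: ler_wpM2r => //.
    by apply: ler_wsqrtr; rewrite lerDl.
  by rewrite le_eqVlt; apply/orP; left; apply/eqP; rewrite /e'; field; rewrite gt_eqF.
(* The data [bv z] is linear in the slice and vanishes on the penalty rows, so [M g z] factors out
   of [cz z i]. What is left is entire and bounded for every weight [M g'], not only for [M g]. *)
pose c' (i : 'I_m) : pt R k1 -> C := fun z => \sum_(n < mm)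
   (G i (lshift m n) * (Num.sqrt (b n))^-1%:C) * taylor_fun (d n) (fun t => u (catpt z t)).
have c'H i : inH M (c' i).
  apply: inH_comb => // n; apply: inH_intro; first exact: taylor_fun_slice.
  move=> g'; have [K HK] := inH_wbound MN0 (g', w1) Hu.
  exists (b n * K) => z.
  have esl : entire (fun t => u (catpt z t)) by exact: entire_slice_r.
  have := bd n _ _ (entireZ (M g' z)%:C esl) (wbound_slice M0 z HK).
  by rewrite taylor_funZ// normcM normc_real ger0_norm.
have czE z i : cz z i = (M g z)%:C * c' i z.
  rewrite /cz /bv big_split_ord /= [X in _ + X]big1 ?addr0.
    rewrite /c' mulr_sumr; apply: eq_bigr => n _.
    rewrite -[lshift m n]/(unsplit (inl n)) unsplitK /= /x taylor_funZ; last exact: entire_slice_r.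
    by rewrite !mulrA [(M g z)%:C * _]mulrC; ring.
  by move=> j _; rewrite -[rshift mm j]/(unsplit (inr j)) unsplitK mulr0.
exists (fun zw => \sum_(i < m) c' i (ptl zw) * h i (ptr zw)); split.
  by eexists; apply: (reps_ord c'H Hh).
apply: (@le_lt_trans _ _ (e / 2)%:E); last by rewrite lte_fin ltr_pdivrMr// ltr_pMr// ltr1n.
apply/snorm_le_wbound => zw; have := yw (ptl zw) (ptr zw).
rewrite /tensfam /= [_ * N w _]mulrC -mulrA; apply: le_trans; apply: ler_wpM2l => //.
rewrite -[X in X * _](ger0_norm (M0 g (ptl zw))) -normc_real -[X in X <= _]normcM /y /x cat_ptlr.
rewrite le_eqVlt; apply/orP; left; apply/eqP; congr (normc _); rewrite mulrBr; congr (_ - _).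
by rewrite mulr_sumr; apply: eq_bigr => i _; rewrite czE mulrA.
Qed.

(** * Completeness of the space on the product *)

Lemma ptnorm_ptl (z w : pt R (k1 + k2)) : ptnorm (subpt (ptl z) (ptl w)) <= ptnorm (subpt z w).
Proof.
rewrite !ptnormE big_split_ord /=.
have E i : normc (co (subpt (ptl z) (ptl w)) i) = normc (co (subpt z w) (lshift k2 i)).
  by rewrite !co_sub !co_ptl.
rewrite (eq_bigr _ (fun i _ => E i)).
by rewrite lerDl sumr_ge0// => i _; exact: normc_ge0.
Qed.

Lemma ptnorm_ptr (z w : pt R (k1 + k2)) : ptnorm (subpt (ptr z) (ptr w)) <= ptnorm (subpt z w).
Proof.
rewrite !ptnormE big_split_ord /=.
have E i : normc (co (subpt (ptr z) (ptr w)) i) = normc (co (subpt z w) (rshift k1 i)).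
  by rewrite !co_sub !co_ptr.
rewrite (eq_bigr _ (fun i _ => E i)).
by rewrite lerDr sumr_ge0// => i _; exact: normc_ge0.
Qed.

(** Property (c) of both families: near each point some seminorm dominates the supremum norm, so a
    Cauchy sequence for the seminorms is locally uniformly Cauchy. *)
Lemma tensfam_local_lower (x : pt R (k1 + k2)) : exists gw (r c : R), [/\ 0 < r, 0 < c &
  forall y, ptnorm (subpt y x) <= r -> c <= MN gw y].
Proof.
have [g [r1 [c1 [r10 [c10 H1]]]]] := df_c dfM (ptl x).
have [w [r2 [c2 [r20 [c20 H2]]]]] := df_c dfN (ptr x).
have m0 : 0 < Num.min r1 r2 by rewrite lt_min r10.
exists (g, w), (Num.min r1 r2 / 2), (c1 * c2); split; [exact: divr_gt0|exact: mulr_gt0|move=> y yx].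
have yx' : ptnorm (subpt y x) < Num.min r1 r2.
  by rewrite (le_lt_trans yx)// ltr_pdivrMr// ltr_pMr// ltr1n.
move: yx'; rewrite lt_min => /andP[y1 y2].
apply: ler_pM; [exact: ltW|exact: ltW|apply: H1|apply: H2].
- exact: le_lt_trans (ptnorm_ptl _ _) y1.
- exact: le_lt_trans (ptnorm_ptr _ _) y2.
Qed.

Lemma tensor_complete (u : nat -> pt R (k1 + k2) -> C) : (forall m, inH MN (u m)) ->
  (forall gw (e : R), 0 < e -> exists m0, forall m m', (m0 <= m)%N -> (m0 <= m')%N ->
     (snorm (MN gw) (fun zw => (u m zw - u m' zw)%R) < e%:E)%E) ->
  exists v, inH MN v /\
    forall gw (e : R), 0 < e -> exists m0, forall m, (m0 <= m)%N ->
      (snorm (MN gw) (fun zw => (u m zw - v zw)%R) < e%:E)%E.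
Proof.
move=> Hu cau.
have MN0 gw x : 0 <= MN gw x by exact: tensfam_ge0.
have {}cau gw (e : R) : 0 < e -> exists m0, forall m m', (m0 <= m)%N -> (m0 <= m')%N ->
     wbound (MN gw) (fun zw => u m zw - u m' zw) e.
  move=> /(cau gw)[m0 Hm]; exists m0 => m m' mm mm'.
  by apply/snorm_le_wbound/ltW/Hm.
have loc x : exists2 r : R, 0 < r & forall e : R, 0 < e -> exists m0, forall m m', (m0 <= m)%N -> (m0 <= m')%N ->
    forall y, ptnorm (subpt y x) <= r -> normc (u m y - u m' y) <= e.
  have [gw [r [c [r0 c0 Hc]]]] := tensfam_local_lower x; exists r => // e e0.
  have [m0 Hm] := cau gw _ (mulr_gt0 c0 e0); exists m0 => m m' mm mm' y yr.
  rewrite -(ler_pM2l c0); apply: le_trans (Hm m m' mm mm' y).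
  by rewrite ler_wpM2r ?normc_ge0// Hc.
have /choice[v Hv] : forall x, exists l, forall e : R, 0 < e -> exists m0, forall m, (m0 <= m)%N -> normc (u m x - l) <= e.
  move=> x; apply: complex_complete => e e0; have [r r0 H] := loc x.
  have [m0 Hm] := H e e0; exists m0 => m m' mm mm'; apply: Hm => //.
  by rewrite subptt ptnorm_zero ltW.
(* Passage to the limit [m'] in a Cauchy inequality at one point; used with [c = 1] for local
   uniform convergence and with [c] the value of a weight for the seminorms. *)
have lim m0 (c K : R) x : 0 <= c -> (forall m m', (m0 <= m)%N -> (m0 <= m')%N -> c * normc (u m x - u m' x) <= K) ->
    forall m, (m0 <= m)%N -> c * normc (u m x - v x) <= K.
  move=> c0 H m mm; apply/ler_addgt0Pr => e e0.
  have c1 : 0 < c + 1 by rewrite ltr_wpDl.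
  have [m1 Hm1] := Hv x _ (divr_gt0 e0 c1).
  have h1 := H m (maxn m0 m1) mm (leq_maxl _ _).
  have h2 := Hm1 (maxn m0 m1) (leq_maxr _ _).
  have -> : u m x - v x = (u m x - u (maxn m0 m1) x) + (u (maxn m0 m1) x - v x) by ring.
  apply: le_trans (ler_wpM2l c0 (normcD _ _)) _; rewrite mulrDr; apply: lerD => //.
  apply: le_trans (ler_wpM2l c0 h2) _.
  by rewrite mulrCA ler_piMr ?(ltW e0)// ler_pdivrMr// mul1r lerDl.
have ev : entire v.
  apply: (@entire_limit _ _ u) => [m|x]; first exact: (Hu m).1.
  have [r r0 H] := loc x; exists r => // e e0; have [m0 Hm] := H e e0.
  exists m0 => m mm y yr; rewrite -[normc _]mul1r.
  apply: (lim m0 1 e y ler01) => // m1 m2 h1 h2.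
  by rewrite mul1r; exact: Hm.
have conv gw (e : R) : 0 < e -> exists m0, forall m, (m0 <= m)%N -> wbound (MN gw) (fun x => u m x - v x) e.
  move=> /(cau gw)[m0 Hm]; exists m0 => m mm x; apply: (lim m0) => // m1 m2 h1 h2.
  exact: Hm.
exists v; split.
  apply: inH_intro => // gw; have [m0 Hm] := conv gw 1 ltr01.
  have [K HK] := inH_wbound MN0 gw (Hu m0); exists (K + 1).
  have := wboundB (MN0 gw) HK (Hm m0 (leqnn _)); congr (wbound _ _ _).
  by apply/funext => x; rewrite opprB addrC subrK.
move=> gw e e0; have e20 : 0 < e / 2 by rewrite divr_gt0.
have [m0 Hm] := conv gw _ e20; exists m0 => m /Hm /snorm_le_wbound /le_lt_trans; apply.
by rewrite lte_fin ltr_pdivrMr// ltr_pMr// ltr1n.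
Qed.

End Main.

Unset Implicit Arguments.

Theorem theorem3p10 (R : realType) (k1 k2 : nat) (I J : Type)
  (M : I -> pt R k1 -> R) (N : J -> pt R k2 -> R) :
  defining_family M -> defining_family N ->
  (* (I) *)
  (forall w : J, exists (w' : J) (L : pt R k2 -> R),
     (forall x, 0 <= L x) /\
     (exists K : R, forall x, L x <= K) /\
     measurable_fun [set: pt R k2] L /\
     (iint (fun x => (L x)%:E) < +oo)%E /\
     (forall x, N w x <= L x * N w' x) /\
     (forall e : R, 0 < e -> exists r : R, forall x, r < ptnorm x -> L x < e)) ->
  (* (II) *)
  (forall w : J, exists (w' : J) (B : set (pt R k2)) (c : R),
     (exists r : R, 0 < r /\ forall x, ptnorm x < r -> B x) /\ 0 < c /\
     forall x x', B x' -> N w x <= c * N w' (addpt x x')) ->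
  proj_tensor_iso M N.
Proof.
move=> dfM dfN HI HII; split; first by move=> f h Hf Hh; apply: (inH_Phi (df_nonneg dfM) (df_nonneg dfN)).
split.
  move=> g w; exists g, w, 1; split => // u Hu; rewrite mul1e.
  exact: (snorm_le_projsn (df_nonneg dfM) (df_nonneg dfN)).
split; first exact: projsn_upper.
split; first by move=> u Hu g w e; exact: tensor_dense.
exact: tensor_complete.
Qed.
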